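(* Let $F$ be a subset of $\mathbb{N}\times\mathbb{N}$ containing a sequence $(\tilde p_n,\tilde q_n)\in F$, $n=1,2,\ldots$, with $\tilde p_n\to+\infty$ and $\tilde q_n\to+\infty$. Let $\Omega\subset\mathbb{C}$ be an open set. Then there exists a function $f\in X^\infty(\Omega)$ that satisfies the following. For every compact set $K\subset\mathbb{C}\setminus\overline{\Omega}$ and every rational function $h$ there exists a sequence $(p_n,q_n)\in F$, $n=1,2,\ldots$, such that for every compact set $L\subset\overline{\Omega}$ there exists $n(L)\in\mathbb{N}$ with $$f\in\mathcal{D}_{p_n,q_n}(\zeta)\quad\text{for all } n\ge n(L)\text{ and } \zeta\in L,$$ $$f\in E_{p_n,q_n,\zeta}(K\cup L)\quad\text{for all } n\ge n(L)\text{ and } \zeta\in L,$$ and $$\sup_{\zeta\in L}\sup_{z\in K}\chi\big([f;p_n/q_n]_\zeta(z),h(z)\big)\to0\quad\text{as } n\to+\infty,$$ $$\sup_{\zeta\in L}\sup_{z\in L}\big|[f;p_n/q_n]_\zeta^{(\ell)}(z)-f^{(\ell)}(z)\big|\to0\quad\text{as } n\to+\infty,\ \text{for all } \ell=0,1,2,\ldots.$$ Moreover, the set of all such functions $f\in X^\infty(\Omega)$ is dense and $G_\delta$ in $X^\infty(\Omega)$.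
   Context: $\mathbb{N}=\{0,1,2,\ldots\}$. Closures $\overline{\Omega}$ are taken in $\mathbb{C}$. Function spaces. For an open set $\Omega\subseteq\mathbb{C}$, $A^\infty(\Omega)$ is the set of holomorphic functions $f$ on $\Omega$ such that for every $\ell\in\{0,1,2,\ldots\}$ the derivative $f^{(\ell)}$ extends continuously to $\overline{\Omega}$ (the extension is still denoted $f^{(\ell)}$). It is a Fréchet space with the topology defined by the seminorms $\sup_{z\in \overline{\Omega},|z|\le n}|f^{(\ell)}(z)|$, $\ell\in\{0,1,2,\ldots\}$, $n\in\mathbb{N}$. $X^\infty(\Omega)$ is the closure in $A^\infty(\Omega)$ of the set of all rational functions with poles off $\overline{\Omega}$, with the subspace topology. Chordal metric. On $\mathbb{C}\cup\{\infty\}$, $\chi(a,b)=\frac{|a-b|}{\sqrt{1+|a|^2}\sqrt{1+|b|^2}}$ for $a,b\in\mathbb{C}$, $\chi(a,\infty)=\frac{1}{\sqrt{1+|a|^2}}$ for $a\in\mathbb{C}$, $\chi(\infty,\infty)=0$. Rational functions are regarded as taking values in $\mathbb{C}\cup\{\infty\}$. Padé approximants. For $f\in X^\infty(\Omega)$ and $\zeta\in\overline{\Omega}$ put $a_n=a_n(f,\zeta)=f^{(n)}(\zeta)/n!$ for $n\ge0$ and $a_n=0$ for $n<0$. Let $p,q$ be nonnegative integers. Write $f\in\mathcal{D}_{p,q}(\zeta)$ if $q=0$, or if $q\ge1$ and the $q\times q$ Hankel determinant $\det(a_{p-q+i+j-1})_{1\le i,j\le q}$ is nonzero. Let $S_k(f,\zeta)(z)=\sum_{\nu=0}^k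 a_\nu(z-\zeta)^\nu$ if $k\ge0$ and $S_k=0$ if $k<0$. Define (Jacobi formula) $A(f,\zeta)(z)$ and $B(f,\zeta)(z)$ as the determinants of the $(q+1)\times(q+1)$ matrices with first rows, respectively, $$\big((z-\zeta)^qS_{p-q}(f,\zeta)(z),\ (z-\zeta)^{q-1}S_{p-q+1}(f,\zeta)(z),\ \ldots,\ S_p(f,\zeta)(z)\big)\quad\text{and}\quad\big((z-\zeta)^q,\ (z-\zeta)^{q-1},\ \ldots,\ 1\big),$$ and, in both cases, with $(i+1)$-th row $(a_{p-q+i},a_{p-q+i+1},\ldots,a_{p+i})$ for $i=1,\ldots,q$. For $f\in\mathcal{D}_{p,q}(\zeta)$ the Padé approximant is $[f;p/q]_\zeta(z)=A(f,\zeta)(z)/B(f,\zeta)(z)$; it is the unique rational function $\phi=A/B$ with $\deg A\le p$, $\deg B\le q$, $B(\zeta)\ne0$, whose Taylor coefficients at $\zeta$ of orders $0,\ldots,p+q$ are $a_0,\ldots,a_{p+q}$. $[f;p/q]_\zeta^{(\ell)}$ is its $\ell$-th derivative in $z$. Write $f\in E_{p,q,\zeta}(K)$ if the polynomials $A(f,\zeta)$ and $B(f,\zeta)$ given by the Jacobi formula have no common zero in $K$. *)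

(* Defs.v *)
From HB Require Import structures.
From mathcomp Require Import all_boot all_order all_algebra.
From mathcomp Require Import complex.
From mathcomp Require Import all_classical all_reals all_analysis.

Set Implicit Arguments.
Unset Strict Implicit.
Unset Printing Implicit Defensive.

Import Order.TTheory GRing.Theory Num.Theory.
Import numFieldNormedType.Exports.

Local Open Scope classical_set_scope.
Local Open Scope ring_scope.

(* The complex numbers. The wrapper is what lets the topology and the normed
   structure that MathComp-Analysis puts on an abstract [numClosedFieldType]
   be inferred; they are not declared on [R[i]] itself. *)
Definition Cplx (R : realType) : numClosedFieldType := complex R.

(* The modulus with values in [R]: [`|z|] would have type [Cplx R]. *)
Definition modulus (R : realType) (z : Cplx R) : R := ComplexField.Normc.normc z.

(* Supremum of a family of nonnegative quantities, taken in [0, +oo]; unlike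
   [ereal_sup], it is 0 (and not -oo) when the index set is empty. *)
Definition nnsup (R : realType) (T : Type) (A : set T) (g : T -> \bar R) : \bar R :=
  maxe 0%E (ereal_sup (g @` A)).

Section FunctionSpaces.
Context {R : realType}.
Local Notation C := (Cplx R).
Implicit Types (Omega : set C) (h : C -> C).

Definition extends_continuously Omega h : Prop :=
  exists g : C -> C,
    {within closure Omega, continuous g} /\ (forall z, Omega z -> g z = h z).

(* The continuous extension to [closure Omega] of the [l]-th derivative of a
   function on [Omega] (meaningful when it exists, and on [closure Omega]). *)
Definition dext Omega h (l : nat) (z : C) : C :=
  lim (derive1n l h w @[w --> within Omega (nbhs z)]).

(* A function on [Omega] is represented by the total function that vanishes
   outside [Omega], so that equality of elements is equality on [Omega]. *)
Record Ainf Omega := MkAinf {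
  Ainf_fun :> C -> C ;
  Ainf_out : forall z, ~ Omega z -> Ainf_fun z = 0 ;
  Ainf_holo : forall z, Omega z -> derivable Ainf_fun z 1 ;
  Ainf_ext : forall l, extends_continuously Omega (derive1n l Ainf_fun) }.

Definition seminorm Omega (l n : nat) h : \bar R :=
  nnsup [set z | closure Omega z /\ modulus z <= n%:R]
        (fun z => (modulus (dext Omega h l z))%:E).

(* The topology defined by the seminorms: [U] is open when it contains, around
   each of its points, a ball for finitely many of them. *)
Definition Ainf_open Omega (U : set (Ainf Omega)) : Prop :=
  forall f, U f -> exists (m : nat) (eps : R), 0 < eps /\
    forall g : Ainf Omega,
      (forall l n, (l <= m)%N -> (n <= m)%N ->
         (seminorm Omega l n (fun z => g z - f z)%R < eps%:E)%E) -> U g.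

Lemma Ainf_openT Omega : @Ainf_open Omega setT.
Proof. by move=> f _; exists 0%N, 1. Qed.

Lemma Ainf_openI Omega : setI_closed (@Ainf_open Omega).
Proof.
move=> U V oU oV f [Uf Vf].
have [m [e [e0 He]]] := oU f Uf; have [m' [e' [e'0 He']]] := oV f Vf.
exists (maxn m m'), (Num.min e e'); split; first by rewrite lt_min e0.
move=> g Hg; split.
- apply: He => l n lm nm.
  apply: (lt_le_trans (Hg l n _ _)); rewrite ?leq_max ?lm ?nm //.
  by rewrite lee_fin ge_min lexx.
- apply: He' => l n lm nm.
  apply: (lt_le_trans (Hg l n _ _)); rewrite ?leq_max ?lm ?nm ?orbT //.
  by rewrite lee_fin ge_min lexx orbT.
Qed.

Lemma Ainf_open_bigU Omega (I : Type) (U : I -> set (Ainf Omega)) :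
  (forall i, Ainf_open (U i)) -> Ainf_open (\bigcup_i (U i)).
Proof.
move=> oU f [i _ Uif]; have [m [e [e0 He]]] := oU i f Uif.
by exists m, e; split=> // g Hg; exists i => //; exact: He.
Qed.

HB.instance Definition _ Omega := gen_eqMixin (Ainf Omega).
HB.instance Definition _ Omega := gen_choiceMixin (Ainf Omega).
HB.instance Definition _ Omega := isOpenTopological.Build (Ainf Omega)
  (@Ainf_openT Omega) (@Ainf_openI Omega) (@Ainf_open_bigU Omega).

Definition rational_on Omega : set (Ainf Omega) :=
  [set f : Ainf Omega | exists P Q : {poly C}, Q != 0 /\
     (forall z, closure Omega z -> Q.[z] != 0) /\
     (forall z, Omega z -> f z = P.[z] / Q.[z])].

(* As a type, this is [set_type (Xinf Omega)], which the library equips with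
   the topology induced by [Ainf Omega]. *)
Definition Xinf Omega : set (Ainf Omega) := closure (@rational_on Omega).

End FunctionSpaces.

Arguments Xinf {R} Omega.

Section RationalFunctions.
Context {R : realType}.
Local Notation C := (Cplx R).

(* [None] is the point at infinity. *)
Definition Chat : Type := one_point_compactification C.

Definition chordal (a b : Chat) : R :=
  match a, b with
  | Some u, Some v =>
      modulus (u - v) /
        (Num.sqrt (1 + modulus u ^+ 2) * Num.sqrt (1 + modulus v ^+ 2))
  | Some u, None | None, Some u => (Num.sqrt (1 + modulus u ^+ 2))^-1
  | None, None => 0
  end.

(* The rational function P / Q (with Q != 0), in lowest terms. *)
Definition rat_num (P Q : {poly C}) : {poly C} := P %/ gcdp P Q.
Definition rat_den (P Q : {poly C}) : {poly C} := Q %/ gcdp P Q.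

Definition rat_val (P Q : {poly C}) (z : C) : Chat :=
  if (rat_den P Q).[z] == 0 then None
  else Some ((rat_num P Q).[z] / (rat_den P Q).[z]).

(* The poles of P / Q are also those of all its derivatives. *)
Definition rat_deriv (P Q : {poly C}) (l : nat) (z : C) : Chat :=
  if (rat_den P Q).[z] == 0 then None
  else Some (derive1n l (fun w : C => (rat_num P Q).[w] / (rat_den P Q).[w]) z).

(* |a - w|, which is infinite when a is the point at infinity. *)
Definition cdist (a : Chat) (w : C) : \bar R :=
  if a is Some v then (modulus (v - w))%:E else +oo%E.

End RationalFunctions.

Section Pade.
Context {R : realType}.
Local Notation C := (Cplx R).
Variables (Omega : set C) (f : Ainf Omega).
Implicit Types (p q : nat) (zeta z : C).

Definition taylor_coef zeta (n : int) : C :=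
  match n with
  | Posz k => dext Omega f k zeta / (k`!)%:R
  | Negz _ => 0
  end.

Definition taylor_poly zeta (k : int) : {poly C} :=
  match k with
  | Posz m => \sum_(nu < m.+1) taylor_coef zeta nu%:Z *: ('X - zeta%:P) ^+ nu
  | Negz _ => 0
  end.

(* Row and column indices start at 0 below, hence the shifts with respect to
   the usual 1-based formulas. *)
Definition hankel p q zeta : 'M[C]_q :=
  \matrix_(i < q, j < q)
    taylor_coef zeta (p%:Z - q%:Z + i%:Z + j%:Z + 1).

Definition pade_D p q zeta : Prop := q = 0%N \/ \det (hankel p q zeta) != 0.

Definition jacobi_mx p q zeta (row0 : 'I_q.+1 -> {poly C}) : 'M[{poly C}]_q.+1 :=
  \matrix_(i < q.+1, j < q.+1)
    if i == 0%N :> nat then row0 j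
    else (taylor_coef zeta (p%:Z - q%:Z + i%:Z + j%:Z))%:P.

Definition pade_A p q zeta : {poly C} :=
  \det (jacobi_mx p zeta (fun j : 'I_q.+1 =>
    ('X - zeta%:P) ^+ (q - j) * taylor_poly zeta (p%:Z - q%:Z + j%:Z))).

Definition pade_B p q zeta : {poly C} :=
  \det (jacobi_mx p zeta (fun j : 'I_q.+1 => ('X - zeta%:P) ^+ (q - j))).

Definition pade_E p q zeta (K : set C) : Prop :=
  forall z, K z -> ~ ((pade_A p q zeta).[z] = 0 /\ (pade_B p q zeta).[z] = 0).

Definition pade_val p q zeta z : Chat :=
  rat_val (pade_A p q zeta) (pade_B p q zeta) z.

Definition pade_deriv p q zeta (l : nat) z : Chat :=
  rat_deriv (pade_A p q zeta) (pade_B p q zeta) l z.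

End Pade.

Definition pade_universal (R : realType) (F : set (nat * nat))
    (Omega : set (Cplx R)) (f : Ainf Omega) : Prop :=
  forall K : set (Cplx R), compact K -> K `<=` ~` closure Omega ->
  forall P Q : {poly Cplx R}, Q != 0 ->
  exists p q : nat -> nat,
    (forall n, F (p n, q n)) /\
    forall L : set (Cplx R), compact L -> L `<=` closure Omega ->
      exists nL : nat,
      [/\ forall n zeta, (nL <= n)%N -> L zeta -> pade_D f (p n) (q n) zeta,
          forall n zeta, (nL <= n)%N -> L zeta ->
            pade_E f (p n) (q n) zeta (K `|` L),
          nnsup L (fun zeta => nnsup K (fun z =>
            (chordal (pade_val f (p n) (q n) zeta z) (rat_val P Q z))%:E))
            @[n --> \oo] --> 0%E
        & forall l : nat,
          nnsup L (fun zeta => nnsup L (fun z =>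
            cdist (pade_deriv f (p n) (q n) zeta l z) (dext Omega f l z)))
            @[n --> \oo] --> 0%E].

(* Main.v *)
Require Import Defs.
Set Warnings "-notation-overridden,-notation-incompatible-prefix,-ambiguous-paths".
From mathcomp Require Import all_boot all_order all_algebra complex.
From mathcomp Require Import all_classical all_reals all_analysis. 
From mathcomp Require Import borel_hierarchy.
From mathcomp Require Import ring lra zify.
Import Order.TTheory GRing.Theory Num.Theory.
Import numFieldNormedType.Exports.
Set Implicit Arguments.
Unset Strict Implicit.
Unset Printing Implicit Defensive.
Local Open Scope classical_set_scope.
Local Open Scope ring_scope.

Local Notation Re := complex.Re.
Local Notation Im := complex.Im.

(* A rational function f = A / B in lowest terms with deg A = p and deg B <= q is its own
   Pade approximant of type (p, q) at every centre where B does not vanish. Hence, for a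
   compact K off the closure of Omega and a rational h, every rational f close to h on K
   whose degrees fit some (p, q) in F satisfies the requirements attached to K and h up to
   a given error. Such f are dense among the rational functions: with a Runge-type gluing
   one finds a rational function close to a given g near the closure of Omega and close to
   h on K (the poles of h in K are put back by dividing by a polynomial that vanishes
   there), and adding eta (z - c)^p with a small generic eta adjusts the degree and makes
   numerator and denominator coprime. Gluing needs no contour integral: a function close
   to 1 on K and to 0 far from K is a sum over the small squares that meet K of midpoint
   sums of the Cauchy kernel, in which the nodes on edges interior to K cancel. All the
   requirements with finite error are open conditions, and countably many of them, for h
   with coefficients in Q(i), are equivalent to universality. A Baire argument with
   rational functions at each step concludes. *)

(** * Complex analysis without integrals *)

(** Elements of [Ainf] are only assumed to be differentiable once, with each [derive1n] extending
    continuously. Everything about higher derivatives therefore rests on one fact: the derivative of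
    a continuously differentiable holomorphic function is differentiable. Cauchy's formula is
    replaced by averages over roots of unity, which come from iterated square roots of -1. Two
    obstacles shape the density step. Closeness in [Ainf] involves derivatives up to the boundary of
    [Omega]; so functions are glued on a closed neighbourhood of [Omega], from which Cauchy
    estimates give closeness of derivatives. And values of quotients are not stable where numerator
    and denominator vanish together; so each open condition is stated together with the absence of
    common zeros, and chordal distances are computed in homogeneous coordinates, where a pole is a
    point like any other. The Baire construction keeps to rational functions because only near these
    are elements of the next open set at hand; for the same reason its limit lies in [Xinf]. *)

Section Modulus.
Context {R : realType}.
Local Notation C := (Cplx R).
Implicit Types (x y z w : C).

Definition rc (a : R) : C := real_complex R a.
Definition imag_unit : C := Complex 0 1.

Lemma modulusE z : `|z| = rc (modulus z).
Proof. by case: z. Qed.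

Lemma rcD a b : rc (a + b) = rc a + rc b.
Proof. exact: (rmorphD (real_complex R)). Qed.
Lemma rcM a b : rc (a * b) = rc a * rc b.
Proof. exact: (rmorphM (real_complex R)). Qed.
Lemma rcB a b : rc (a - b) = rc a - rc b.
Proof. exact: (rmorphB (real_complex R)). Qed.
Lemma rc0 : rc 0 = 0.
Proof. exact: (rmorph0 (real_complex R)). Qed.
Lemma rc1 : rc 1 = 1.
Proof. exact: (rmorph1 (real_complex R)). Qed.
Lemma rc_nat n : rc n%:R = n%:R.
Proof. exact: (rmorph_nat (real_complex R)). Qed.

Lemma modulus_ge0 z : 0 <= modulus z.
Proof. by case: z => a b; exact: sqrtr_ge0. Qed.
Lemma modulus0 : modulus (0 : C) = 0.
Proof. exact: ComplexField.Normc.normc0. Qed.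
Lemma modulus1 : modulus (1 : C) = 1.
Proof. exact: ComplexField.Normc.normc1. Qed.
Lemma modulus_eq0 z : (modulus z == 0) = (z == 0).
Proof.
by apply/eqP/eqP => [/ComplexField.Normc.eq0_normc //|->]; rewrite modulus0.
Qed.
Lemma modulus_gt0 z : (0 < modulus z) = (z != 0).
Proof. by rewrite lt_def modulus_ge0 andbT modulus_eq0. Qed.
Lemma modulusM x y : modulus (x * y) = modulus x * modulus y.
Proof. exact: ComplexField.Normc.normcM. Qed.
Lemma modulusV x : modulus x^-1 = (modulus x)^-1.
Proof. exact: ComplexField.Normc.normcV. Qed.
Lemma modulusN x : modulus (- x) = modulus x.
Proof. exact: complex.normcN. Qed.
Lemma modulusD x y : modulus (x + y) <= modulus x + modulus y.
Proof. exact: complex.le_normcD. Qed.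
Lemma modulusX x n : modulus (x ^+ n) = modulus x ^+ n.
Proof.
by elim: n => [|n IH]; rewrite ?expr0 ?modulus1 // !exprS modulusM IH.
Qed.
Lemma modulusB x y : modulus (x - y) <= modulus x + modulus y.
Proof. by rewrite -(modulusN y); exact: modulusD. Qed.
Lemma modulus_distC x y : modulus (x - y) = modulus (y - x).
Proof. by rewrite -modulusN opprB. Qed.
Lemma modulus_dist_trans y x z :
  modulus (x - z) <= modulus (x - y) + modulus (y - z).
Proof. by apply: le_trans (modulusD _ _); rewrite addrA subrK. Qed.
Lemma ler_modulusB x y : modulus x - modulus y <= modulus (x - y).
Proof. by rewrite lerBlDr; apply: le_trans (modulusD _ _); rewrite subrK. Qed.
Lemma modulus_rc a : modulus (rc a) = `|a|.
Proof. by rewrite /modulus /= expr0n /= addr0 sqrtr_sqr. Qed.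
Lemma modulus_nat n : modulus (n%:R : C) = n%:R.
Proof. by rewrite -rc_nat modulus_rc ger0_norm. Qed.
Lemma modulus_imag_unit : modulus imag_unit = 1.
Proof. by rewrite /modulus /= expr0n /= add0r expr1n sqrtr1. Qed.
Lemma imag_unit_sqr : imag_unit ^+ 2 = -1.
Proof. exact: sqr_i. Qed.

Lemma modulus_sum (I : Type) (r : seq I) (P : pred I) (F : I -> C) :
  modulus (\sum_(i <- r | P i) F i) <= \sum_(i <- r | P i) modulus (F i).
Proof.
elim/big_rec2 : _ => [|i u v _ IH]; first by rewrite modulus0.
by apply: le_trans (modulusD _ _) _; rewrite lerD2l.
Qed.

Lemma normr_Re_le_modulus z : `|Re z| <= modulus z.
Proof.
case: z => a b; rewrite /modulus /= -sqrtr_sqr ler_sqrt ?addr_ge0 ?sqr_ge0 //.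
by rewrite lerDl sqr_ge0.
Qed.
Lemma normr_Im_le_modulus z : `|Im z| <= modulus z.
Proof.
case: z => a b; rewrite /modulus /= -sqrtr_sqr ler_sqrt ?addr_ge0 ?sqr_ge0 //.
by rewrite lerDr sqr_ge0.
Qed.
Lemma complex_ReIm z : z = rc (Re z) + imag_unit * rc (Im z).
Proof. exact: complexE. Qed.
Lemma modulus_le_ReIm z : modulus z <= `|Re z| + `|Im z|.
Proof.
rewrite {1}(complex_ReIm z); apply: le_trans (modulusD _ _) _.
by rewrite modulusM modulus_imag_unit mul1r !modulus_rc.
Qed.
Lemma sqr_modulus z : modulus z ^+ 2 = Re z ^+ 2 + Im z ^+ 2.
Proof. by case: z => a b; rewrite /modulus /= sqr_sqrtr // addr_ge0 ?sqr_ge0. Qed.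

Lemma ReD x y : Re (x + y) = Re x + Re y. Proof. by case: x; case: y. Qed.
Lemma ReN x : Re (- x) = - Re x. Proof. by case: x. Qed.
Lemma ReB x y : Re (x - y) = Re x - Re y. Proof. by case: x; case: y. Qed.
Lemma ImB x y : Im (x - y) = Im x - Im y. Proof. by case: x; case: y. Qed.

Lemma nbhs_modulusP z (A : set C) :
  nbhs z A <-> exists2 e : R, 0 < e & forall w, modulus (w - z) < e -> A w.
Proof.
split=> [/nbhs_ballP[e /= e0 eA]|[e e0 eA]].
  (* Radii of balls have type [Cplx R]; positivity in the order of the complex numbers forces the
     imaginary part to be 0. *)
  have er : e = rc (Re e).
    by move: e0; rewrite ltcE /= => /andP[/eqP]; case: (e) => a b /= -> _.
  have Re0 : 0 < Re e by move: e0; rewrite er ltcR.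
  exists (Re e) => // w wz; apply: eA.
  by rewrite -ball_normE /ball_ /= distrC modulusE er ltcR.
apply/nbhs_ballP; exists (rc e); first by rewrite /= ltcR.
move=> w; rewrite -ball_normE /ball_ /= distrC modulusE ltcR; exact: eA.
Qed.

(** Completeness is what produces the second derivative of a holomorphic function and the limit in
    the Baire construction. *)
Lemma cauchy_seq_complex (u : nat -> C) :
  (forall e : R, 0 < e ->
    exists n0, forall m n, (n0 <= m)%N -> (n0 <= n)%N -> modulus (u m - u n) < e) ->
  exists l, forall e : R, 0 < e ->
    exists n0, forall n, (n0 <= n)%N -> modulus (u n - l) < e.
Proof.
move=> Cu.
have cvg_part (p : C -> R) : (forall x y, p (x - y) = p x - p y) ->
    (forall z, `|p z| <= modulus z) -> exists a : R, forall e : R, 0 < e ->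
    exists n0, forall n, (n0 <= n)%N -> `|p (u n) - a| < e.
  move=> pB pN; have : cauchy ((fun n => p (u n)) @ \oo).
    apply: cauchy_exP => e e0; have [n0 Hn0] := Cu e e0.
    exists (p (u n0)); exists n0 => // n /= n0n.
    by rewrite /ball /= -pB; apply: le_lt_trans (pN _) _; exact: Hn0.
  move=> /cauchy_cvg/cvg_ex[a /cvgrPdist_lt Ha]; exists a => e /Ha[n0 _ Hn0].
  by exists n0 => n /Hn0; rewrite distrC.
have [a Ha] := cvg_part _ (@ReB) normr_Re_le_modulus.
have [b Hb] := cvg_part _ (@ImB) normr_Im_le_modulus.
exists (Complex a b) => e e0; have e20 : 0 < e / 2 by rewrite divr_gt0.
have [n1 Hn1] := Ha _ e20; have [n2 Hn2] := Hb _ e20.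
exists (maxn n1 n2) => n; rewrite geq_max => /andP[/Hn1 H1 /Hn2 H2].
apply: le_lt_trans (modulus_le_ReIm _) _; rewrite ReB ImB /=.
by rewrite [ltRHS]splitr ltrD.
Qed.

(* Stated for maps of a real variable into [C] to be used along segments. *)
Lemma mean_value_le (F : R -> C) (M : R) :
  (forall t, 0 <= t <= 1 -> exists2 d : R, 0 < d & forall s, 0 <= s <= 1 ->
     `|s - t| < d -> modulus (F s - F t) <= M * `|s - t|) ->
  modulus (F 1 - F 0) <= M.
Proof.
(* Induction along the segment: the supremum [s] of the times at which the bound holds is again such
   a time, and if it were below 1 the local bound at [s] would give a later one. *)
move=> loc; pose S := [set t : R | 0 <= t <= 1 /\ modulus (F t - F 0) <= M * t].
have S0 : S 0 by rewrite /S /= lexx ler01 mulr0 subrr modulus0.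
have ubS : ubound S 1 by move=> t [/andP[]].
have supS : has_sup S by split; [exists 0|exists 1].
set s := sup S; have s0 : 0 <= s by apply: ub_le_sup => //; exists 1.
have s1 : s <= 1 by apply: ge_sup => //; exists 0.
have s01 : 0 <= s <= 1 by rewrite s0.
have [d d0 Hd] := loc s s01.
have Ss : S s.
  split => //; have [t [t01 Ft] st] := sup_adherent d0 supS.
  rewrite -/s in st; have ts : t <= s by apply: ub_le_sup => //; exists 1.
  apply: le_trans (modulus_dist_trans (F t) _ _) _.
  have := Hd t t01; rewrite ler0_norm ?subr_le0 // modulus_distC.
  move=> /(_ ltac:(lra)); lra.
have [s_lt1|] := ltP s 1; last first.
  move=> s1'; have sE : s = 1 by apply/eqP; rewrite eq_le s1 s1'.
  by case: Ss; rewrite sE mulr1.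
pose t := Num.min 1 (s + d / 2).
have st : s < t by rewrite /t lt_min s_lt1 /=; lra.
have t1 : t <= 1 by rewrite /t ge_min lexx.
have td : t <= s + d / 2 by rewrite /t ge_min lexx orbT.
have t01 : 0 <= t <= 1 by rewrite t1 andbT; lra.
suff /(ub_le_sup (ex_intro _ 1 ubS)) : S t by rewrite leNgt st.
split => //; apply: le_trans (modulus_dist_trans (F s) _ _) _.
have := Hd t t01; rewrite ger0_norm ?subr_ge0; last by lra.
by move=> /(_ ltac:(lra)); case: Ss; lra.
Qed.

(** A first-order expansion without division and with a real [e]; the non-strict bound makes [w = z]
    harmless. *)
Definition cderiv (f : C -> C) z (d : C) := forall e : R, 0 < e ->
  exists2 r : R, 0 < r & forall w, modulus (w - z) < r ->
    modulus (f w - f z - d * (w - z)) <= e * modulus (w - z).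

Lemma cderivP f z d : cderiv f z d <-> is_derive z (1 : C) f d.
Proof.
have E : (fun h : C => h^-1 *: ((f \o shift z) (h *: (1 : C)) - f z)) @ 0^' --> d
    <-> cderiv f z d.
  split=> [/cvgrPdist_le H e e0|H].
    have /H/nbhs_modulusP[r r0 Hr] : 0 < rc e by rewrite ltcR.
    exists r => // w wz; have [->|wNz] := eqVneq w z.
      by rewrite !subrr mulr0 subrr modulus0 mulr0.
    have wz0 : w - z != 0 by rewrite subr_eq0.
    have := Hr (w - z); rewrite subr0 => /(_ wz wz0) /=.
    rewrite /GRing.scale /= mulr1 subrK modulusE lecR => K.
    have -> : f w - f z - d * (w - z) =
      - ((d - (w - z)^-1 * (f w - f z)) * (w - z)).
      by rewrite mulrBl opprB mulrAC mulVf // mul1r.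
    by rewrite modulusN modulusM ler_wpM2r ?modulus_ge0.
  apply/cvgrPdist_le => e e0.
  have er : e = rc (Re e).
    by move: e0; rewrite ltcE /= => /andP[/eqP]; case: (e) => a b /= -> _.
  have Re0 : 0 < Re e by move: e0; rewrite er ltcR.
  have [r r0 Hr] := H _ Re0; apply/nbhs_modulusP; exists r => // h.
  rewrite subr0 => hr hN0; rewrite modulusE er lecR /= /GRing.scale /= mulr1.
  have := Hr (h + z); rewrite addrK => /(_ hr).
  have -> : f (h + z) - f z - d * h = - (d - h^-1 * (f (h + z) - f z)) * h.
    by rewrite mulNr mulrBl opprB mulrAC mulVf // mul1r.
  by rewrite modulusM modulusN ler_pM2r ?modulus_gt0.
split=> [/E H|[]].
  split; first by apply/cvg_ex; exists d.
  exact: norm_cvg_lim H.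
by move=> /cvg_ex[l Hl] dE; apply/E; rewrite -dE /derive (norm_cvg_lim Hl).
Qed.

Lemma cvg_modulusP (T : Type) (F : set_system T) {FF : Filter F} (f : T -> C) l :
  f x @[x --> F] --> l <->
  forall e : R, 0 < e -> \forall x \near F, modulus (f x - l) < e.
Proof.
split=> [/cvgrPdist_lt H e e0|H]; last first.
  apply/cvgrPdist_lt => e e0.
  have er : e = rc (Re e).
    by move: e0; rewrite ltcE /= => /andP[/eqP]; case: (e) => a b /= -> _.
  have Re0 : 0 < Re e by move: e0; rewrite er ltcR.
  by apply: filterS (H _ Re0) => x; rewrite distrC modulusE er ltcR.
have e0' : 0 < rc e by rewrite ltcR.
by apply: filterS (H _ e0') => x; rewrite distrC modulusE ltcR.
Qed.

Lemma cvg_at_modulusP (f : C -> C) z l : f w @[w --> z] --> l <->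
  forall e : R, 0 < e -> exists2 r : R, 0 < r &
    forall w, modulus (w - z) < r -> modulus (f w - l) < e.
Proof.
have E := @cvg_modulusP C (nbhs z) _ f l.
split=> [/E H e /H/nbhs_modulusP//|H].
by apply/E => e /H ?; exact/nbhs_modulusP.
Qed.

Lemma continuous_modulusP (f : C -> C) z : {for z, continuous f} <->
  forall e : R, 0 < e -> exists2 r : R, 0 < r &
    forall w, modulus (w - z) < r -> modulus (f w - f z) < e.
Proof. exact: cvg_at_modulusP. Qed.

End Modulus.

(** * Rules for complex derivatives and the derivatives of rational functions *)

Section ComplexDerivative.
Context {R : realType}.
Local Notation C := (Cplx R).
Implicit Types (z w d : C) (f g : C -> C) (P Q : {poly C}).

Lemma cderiv_derive1 f z d : cderiv f z d -> derive1 f z = d.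
Proof. by move=> /cderivP H; rewrite derive1E; exact: derive_val. Qed.

Lemma cderiv_eq f z d d' : cderiv f z d -> d = d' -> cderiv f z d'.
Proof. by move=> + <-. Qed.

Lemma derivable_cderiv f z : derivable f z (1 : C) <-> cderiv f z (derive1 f z).
Proof.
split=> [H|/cderivP[]//]; apply/cderivP; rewrite derive1E; exact: derivableP.
Qed.

Lemma cderiv_near f g z d : (\forall w \near z, f w = g w) ->
  cderiv f z d -> cderiv g z d.
Proof. by move=> fg /cderivP H; apply/cderivP; exact: near_eq_is_derive H. Qed.

Lemma cderiv_cst (c : C) z : cderiv (fun=> c) z 0.
Proof. by apply/cderivP; exact: is_derive_cst. Qed.

Lemma cderiv_id z : cderiv id z 1.
Proof. by apply/cderivP; exact: is_derive_id. Qed.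

Lemma cderivD f g z d d' : cderiv f z d -> cderiv g z d' ->
  cderiv (fun w => f w + g w) z (d + d').
Proof. by move=> /cderivP ? /cderivP ?; apply/cderivP; exact: is_deriveD. Qed.

Lemma cderivB f g z d d' : cderiv f z d -> cderiv g z d' ->
  cderiv (fun w => f w - g w) z (d - d').
Proof. by move=> /cderivP ? /cderivP ?; apply/cderivP; exact: is_deriveB. Qed.

Lemma cderivM f g z d d' : cderiv f z d -> cderiv g z d' ->
  cderiv (fun w => f w * g w) z (d * g z + f z * d').
Proof.
move=> /cderivP ? /cderivP ?; apply/cderivP; rewrite addrC (mulrC d).
exact: is_deriveM.
Qed.

Lemma cderivMl (c : C) f z d : cderiv f z d -> cderiv (fun w => c * f w) z (c * d).
Proof.
by move=> /(cderivM (cderiv_cst c z)); rewrite mul0r add0r.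
Qed.

Lemma cderiv_sum n (F : 'I_n -> C -> C) (D : 'I_n -> C) z :
  (forall i, cderiv (F i) z (D i)) ->
  cderiv (fun w => \sum_(i < n) F i w) z (\sum_(i < n) D i).
Proof.
move=> H; apply: (@cderiv_near (\sum_(i < n) F i)).
  by near=> w; rewrite fct_sumE.
by apply/cderivP/is_derive_sum => i; exact/cderivP/H.
Unshelve. all: by end_near. Qed.

Lemma cderiv_horner P z : cderiv (horner P) z P^`().[z].
Proof.
elim/poly_ind: P => [|P c IH].
  rewrite derivC horner0; apply: cderiv_near (cderiv_cst 0 z).
  by near=> w; rewrite horner0.
apply: (@cderiv_near (fun w => P.[w] * w + c)).
  by near=> w; rewrite hornerMXaddC.
have := cderivD (cderivM IH (cderiv_id z)) (cderiv_cst c z).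
by move=> /cderiv_eq; apply; rewrite derivMXaddC !hornerE addrC.
Unshelve. all: by end_near. Qed.

Lemma cderiv_continuous f z d : cderiv f z d -> {for z, continuous f}.
Proof.
move=> H; apply/continuous_modulusP => e e0.
have [r r0 Hr] := H 1 ltr01; have m0 := modulus_ge0 d.
exists (Num.min r (e / (1 + modulus d))).
  by rewrite lt_min r0 divr_gt0 //; lra.
move=> w; rewrite lt_min => /andP[/Hr H1 H2].
have -> : f w - f z = (f w - f z - d * (w - z)) + d * (w - z) by rewrite subrK.
apply: le_lt_trans (modulusD _ _) _; rewrite modulusM.
move: H2; rewrite ltr_pdivlMr; [|lra]; lra.
Qed.

Lemma continuous_neq0 f z : {for z, continuous f} -> f z != 0 ->
  exists2 r : R, 0 < r & forall w, modulus (w - z) < r -> f w != 0.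
Proof.
move=> /continuous_modulusP H; rewrite -modulus_gt0 => /H[r r0 Hr].
exists r => // w /Hr; apply: contraTneq => ->.
by rewrite sub0r modulusN ltxx.
Qed.

Lemma cderivV f z d : f z != 0 -> cderiv f z d ->
  cderiv (fun w => (f w)^-1) z (- d / (f z) ^+ 2).
Proof.
move=> fz0 H.
(* The difference quotient, filled in at [z] so that it is continuous there; the quotient of [1 / f]
   is expressed through it. *)
pose q w := if w == z then d else (f w - f z) / (w - z).
have qd : q w @[w --> z] --> d.
  apply/cvg_at_modulusP => e e0; have [|r r0 Hr] := H (e / 2); first by rewrite divr_gt0.
  exists r => // w /Hr; rewrite /q.
  case: eqVneq => [-> _|wz]; first by rewrite subrr modulus0.
  have wz0 : w - z != 0 by rewrite subr_eq0.
  rewrite -{1}(mulfVK wz0 (f w - f z)) -mulrBl modulusM ler_pM2r ?modulus_gt0 //.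
  lra.
have fc := cderiv_continuous H.
have L : (- q w / (f w * f z)) @[w --> z] --> - d / (f z * f z).
  have ff : (f w * f z)^-1 @[w --> z] --> (f z * f z)^-1.
    have fz20 : f z * f z != 0 by rewrite mulf_neq0.
    exact: (cvgV fz20 (cvgM fc (cvg_cst (f z)))).
  exact: (cvgM (cvgN qd) ff).
move=> e e0; have /cvg_at_modulusP/(_ e e0)[r2 r20 Hr2] := L.
have [r1 r10 Hr1] := continuous_neq0 fc fz0.
exists (Num.min r1 r2); first by rewrite lt_min r10.
move=> w; rewrite lt_min => /andP[/Hr1 fw0 /Hr2/ltW].
rewrite /q; case: eqVneq => [-> _|wz].
  by rewrite !subrr mulr0 subr0 modulus0 mulr0.
have wz0 : w - z != 0 by rewrite subr_eq0.
have -> : (f w)^-1 - (f z)^-1 - - d / f z ^+ 2 * (w - z) =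
    (- ((f w - f z) / (w - z)) / (f w * f z) - - d / (f z * f z)) * (w - z).
  by field; rewrite fz0 fw0 wz0.
by rewrite modulusM ler_pM2r ?modulus_gt0.
Qed.

(** The mean value inequality for [f] minus a linear map of slope [c]. With [c] a nearby value of
    [f1] it bounds the error of linearization by the oscillation of the derivative. *)
Lemma cderiv_segment_le f f1 a b (c : C) (M : R) :
  (forall t, 0 <= t <= 1 -> cderiv f (a + rc t * (b - a)) (f1 (a + rc t * (b - a)))) ->
  (forall t, 0 <= t <= 1 -> modulus (f1 (a + rc t * (b - a)) - c) <= M) ->
  modulus (f b - f a - c * (b - a)) <= M * modulus (b - a).
Proof.
move=> df f1M; have [->|ab] := eqVneq b a.
  by rewrite !subrr mulr0 subr0 modulus0 mulr0.
have ba0 : 0 < modulus (b - a) by rewrite modulus_gt0 subr_eq0.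
rewrite -ler_pdivrMr //; apply/ler_addgt0Pr => e e0.
rewrite ler_pdivrMr //.
pose F t := f (a + rc t * (b - a)) - c * (rc t * (b - a)).
have -> : f b - f a - c * (b - a) = F 1 - F 0.
  by rewrite /F rc0 rc1 !mul0r mulr0 addr0 subr0 !mul1r [a + _]addrC subrK addrAC.
apply: mean_value_le => t t01; have [r r0 Hr] := df t t01 e e0.
exists (r / modulus (b - a)); first by rewrite divr_gt0.
move=> s s01; rewrite ltr_pdivlMr // => st.
have E : a + rc s * (b - a) - (a + rc t * (b - a)) = rc (s - t) * (b - a).
  by rewrite rcB; ring.
have := Hr (a + rc s * (b - a)); rewrite E modulusM modulus_rc => /(_ st) K.
set u := f (a + rc s * (b - a)) - _ - _ in K.
have -> : F s - F t = u + (f1 (a + rc t * (b - a)) - c) * (rc (s - t) * (b - a)).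
  by rewrite /F /u rcB; ring.
apply: le_trans (modulusD _ _) _; rewrite [modulus (_ * _)]modulusM.
rewrite modulusM modulus_rc.
have st0 : 0 <= `|s - t| * modulus (b - a) by rewrite mulr_ge0 ?modulus_ge0.
have := ler_wpM2r st0 (f1M t t01); lra.
Qed.

Lemma derive1n_open (U : set C) f g l : open U -> (forall z, U z -> f z = g z) ->
  forall z, U z -> derive1n l f z = derive1n l g z.
Proof.
move=> oU fg; elim: l => [//|l IH] z Uz; rewrite !derive1nS !derive1E.
apply: (near_eq_derive (1 : C)).
have : \forall w \near z, U w by exact: open_nbhs_nbhs.
by apply: filterS => w /IH.
Qed.

(* The [l]-th derivative of [P / Q] is [rat_dnum P Q l / Q ^ l.+1]. *)
Fixpoint rat_dnum P Q (l : nat) : {poly C} :=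
  if l is l'.+1 then
    (rat_dnum P Q l')^`() * Q - (rat_dnum P Q l' * Q^`()) *+ l'.+1
  else P.

Definition rat_fun P Q z : C := P.[z] / Q.[z].
Definition rat_der P Q l z : C := (rat_dnum P Q l).[z] / Q.[z] ^+ l.+1.

Lemma cderivX f z d n : cderiv f z d ->
  cderiv (fun w => f w ^+ n.+1) z (n.+1%:R * f z ^+ n * d).
Proof.
move=> H; elim: n => [|n IH]; first by rewrite expr0 !mul1r.
apply: (@cderiv_near (fun w => f w * f w ^+ n.+1)).
  by near=> w; rewrite -exprS.
have /cderiv_eq := cderivM H IH; apply.
by rewrite !exprS -[n.+2]addn1 natrD; ring.
Unshelve. all: by end_near. Qed.

Lemma cderiv_rat_der P Q l z : Q.[z] != 0 ->
  cderiv (rat_der P Q l) z (rat_der P Q l.+1 z).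
Proof.
move=> Qz0.
have dQ := @cderivV (fun w => Q.[w] ^+ l.+1) z _ (expf_neq0 l.+1 Qz0)
  (cderivX l (cderiv_horner Q z)).
have := cderivM (cderiv_horner (rat_dnum P Q l) z) dQ.
move=> /cderiv_eq; apply; rewrite /rat_der.
have -> : (rat_dnum P Q l.+1).[z] = (rat_dnum P Q l)^`().[z] * Q.[z] -
    l.+1%:R * ((rat_dnum P Q l).[z] * Q^`().[z]).
  by rewrite /= hornerD hornerN hornerMn !hornerM mulr_natl.
have ql0 := expf_neq0 l Qz0; rewrite expr2 !exprS.
by field; rewrite Qz0 ql0.
Qed.

Lemma open_horner_neq0 Q : open [set z : C | Q.[z] != 0].
Proof.
rewrite openE => z Qz; apply/nbhs_modulusP.
exact: continuous_neq0 (cderiv_continuous (cderiv_horner Q z)) Qz.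
Qed.

Lemma derive1n_rat P Q l z : Q.[z] != 0 ->
  derive1n l (rat_fun P Q) z = rat_der P Q l z.
Proof.
elim: l z => [|l IH] z Qz; first by rewrite /rat_der expr1.
rewrite derive1nS -(cderiv_derive1 (cderiv_rat_der P l Qz)) !derive1E.
apply: (near_eq_derive (1 : C)).
have [r r0 Hr] := continuous_neq0 (cderiv_continuous (cderiv_horner Q z)) Qz.
by apply/nbhs_modulusP; exists r => // w /Hr/IH.
Qed.

End ComplexDerivative.

(** * Averages of the Cauchy kernel over roots of unity *)

Section CauchyFormula.
Context {R : realType}.
Local Notation C := (Cplx R).
Implicit Types (z w : C) (f : C -> C).

Lemma sqrt_Re_ge0 (w : C) : exists2 v : C, v ^+ 2 = w & 0 <= Re v.
Proof.
have sq : (sqrtc w : C) ^+ 2 = w := sqr_sqrtc w.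
have [Rv|Rv] := leP 0 (Re (sqrtc w)); first by exists (sqrtc w).
by exists (- (sqrtc w : C)); rewrite ?sqrrN // ReN oppr_ge0 ltW.
Qed.

(** Iterated square roots of -1, each taken in the right half plane. If [v ^ 2 = w] then |v - 1| |v
    + 1| = |w - 1|, and |v + 1|^2 >= 2 there, so each root at least halves the squared distance to
    1. *)
Lemma exists_root_opp1 n : exists w : C,
  [/\ w ^+ (2 ^ n) = -1, modulus w = 1 & modulus (w - 1) ^+ 2 <= 4 / 2 ^+ n].
Proof.
elim: n => [|n [w [wn w1 wd]]].
  exists (-1); rewrite expr1 modulusN modulus1; split=> //.
  rewrite -opprD modulusN -[1 + 1]/(2%:R) modulus_nat expr0 divr1.
  by rewrite -natrX.
have [v vw Rv] := sqrt_Re_ge0 w; exists v; split.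
- by rewrite expnS exprM vw.
- apply/eqP; rewrite -(@pexpr_eq1 _ _ 2) ?modulus_ge0 // -modulusX vw; exact/eqP.
have v1 : modulus v ^+ 2 = 1 by rewrite -modulusX vw.
have H : 2 <= modulus (v + 1) ^+ 2.
  move: v1; rewrite !sqr_modulus; case: v {vw} Rv => a b /= Ra.
  rewrite addr0; nra.
have E : modulus (v - 1) ^+ 2 * modulus (v + 1) ^+ 2 = modulus (w - 1) ^+ 2.
  by rewrite -exprMn -modulusM -vw; congr (modulus _ ^+ 2); ring.
have p0 : 0 < 2 ^+ n :> R by rewrite exprn_gt0.
have d0 : 0 <= modulus (v - 1) ^+ 2 by rewrite exprn_ge0 ?modulus_ge0.
rewrite -E ler_pdivlMr // in wd; rewrite ler_pdivlMr ?exprn_gt0 // (exprS 2).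
by apply: le_trans wd; rewrite mulrA ler_pM2r // ler_wpM2l.
Qed.

Lemma exists_root_of_unity (tau : R) (n0 : nat) : 0 < tau ->
  exists (N : nat) (w : C), [/\ (n0 < N)%N, w ^+ N = 1, modulus w = 1,
    modulus (w - 1) < tau & forall j, (0 < j < N)%N -> w ^+ j != 1].
Proof.
move=> tau0; have [m Hm] : exists m, 4 / tau ^+ 2 < 2 ^+ m :> R.
  have [m] : exists m, 4 / tau ^+ 2 < m%:R :> R.
    by exists (Num.bound (4 / tau ^+ 2)); apply: archi_boundP; rewrite divr_ge0 ?exprn_ge0 ?ltW.
  by move=> H; exists m; apply: (lt_le_trans H); rewrite -natrX ler_nat ltnW // ltn_expl.
have [n mn n0n] : exists2 n, (m <= n)%N & (n0 <= n)%N.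
  by exists (maxn m n0); rewrite ?leq_maxl ?leq_maxr.
have [w [wn w1 wd]] := exists_root_opp1 n.
exists (2 ^ n.+1)%N, w; split=> //.
- exact: (leq_ltn_trans n0n (ltn_trans (ltnSn n) (ltn_expl n.+1 (isT : (1 < 2)%N)))).
- by rewrite expnS mulnC exprM wn sqrrN expr1n.
- rewrite -(@ltr_pXn2r _ 2) ?nnegrE ?modulus_ge0 ?ltW //.
  apply: (le_lt_trans wd); rewrite ltr_pdivrMr ?exprn_gt0 // mulrC.
  rewrite -ltr_pdivrMr ?exprn_gt0 //; apply: (lt_le_trans Hm).
  by rewrite ler_eXn2l ?ltr1n.
move=> j /andP[j0 jN]; apply/negP => /eqP wj.
(* An exponent below [2 ^ n.+1] is an odd multiple of some [2 ^ a] with [a <= n]; so [w ^ j = 1]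
   would make an odd power of [w ^ (2 ^ n) = -1] equal to 1. *)
have [a [b [aj bodd]]] : exists a b, (j = 2 ^ a * b)%N /\ odd b.
  have [b cb jb] := pfactor_coprime (isT : prime 2) j0.
  by exists (logn 2 j), b; rewrite -coprime2n mulnC -jb.
have an : (a <= n)%N.
  rewrite -ltnS -(@ltn_exp2l 2) //; apply: leq_ltn_trans jN.
  by rewrite aj leq_pmulr //; case: (b) bodd.
have : (w ^+ (2 ^ n)) ^+ b = 1.
  rewrite -exprM -(subnK an) expnD -mulnA -aj mulnC exprM wj; exact: expr1n.
rewrite wn -signr_odd bodd expr1 => /eqP.
by rewrite eq_sym -subr_eq0 opprK -[1 + 1]/(2%:R) pnatr_eq0.
Qed.

Lemma sum_root_of_unity (w : C) N : w ^+ N = 1 -> w != 1 ->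
  \sum_(k < N) w ^+ k = 0.
Proof.
move=> wN w1; apply/eqP; have := subrX1 w N; rewrite wN subrr => /esym/eqP.
by rewrite mulf_eq0 subr_eq0 (negbTE w1).
Qed.

Lemma modulus_sum_le N (F : 'I_N -> C) (c : R) :
  (forall i, modulus (F i) <= c) -> modulus (\sum_(i < N) F i) <= N%:R * c.
Proof.
move=> Fc; apply: le_trans (modulus_sum _ _ _) _.
apply: (@le_trans _ _ (\sum_(i < N) c)); first exact: ler_sum.
by rewrite sumr_const card_ord mulr_natl.
Qed.

(** The discrete Cauchy formula for the constant 1. Each kernel is a geometric sum up to order [N]
    plus a remainder with factor [y ^ N]; summing over the roots of unity kills every power of [y]
    below [N] except the zeroth. *)
Lemma cauchy_kernel_approx (w y : C) N : (0 < N)%N -> w ^+ N = 1 -> modulus w = 1 ->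
  (forall j, (0 < j < N)%N -> w ^+ j != 1) -> modulus y < 1 ->
  modulus (N%:R^-1 * \sum_(k < N) w ^+ k / (w ^+ k - y) - 1)
    <= modulus y ^+ N / (1 - modulus y).
Proof.
move=> N0 wN w1 wj y1; have N0' : N%:R != 0 :> C by rewrite pnatr_eq0 -lt0n.
have w0 : w != 0 by rewrite -modulus_gt0 w1.
have y1' : 0 < 1 - modulus y by rewrite subr_gt0.
pose v : C := w^-1; have v1 : modulus v = 1 by rewrite modulusV w1 invr1.
have vN : v ^+ N = 1 by rewrite exprVn wN invr1.
have kN (k : nat) : 1 - modulus y <= modulus (1 - y * v ^+ k).
  apply: le_trans (ler_modulusB _ _).
  by rewrite modulus1 modulusM modulusX v1 expr1n mulr1.
have k0 (k : nat) : 1 - y * v ^+ k != 0.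
  by rewrite -modulus_gt0; apply: lt_le_trans (kN k).
have -> : \sum_(k < N) w ^+ k / (w ^+ k - y) =
    \sum_(k < N) (\sum_(j < N) y ^+ j * (v ^+ j) ^+ k + y ^+ N / (1 - y * v ^+ k)).
  apply: eq_bigr => k _.
  have wk : w ^+ k != 0 by rewrite expf_neq0.
  have -> : w ^+ k / (w ^+ k - y) = (1 - y * v ^+ k)^-1.
    rewrite /v exprVn; have := k0 k; rewrite /v exprVn => k0'.
    have -> : w ^+ k - y = w ^+ k * (1 - y / w ^+ k).
      by rewrite mulrBr mulr1 mulrCA mulfV // mulr1.
    by rewrite invfM mulrA mulfV // mul1r.
  apply: (mulIf (k0 k)); rewrite mulVf // mulrDl mulfVK //.
  have -> : \sum_(j < N) y ^+ j * (v ^+ j) ^+ k = \sum_(j < N) (y * v ^+ k) ^+ j.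
    by apply: eq_bigr => j _; rewrite exprMn -!exprM mulnC.
  have := subrX1 (y * v ^+ k) N; rewrite exprMn -exprM mulnC exprM vN expr1n mulr1.
  by move=> H; rewrite -opprB mulrN mulrC -H opprB subrK.
rewrite big_split /= exchange_big /=.
have -> : \sum_(j < N) \sum_(i < N) y ^+ j * (v ^+ j) ^+ i = N%:R.
  case: N N0 {N0'} wN wj vN => // N _ wN wj vN; rewrite big_ord_recl [X in _ + X]big1 ?addr0.
    rewrite (eq_bigr (fun=> 1)) => [|i _]; last by rewrite !expr0 expr1n mul1r.
    by rewrite sumr_const card_ord.
  move=> i _; rewrite -mulr_sumr sum_root_of_unity ?mulr0 //.
    by rewrite -exprM mulnC exprM vN expr1n.
  by rewrite /v exprVn invr_eq1 wj // lift0 ltnS; exact: ltn_ord.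
rewrite mulrDr mulVf // addrAC subrr add0r modulusM modulusV modulus_nat.
rewrite ler_pdivrMl ?ltr0n //.
apply: modulus_sum_le => k; rewrite modulusM modulusV modulusX.
by rewrite ler_wpM2l ?exprn_ge0 ?modulus_ge0 // lef_pV2 ?posrE // modulus_gt0.
Qed.

Lemma cderiv_affine f a b s d : cderiv f (a + s * b) d ->
  cderiv (fun t => f (a + t * b)) s (d * b).
Proof.
move=> H e e0; have b0 : 0 < 1 + modulus b by have := modulus_ge0 b; lra.
have [|r r0 Hr] := H (e / (1 + modulus b)); first by rewrite divr_gt0.
exists (r / (1 + modulus b)); first by rewrite divr_gt0.
move=> t; rewrite ltr_pdivlMr // => tr.
have E : a + t * b - (a + s * b) = (t - s) * b by ring.
have m0 := modulus_ge0 (t - s).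
have := Hr (a + t * b); rewrite E modulusM => K.
have {}K := K ltac:(lra).
have -> : d * b * (t - s) = d * ((t - s) * b) by ring.
apply: le_trans K _; rewrite -mulrA ler_pM2l //.
rewrite ler_pdivrMl //; lra.
Qed.

(* Comparing the average at radius [rho] with the one at [w]: along the
   segments from [w] to the nodes the derivative of the average telescopes up
   to the oscillation [e] of [f'] between neighbouring points. *)
Lemma cauchy_average_approx f f1 (z0 w om : C) (rho e : R) N :
  0 < rho -> (0 < N)%N -> om ^+ N = 1 -> om != 1 -> modulus om = 1 ->
  (forall z, modulus (z - z0) <= rho -> cderiv f z (f1 z)) ->
  (forall x y, modulus (x - z0) <= rho -> modulus (y - z0) <= rho ->
     modulus (x - y) <= rho * modulus (om - 1) -> modulus (f1 x - f1 y) <= e) ->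
  modulus (w - z0) < rho ->
  forall zk : nat -> C, (forall k, zk k = z0 + rc rho * om ^+ k) ->
  modulus (N%:R^-1 * \sum_(k < N) f (zk k) * (zk k - z0) / (zk k - w)
    - f w * (N%:R^-1 * \sum_(k < N) (zk k - z0) / (zk k - w))) <= rho * e.
Proof.
move=> rho0 N0 omN om1 mom df f1e wrho zk zkE.
have N0' : N%:R != 0 :> C by rewrite pnatr_eq0 -lt0n.
have e0 : 0 <= e.
  apply: le_trans (modulus_ge0 (f1 w - f1 w)) (f1e _ _ (ltW wrho) (ltW wrho) _).
  by rewrite subrr modulus0; apply: mulr_ge0; rewrite ?modulus_ge0 // ltW.
have om10 : 0 < modulus (om - 1) by rewrite modulus_gt0 subr_eq0.
have zkz0 k : zk k - z0 = rc rho * om ^+ k by rewrite zkE addrC addKr.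
have mzk k : modulus (zk k - z0) = rho.
  by rewrite zkz0 modulusM modulus_rc modulusX mom expr1n mulr1 gtr0_norm.
have zkw k : zk k - w != 0.
  rewrite -modulus_gt0; have := modulus_dist_trans w (zk k) z0.
  rewrite mzk; lra.
have in_disc t k : 0 <= t <= 1 -> modulus (w + rc t * (zk k - w) - z0) <= rho.
  move=> /andP[t0 t1].
  have -> : w + rc t * (zk k - w) - z0 = rc (1 - t) * (w - z0) + rc t * (zk k - z0).
    by rewrite rcB rc1; ring.
  apply: le_trans (modulusD _ _) _; rewrite !modulusM !modulus_rc mzk.
  rewrite !ger0_norm ?subr_ge0 //.
  have : (1 - t) * modulus (w - z0) <= (1 - t) * rho.
    by rewrite ler_wpM2l ?subr_ge0 // ltW.
  lra.
pose kap k := (zk k - z0) / (zk k - w).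
(* [G] runs from [f w] times the average of the kernels, at [s = 0], to the average of [f] at the
   nodes, at [s = 1]. In its derivative the factor [zk k - w] cancels the denominators of the
   kernels. *)
pose G (s : C) := N%:R^-1 * \sum_(k < N) kap k * f (w + s * (zk k - w)).
pose G1 (s : C) := N%:R^-1 * \sum_(k < N) kap k * (f1 (w + s * (zk k - w)) * (zk k - w)).
have := @cderiv_segment_le R G G1 0 1 0 (rho * e).
rewrite !subr0 mul0r subr0 modulus1 mulr1.
have -> : G 1 = N%:R^-1 * \sum_(k < N) f (zk k) * (zk k - z0) / (zk k - w).
  congr (_ * _); apply: eq_bigr => k _; rewrite mul1r [w + _]addrC subrK /kap.
  by rewrite mulrC mulrA.
have -> : G 0 = f w * (N%:R^-1 * \sum_(k < N) (zk k - z0) / (zk k - w)).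
  rewrite /G mulrCA; congr (_ * _); rewrite mulr_sumr; apply: eq_bigr => k _.
  by rewrite mul0r addr0 mulrC.
apply=> t t01; rewrite add0r mulr1.
  apply: cderivMl; apply: cderiv_sum => k; apply: cderivMl.
  by apply: cderiv_affine; apply: df; exact: in_disc.
rewrite subr0.
have -> : G1 (rc t) = N%:R^-1 * \sum_(k < N) f1 (w + rc t * (zk k - w)) * (zk k - z0).
  congr (_ * _); apply: eq_bigr => k _; rewrite /kap; field; exact: zkw.
have [t0 t1] := andP t01.
(* At [t = 0] all evaluation points are [w] and the weights sum to zero. For [t > 0] the factor
   [t * (om - 1)] of the steps [x k.+1 - x k] can be cancelled at the end. *)
have [t_gt0|/(conj t0)/andP/le_anti tE] := ltP 0 t; last first.
  rewrite -tE rc0; under eq_bigr do rewrite mul0r addr0 zkz0 mulrA.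
  by rewrite -mulr_sumr sum_root_of_unity // !mulr0 modulus0 mulr_ge0 // ltW.
pose x k := w + rc t * (zk k - w).
have xS k : x k.+1 - x k = rc t * (zk k - z0) * (om - 1).
  by rewrite /x !zkE exprSr; ring.
have mxS k : modulus (x k.+1 - x k) = t * rho * modulus (om - 1).
  by rewrite xS !modulusM mzk modulus_rc gtr0_norm.
set S := \sum_(k < N) _.
(* The polygon through the [x k] closes up because [om ^+ N = 1]. Replacing each increment of [f] by
   its linear part turns this vanishing sum into a bound for [S]. *)
have tel : \sum_(k < N) (f (x k.+1) - f (x k)) = 0.
  rewrite -(big_mkord xpredT (fun k => f (x k.+1) - f (x k))).
  rewrite telescope_sumr // /x !zkE omN expr0; exact: subrr.
have : modulus (\sum_(k < N) (f (x k.+1) - f (x k) - f1 (x k) * (x k.+1 - x k)))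
    <= N%:R * (e * (t * rho * modulus (om - 1))).
  apply: modulus_sum_le => k; rewrite -[X in e * X](mxS k).
  have seg s : 0 <= s <= 1 -> modulus (x k + rc s * (x k.+1 - x k) - z0) <= rho.
    move=> /andP[s0 s1].
    have -> : x k + rc s * (x k.+1 - x k) - z0 =
      rc (1 - s) * (x k - z0) + rc s * (x k.+1 - z0) by rewrite rcB rc1; ring.
    apply: le_trans (modulusD _ _) _; rewrite !modulusM !modulus_rc.
    rewrite !ger0_norm ?subr_ge0 //.
    have := ler_wpM2l s0 (in_disc t k.+1 t01); rewrite -/(x k.+1).
    have s1' : 0 <= 1 - s by rewrite subr_ge0.
    have := ler_wpM2l s1' (in_disc t k t01); rewrite -/(x k); lra.
  apply: cderiv_segment_le => s s01; first by apply: df; exact: seg.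
  apply: f1e; [exact: seg|exact: in_disc|].
  rewrite [x k + _]addrC addrK modulusM modulus_rc mxS.
  have [s0 s1] := andP s01; rewrite ger0_norm //.
  have st : s * t <= 1 by rewrite mulr_ile1.
  rewrite !mulrA ler_pM2r // ler_piMl // ltW //.
rewrite sumrB tel sub0r modulusN.
have -> : \sum_(k < N) f1 (x k) * (x k.+1 - x k) = S * (rc t * (om - 1)).
  by rewrite /S mulr_suml; apply: eq_bigr => k _; rewrite xS; ring.
rewrite !modulusM modulus_rc gtr0_norm // modulusV modulus_nat => H.
rewrite ler_pdivrMl ?ltr0n // -(ler_pM2r (mulr_gt0 t_gt0 om10)).
apply: le_trans H _; rewrite le_eqVlt; apply/orP; left; apply/eqP; ring.
Qed.

End CauchyFormula.

(** * Compactness in the complex plane *)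

Section ComplexCompactness.
Context {R : realType}.
Local Notation C := (Cplx R).
Implicit Types (z w : C) (f : C -> C) (A K : set C).

Lemma closure_modulusP A z :
  closure A z <-> forall e : R, 0 < e -> exists2 w, A w & modulus (w - z) < e.
Proof.
split=> [H e e0|H B /nbhs_modulusP[e e0 He]].
  have [|w [Aw wz]] := H [set w | modulus (w - z) < e]; last by exists w.
  by apply/nbhs_modulusP; exists e.
by have [w Aw /He Bw] := H e e0; exists w.
Qed.

Lemma closed_modulusP A :
  (forall z, (forall e : R, 0 < e -> exists2 w, A w & modulus (w - z) < e) -> A z) ->
  closed A.
Proof. by move=> H z /closure_modulusP/H. Qed.

Lemma continuous_rc : continuous (rc : R -> C).
Proof.
move=> x; have E := @cvg_modulusP R R (nbhs x) _ rc (rc x).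
apply/E => e e0; near=> y; rewrite -rcB modulus_rc.
by near: y; apply: (@cvgr_distC_lt _ _ _ (nbhs x) _ id).
Unshelve. all: by end_near. Qed.

Lemma compact_disc (r : R) : compact [set z : C | modulus z <= r].
Proof.
pose g (u : R * R) : C := rc u.1 + imag_unit * rc u.2.
have cg : continuous g.
  move=> [a b]; apply: (@cvgD _ _ _ (nbhs (a, b))).
    exact: (@cvg_comp _ _ _ fst rc _ _ _ cvg_fst (@continuous_rc a)).
  apply: (@cvgM _ _ (nbhs (a, b))); first exact: cvg_cst.
  exact: (@cvg_comp _ _ _ snd rc _ _ _ cvg_snd (@continuous_rc b)).
have cI := @segment_compact R (- r) r.
have cg' : {within `[- r, r] `*` `[- r, r], continuous g}.
  exact: continuous_subspaceT.
apply: (subclosed_compact _ (continuous_compact cg' (compact_setX cI cI))) => [|z /= zr].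
  apply: closed_modulusP => z H; rewrite /= leNgt; apply/negP => rz.
  have [|w /= wr wz] := H (modulus z - r); first by rewrite subr_gt0.
  have := ler_modulusB z w; rewrite modulus_distC; lra.
exists (Re z, Im z); last by rewrite [RHS]complex_ReIm.
by split; rewrite /= in_itv /= -ler_norml;
  apply: le_trans zr; rewrite ?normr_Re_le_modulus ?normr_Im_le_modulus.
Qed.

(** Takes the place of finite subcovers: boundedness, uniform continuity and separation from a
    closed set are instances with a suitable [P]. *)
Lemma compact_modulusP K (P : R -> C -> Prop) : compact K ->
  (forall z, K z -> exists2 r : R, 0 < r &
     forall w d, modulus (w - z) < r -> 0 < d < r -> P d w) ->
  exists2 d : R, 0 < d & forall z, K z -> P d z.
Proof.
move=> /compact_near_coveringP cK H.
have : \forall d \near 0^'+, K `<=` P d.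
  apply: cK => z /H[r r0 Hr].
  exists ([set w | modulus (w - z) < r], [set d : R | 0 < d < r]) => /=; last first.
    by move=> [w d] /= [wz dr]; exact: Hr.
  split; first by apply/nbhs_modulusP; exists r.
  near=> d => /=; apply/andP; split; near: d; first exact: nbhs_right_gt.
  exact: nbhs_right_lt.
move=> H'; suff : \forall d \near 0^'+, 0 < d /\ K `<=` P d.
  by move=> /filter_ex[d [d0 Kd]]; exists d.
by near=> d; split; near: d => //; exact: nbhs_right_gt.
Unshelve. all: by end_near. Qed.

Lemma compact_modulus_bounded K f : compact K ->
  (forall z, K z -> {for z, continuous f}) ->
  exists2 M : R, 0 < M & forall z, K z -> modulus (f z) <= M.
Proof.
move=> cK cf; have [|d d0 Hd] := @compact_modulusP K (fun d w => modulus (f w) <= d^-1) cK.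
  move=> z Kz; have [r r0 Hr] := (continuous_modulusP f z).1 (cf z Kz) 1 ltr01.
  have M0 : 0 < modulus (f z) + 1 by have := modulus_ge0 (f z); lra.
  exists (Num.min r (modulus (f z) + 1)^-1); first by rewrite lt_min r0 invr_gt0.
  move=> w d; rewrite !lt_min => /andP[/Hr wr _] /and3P[d0 _ /ltW dM].
  have : modulus (f z) + 1 <= d^-1 by rewrite -[leLHS]invrK lef_pV2 ?posrE ?invr_gt0.
  have := ler_modulusB (f w) (f z); lra.
by exists d^-1; rewrite ?invr_gt0.
Qed.

Lemma compact_unif_continuous K f (e : R) : compact K -> 0 < e ->
  (forall z, K z -> {for z, continuous f}) ->
  exists2 d : R, 0 < d & forall x y, K x -> K y -> modulus (x - y) <= d ->
    modulus (f x - f y) <= e.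
Proof.
move=> cK e0 cf.
have [|d d0 Hd] := @compact_modulusP K (fun d x => forall y, modulus (x - y) <= d ->
    modulus (f x - f y) <= e) cK; 
  last by exists d => // x y Kx _; exact: Hd.
move=> z Kz; have e20 : 0 < e / 2 by rewrite divr_gt0.
have [r r0 Hr] := (continuous_modulusP f z).1 (cf z Kz) (e / 2) e20.
exists (r / 2); first by rewrite divr_gt0.
move=> x d xz /andP[d0 dr] y xy.
have /Hr H1 : modulus (x - z) < r by lra.
have /Hr H2 : modulus (y - z) < r.
  have := modulus_dist_trans x y z; rewrite (modulus_distC y x); lra.
have := modulus_dist_trans (f z) (f x) (f y); rewrite (modulus_distC (f z)); lra.
Qed.

Lemma compact_bounded_modulus K : compact K -> exists2 M : R, 0 < M &
  forall z, K z -> modulus z <= M.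
Proof. by move=> /(@compact_modulus_bounded K id); apply=> z _; exact: cvg_id. Qed.

Lemma compact_separated K A : compact K -> closed A -> K `<=` ~` A ->
  exists2 d : R, 0 < d & forall z w, K z -> A w -> d <= modulus (z - w).
Proof.
move=> cK cA KA.
have [|d d0 Hd] := @compact_modulusP K (fun d x => forall y, A y -> d <= modulus (x - y)) cK;
  last by exists d => // z w Kz; exact: Hd.
move=> z /KA /= nAz; have [r r0 Hr] : exists2 r : R, 0 < r &
    forall w, modulus (w - z) < r -> ~ A w.
  by apply/nbhs_modulusP; have := open_nbhs_nbhs (conj (closed_openC cA) nAz).
exists (r / 2); first by rewrite divr_gt0.
move=> x d xz /andP[d0 dr] y Ay; have := modulus_dist_trans x y z.
have [yz|] := ltP (modulus (y - z)) r; first by have := Hr y yz.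
rewrite (modulus_distC y x); lra.
Qed.

Lemma compact_disc_center (z0 : C) (r : R) : compact [set z : C | modulus (z - z0) <= r].
Proof.
apply: subclosed_compact (@compact_disc (r + modulus z0)) _.
  apply: closed_modulusP => z H; rewrite /= leNgt; apply/negP => rz.
  have [|w /= wr wz] := H (modulus (z - z0) - r); first by rewrite subr_gt0.
  have := modulus_dist_trans w z z0; rewrite (modulus_distC z w); lra.
move=> z /= zr; have := modulusD (z - z0) z0; rewrite subrK; lra.
Qed.

End ComplexCompactness.

(** * Cauchy estimates and differentiability of the derivative *)

Section CauchyEstimates.
Context {R : realType}.
Local Notation C := (Cplx R).
Implicit Types (z w : C) (f : C -> C).

(** The substitute for the Cauchy integral: a finite sum of simple fractions with poles on the
    circle. The total weight is bounded independently of [e], so estimates made on the kernels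
    survive as [e] tends to 0. *)
Lemma cauchy_approx f f1 z0 (rho M e : R) : 0 < rho -> 0 < e ->
  (forall z, modulus (z - z0) <= rho -> cderiv f z (f1 z)) ->
  (forall z, modulus (z - z0) <= rho -> {for z, continuous f1}) ->
  (forall z, modulus (z - z0) <= rho -> modulus (f z) <= M) ->
  exists (N : nat) (zk c : nat -> C),
    [/\ forall k, modulus (zk k - z0) = rho,
        \sum_(k < N) modulus (c k) <= M * rho &
        forall w, modulus (w - z0) <= rho / 2 ->
          modulus (f w - \sum_(k < N) c k / (zk k - w)) <= e].
Proof.
move=> rho0 e0 df cf1 fM.
have M0 : 0 <= M.
  by apply: le_trans (modulus_ge0 (f z0)) (fM _ _); rewrite subrr modulus0 ltW.
have [|d d0 Hd] := compact_unif_continuous (@compact_disc_center R z0 rho)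
  (_ : 0 < e / (2 * rho)) cf1; first by rewrite divr_gt0 ?mulr_gt0.
(* Since [2 ^ N] exceeds [N], this keeps the kernel error [M * (2 / 2 ^ N)] below [e / 2]; the other
   half of [e] pays for the oscillation of [f1]. *)
have [n0 Hn0] : exists n0 : nat, 4 * M / e < n0%:R.
  exists (Num.bound (4 * M / e)); apply: archi_boundP.
  by rewrite divr_ge0 ?mulr_ge0 // ltW.
have [|N [om [n0N omN mom omd omj]]] := @exists_root_of_unity R (d / rho) n0.+1.
  by rewrite divr_gt0.
have N0 : (0 < N)%N by apply: leq_ltn_trans n0N.
have om1 : om != 1 by apply: (omj 1%N); rewrite /=; lia.
pose zk k := z0 + rc rho * om ^+ k.
have zkz0 k : zk k - z0 = rc rho * om ^+ k by rewrite /zk addrC addKr.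
have mzk k : modulus (zk k - z0) = rho.
  by rewrite zkz0 modulusM modulus_rc modulusX mom expr1n mulr1 gtr0_norm.
exists N, zk, (fun k => N%:R^-1 * (f (zk k) * (zk k - z0))); split=> //.
  apply: (@le_trans _ _ (\sum_(k < N) N%:R^-1 * (M * rho))); last first.
    by rewrite sumr_const card_ord -mulrnAl -mulr_natl mulfV ?mul1r // pnatr_eq0 -lt0n.
  apply: ler_sum => k _; rewrite !modulusM modulusV modulus_nat mzk.
  rewrite ler_pM2l ?invr_gt0 ?ltr0n // ler_pM2r //; apply: fM; by rewrite mzk.
move=> w wz0.
have wrho : modulus (w - z0) < rho by lra.
have := @cauchy_average_approx R f f1 z0 w om rho (e / (2 * rho)) N rho0 N0 omN om1 mom df _ wrho zk (fun k => erefl).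
have H : forall x y : C, modulus (x - z0) <= rho -> modulus (y - z0) <= rho ->
  modulus (x - y) <= rho * modulus (om - 1) -> modulus (f1 x - f1 y) <= e / (2 * rho).
  move=> x y xz yz xy; apply: Hd => //; apply: le_trans xy _.
  by rewrite mulrC -ler_pdivlMr // ltW.
move=> /(_ H); have -> : rho * (e / (2 * rho)) = e / 2.
  by field; rewrite gt_eqF.
rewrite mulr_sumr; under eq_bigr do rewrite mulrA.
set A := \sum_(k < N) _; set S := N%:R^-1 * _ => HA.
pose y := (w - z0) / rc rho.
have rc0' : rc rho != 0 by rewrite -modulus_gt0 modulus_rc gtr0_norm.
have SE : S = N%:R^-1 * \sum_(k < N) om ^+ k / (om ^+ k - y).
  congr (_ * _); apply: eq_bigr => k _; rewrite zkz0.
  have -> : zk k - w = rc rho * (om ^+ k - y).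
    by rewrite /zk /y mulrBr mulrCA mulfV //; ring.
  by rewrite invfM mulrACA mulfV // mul1r.
(* This is where the half disc enters: it bounds the kernel error by [2 / 2 ^ N]. *)
have y12 : modulus y <= 1 / 2.
  rewrite /y modulusM modulusV modulus_rc gtr0_norm // ler_pdivrMr //; lra.
have HS : modulus (S - 1) <= 2 / 2 ^+ N.
  rewrite SE; apply: le_trans (cauchy_kernel_approx N0 omN mom omj _) _; first by lra.
  rewrite mulrC ler_pM ?exprn_ge0 ?modulus_ge0 //.
  - by rewrite invr_ge0; lra.
  - by rewrite -[leRHS]invrK lef_pV2 ?posrE ?invr_gt0 //; lra.
  rewrite -exprVn lerXn2r ?nnegrE ?modulus_ge0 ?invr_ge0 //; lra.
have HN : 4 * M / e <= 2 ^+ N.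
  apply: ltW; apply: (lt_le_trans Hn0); rewrite -natrX ler_nat.
  by apply: ltnW; apply: ltn_trans (ltn_expl N (isT : (1 < 2)%N)); apply: ltnW n0N.
have fw : modulus (f w) <= M by apply: fM; lra.
have -> : f w - A = - (A - f w * S) - f w * (S - 1) by ring.
apply: le_trans (modulusB _ _) _; rewrite modulusN modulusM.
have p0 : 0 < 2 ^+ N :> R by rewrite exprn_gt0.
have : modulus (f w) * modulus (S - 1) <= M * (2 / 2 ^+ N).
  by rewrite ler_pM ?modulus_ge0.
have : M * (2 / 2 ^+ N) <= e / 2.
  rewrite mulrA ler_pdivrMr //; move: HN; rewrite ler_pdivrMr //; lra.
lra.
Qed.

Section Nodes.
Variables (f f1 : C -> C) (z0 : C) (rho M : R).
Hypotheses (rho0 : 0 < rho).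
Hypothesis df : forall z, modulus (z - z0) <= rho -> cderiv f z (f1 z).
Hypothesis cf1 : forall z, modulus (z - z0) <= rho -> {for z, continuous f1}.
Hypothesis fM : forall z, modulus (z - z0) <= rho -> modulus (f z) <= M.

(** Difference quotients of the approximating sums are bounded kernel by kernel. The nodes are at
    distance [rho] from [z0] but only at least [rho / 2] from [z0 + h], which accounts for the
    factor 2. *)
Lemma cauchy_estimate : modulus (f1 z0) <= 2 * M / rho.
Proof.
have M0 : 0 <= M.
  by apply: le_trans (modulus_ge0 (f z0)) (fM _); rewrite subrr modulus0 ltW.
apply/ler_addgt0Pr => e e0.
have [|r r0 Hr] := df (z := z0) _ e0; first by rewrite subrr modulus0 ltW.
pose h := rc (Num.min (r / 2) (rho / 2)).
have m0 : 0 < Num.min (r / 2) (rho / 2) by rewrite lt_min !divr_gt0.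
have mh : modulus h = Num.min (r / 2) (rho / 2) by rewrite modulus_rc gtr0_norm.
have h0 : 0 < modulus h by rewrite mh.
have hr : modulus h < r.
  have : Num.min (r / 2) (rho / 2) <= r / 2 by rewrite ge_min lexx.
  rewrite mh; lra.
have hrho : modulus h <= rho / 2 by rewrite mh ge_min lexx orbT.
have := Hr (z0 + h); rewrite [z0 + h]addrC addrK => /(_ hr) H1.
rewrite -(ler_pM2r h0).
have H2 : modulus (f (h + z0) - f z0) <= 2 * M / rho * modulus h.
  apply/ler_addgt0Pr => e' e'0; have e'2 : 0 < e' / 2 by rewrite divr_gt0.
  have [N [zk [c [mzk cM Hc]]]] := cauchy_approx rho0 e'2 df cf1 fM.
  have zk0 k : zk k - z0 != 0 by rewrite -modulus_gt0 mzk.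
  have zkh (k : nat) : rho / 2 <= modulus (zk k - (h + z0)).
    have := modulus_dist_trans (h + z0) (zk k) z0; rewrite mzk addrK; lra.
  have zkh0 (k : nat) : zk k - (h + z0) != 0.
    by rewrite -modulus_gt0; apply: lt_le_trans (zkh k); rewrite divr_gt0.
  have := Hc z0; rewrite subrr modulus0 => /(_ _)/wrap[]; first by rewrite ltW // divr_gt0.
  have := Hc (h + z0); rewrite addrK => /(_ hrho).
  set A := \sum_(k < N) _; set B := \sum_(k < N) _ => HA HB.
  have AB : modulus (A - B) <= 2 * M / rho * modulus h.
    rewrite -sumrB; apply: le_trans (modulus_sum _ _ _) _.
    apply: (@le_trans _ _ (\sum_(k < N) modulus (c k) * (2 / rho ^+ 2 * modulus h))).
      apply: ler_sum => k _.
      have -> : c k / (zk k - (h + z0)) - c k / (zk k - z0) =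
        c k * ((zk k - z0)^-1 * (zk k - (h + z0))^-1 * h).
        by field; rewrite zk0 zkh0.
      rewrite !modulusM !modulusV mzk ler_wpM2l ?modulus_ge0 // ler_pM2r //.
      rewrite -(@ler_pM2l _ rho) // mulrA mulfV ?gt_eqF // mul1r.
      have -> : rho * (2 / rho ^+ 2) = (rho / 2)^-1.
        by field; rewrite gt_eqF.
      by rewrite lef_pV2 ?posrE ?divr_gt0 // modulus_gt0.
    rewrite -mulr_suml; apply: (@le_trans _ _ (M * rho * (2 / rho ^+ 2 * modulus h))).
      by rewrite ler_wpM2r // mulr_ge0 ?modulus_ge0 // divr_ge0 // exprn_ge0 // ltW.
    by rewrite le_eqVlt; apply/orP; left; apply/eqP; field; rewrite gt_eqF.
  have -> : f (h + z0) - f z0 = (f (h + z0) - A) - (f z0 - B) + (A - B) by ring.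
  apply: le_trans (modulusD _ _) _; have := modulusB (f (h + z0) - A) (f z0 - B); lra.
have -> : modulus (f1 z0) * modulus h = modulus (f1 z0 * h) by rewrite modulusM.
have := ler_modulusB (f1 z0 * h) (f (h + z0) - f z0).
rewrite (modulus_distC (f1 z0 * h)); move: H1 H2; rewrite mulrDl; lra.
Qed.

Local Notation A := (M * rho).

Let A0 : 0 <= A.
Proof.
apply: mulr_ge0; last exact: ltW.
by apply: le_trans (modulus_ge0 (f z0)) (fM _); rewrite subrr modulus0 ltW.
Qed.

(** Sums close to [f] have derivatives close to [f1]: difference quotients of both are compared over
    a step [eta] that is fixed before the accuracy [e]. The second-order remainder of the sums
    depends on them only through their total weight. *)
Let cauchy_deriv_approx w (d : R) : modulus (w - z0) <= rho / 4 -> 0 < d ->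
  exists2 e : R, 0 < e & forall (N : nat) (zk c : nat -> C),
    (forall k, modulus (zk k - z0) = rho) -> \sum_(k < N) modulus (c k) <= A ->
    (forall w, modulus (w - z0) <= rho / 2 ->
          modulus (f w - \sum_(k < N) c k / (zk k - w)) <= e) ->
    modulus (f1 w - \sum_(k < N) c k / (zk k - w) ^+ 2) <= d.
Proof.
move=> wz0 d0; have d3 : 0 < d / 3 by rewrite divr_gt0.
have rho_gt0 := rho0; have wrho : modulus (w - z0) <= rho by lra.
have [r r0 Hr] := df wrho d3.
pose B := A * (8 / rho ^+ 3) + 1.
have B0 : 0 < B by rewrite ltr_wpDl // mulr_ge0 // divr_ge0 // exprn_ge0 // ltW.
have [eta [eta0 etar etarho etaB]] : exists eta : R,
    [/\ 0 < eta, eta < r, eta <= rho / 4 & B * eta <= d / 3].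
  exists (Num.min (r / 2) (Num.min (rho / 4) (d / 3 / B))); split.
  - by rewrite !lt_min !divr_gt0.
  - by rewrite gt_min; apply/orP; left; lra.
  - by rewrite !ge_min lexx orbT.
  - by rewrite mulrC -ler_pdivlMr // !ge_min lexx !orbT.
(* Two values of [f] are replaced, at a cost of [d * eta / 3]; the expansions of [f] and of the sum
   cost as much each, and division by [eta] leaves [d]. *)
exists (d * eta / 6); first by rewrite divr_gt0 ?mulr_gt0.
move=> N zk c mzk cA Hc; pose h := rc eta.
have mh : modulus h = eta by rewrite modulus_rc gtr0_norm.
have zkw (k : nat) : rho / 2 <= modulus (zk k - w).
  have := modulus_dist_trans w (zk k) z0; rewrite mzk; lra.
have zkh (k : nat) : rho / 2 <= modulus (zk k - (h + w)).
  have := modulus_dist_trans (h + w) (zk k) z0; rewrite mzk.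
  have := modulusD h (w - z0); rewrite addrA mh; lra.
have rho2 : 0 < rho / 2 by rewrite divr_gt0.
have zkw0 (k : nat) : zk k - w != 0.
  by rewrite -modulus_gt0; apply: lt_le_trans (zkw k).
have zkh0 (k : nat) : zk k - (h + w) != 0.
  by rewrite -modulus_gt0; apply: lt_le_trans (zkh k).
have H1 := Hc w ltac:(lra).
have H2 : modulus (h + w - z0) <= rho / 2.
  have := modulusD h (w - z0); rewrite addrA mh; lra.
have {}H2 := Hc _ H2.
have := Hr (h + w); rewrite addrK mh => /(_ etar) H3.
set C0 := \sum_(k < N) _ in H1; set C1 := \sum_(k < N) _ in H2.
set D := \sum_(k < N) _.
have CD : modulus (C1 - C0 - D * h) <= B * eta * eta.
  have -> : C1 - C0 - D * h =
      \sum_(k < N) c k * (((zk k - w) ^+ 2 * (zk k - (h + w)))^-1 * h ^+ 2).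
    rewrite mulr_suml -!sumrB; apply: eq_bigr => k _.
    by field; rewrite zkw0 zkh0.
  apply: le_trans (modulus_sum _ _ _) _.
  apply: (@le_trans _ _ (\sum_(k < N) modulus (c k) * (8 / rho ^+ 3 * eta ^+ 2))).
    apply: ler_sum => k _; rewrite !modulusM modulusV modulusM !modulusX mh.
    rewrite ler_wpM2l ?modulus_ge0 // ler_pM2r ?(mulr_gt0 eta0 eta0) //.
    have -> : 8 / rho ^+ 3 = ((rho / 2) ^+ 2 * (rho / 2))^-1.
      by field; rewrite gt_eqF.
    rewrite lef_pV2 ?posrE ?mulr_gt0 ?exprn_gt0 ?modulus_gt0 //.
    apply: ler_pM => //; rewrite ?exprn_ge0 ?(ltW rho2) //.
    by rewrite lerXn2r ?nnegrE ?modulus_ge0 ?(ltW rho2).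
  rewrite -mulr_suml -[leRHS]mulrA -expr2 mulrA [B * _]mulrDl.
  apply: (@le_trans _ _ (A * (8 / rho ^+ 3) * eta ^+ 2)).
    rewrite ler_pM2r ?exprn_gt0 // ler_wpM2r // divr_ge0 // exprn_ge0 // ltW //.
  by rewrite lerDl mul1r exprn_ge0 // ltW.
have BE : B * eta * eta <= d / 3 * eta by rewrite ler_pM2r.
rewrite -(ler_pM2r eta0) -mh -modulusM.
have -> : (f1 w - D) * h = - (f (h + w) - f w - f1 w * h)
  + ((f (h + w) - C1) - (f w - C0)) + (C1 - C0 - D * h) by ring.
have := modulusB (f (h + w) - C1) (f w - C0).
have := modulusD (- (f (h + w) - f w - f1 w * h)) ((f (h + w) - C1) - (f w - C0)).
rewrite modulusN.
have := modulusD (- (f (h + w) - f w - f1 w * h) + ((f (h + w) - C1) - (f w - C0)))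
   (C1 - C0 - D * h).
rewrite mh; lra.
Qed.

Let q (h : C) := (f1 (h + z0) - f1 z0) / h.
Let B := A * (16 / rho ^+ 4) + 1.

(** Both quotients are compared with the second derivative [E] of one approximating sum at [z0]. [E]
    depends on the accuracy, but the bound on the difference of the quotients does not. *)
Let quotient_cauchy (h h' : C) : 0 < modulus h <= rho / 4 ->
  0 < modulus h' <= rho / 4 -> modulus (q h - q h') <= B * (modulus h + modulus h').
Proof.
move=> Hh Hh'; have rho_gt0 := rho0; apply/ler_addgt0Pr => e e0.
pose m := Num.min (modulus h) (modulus h').
have m0 : 0 < m by rewrite lt_min; case/andP: Hh => ->; case/andP: Hh' => ->.
(* In each quotient two values of [f1] are replaced and the result is divided by a number of modulus
   at least [m], which leaves [e / 2] per quotient. *)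
have d0 : 0 < e * m / 4 by rewrite divr_gt0 // mulr_gt0.
have zz0 : modulus (z0 - z0) <= rho / 4 by rewrite subrr modulus0 divr_ge0 // ltW.
have [e1 e10 He1] := cauchy_deriv_approx zz0 d0.
have [|e2 e20 He2] := @cauchy_deriv_approx (h + z0) _ _ d0.
  by rewrite addrK; case/andP: Hh.
have [|e3 e30 He3] := @cauchy_deriv_approx (h' + z0) _ _ d0.
  by rewrite addrK; case/andP: Hh'.
pose e' := Num.min e1 (Num.min e2 e3).
have e'0 : 0 < e' by rewrite !lt_min e10 e20.
have [le1 le2 le3] : [/\ e' <= e1, e' <= e2 & e' <= e3].
  by rewrite /e' !ge_min !lexx !orbT.
have [N [zk [c [mzk cM Hc]]]] := cauchy_approx rho0 e'0 df cf1 fM.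
have {}He1 := He1 N zk c mzk cM (fun w Hw => le_trans (Hc w Hw) le1).
have {}He2 := He2 N zk c mzk cM (fun w Hw => le_trans (Hc w Hw) le2).
have {}He3 := He3 N zk c mzk cM (fun w Hw => le_trans (Hc w Hw) le3).
pose E := \sum_(k < N) 2%:R * (c k / (zk k - z0) ^+ 3).
have zk0 k : zk k - z0 != 0 by rewrite -modulus_gt0 mzk.
have main (u : C) : 0 < modulus u <= rho / 4 ->
    modulus (f1 (u + z0) - \sum_(k < N) c k / (zk k - (u + z0)) ^+ 2) <= e * m / 4 ->
    m <= modulus u ->
    modulus (q u - E) <= B * modulus u + e / 2.
  move=> /andP[u0 urho] Hu mu.
  have zku (k : nat) : rho / 2 <= modulus (zk k - (u + z0)).
    have := modulus_dist_trans (u + z0) (zk k) z0; rewrite mzk addrK; lra.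
  have zku0 (k : nat) : zk k - (u + z0) != 0.
    by rewrite -modulus_gt0; apply: lt_le_trans (zku k); rewrite divr_gt0.
  have u0' : u != 0 by rewrite -modulus_gt0.
  set D := \sum_(k < N) _ in Hu; set D0 := \sum_(k < N) _ in He1.
  have DE : modulus (D - D0 - E * u) <= B * modulus u * modulus u.
    have -> : D - D0 - E * u = \sum_(k < N) c k * (((zk k - z0) ^+ 3 *
        (zk k - (u + z0)) ^+ 2)^-1 * (3%:R * (zk k - z0) - 2%:R * u) * u ^+ 2).
      rewrite mulr_suml -!sumrB; apply: eq_bigr => k _.
      by field; rewrite zk0 zku0.
    apply: le_trans (modulus_sum _ _ _) _.
    apply: (@le_trans _ _ (\sum_(k < N) modulus (c k) * (16 / rho ^+ 4 * modulus u ^+ 2))).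
      apply: ler_sum => k _.
      rewrite (modulusM (c k)) (modulusM _ (u ^+ 2)) (modulusM _ (_ - _)) modulusV.
      rewrite (modulusM (_ ^+ 3)) !(modulusX _ 2) (modulusX _ 3) mzk.
      rewrite ler_wpM2l ?modulus_ge0 // ler_pM2r ?(mulr_gt0 u0 u0) //.
      have -> : 16 / rho ^+ 4 = (rho ^+ 3 * (rho / 2) ^+ 2)^-1 * (4 * rho).
        by field; rewrite gt_eqF.
      apply: ler_pM; rewrite ?modulus_ge0 ?invr_ge0 ?mulr_ge0 ?exprn_ge0 ?modulus_ge0 ?(ltW rho_gt0) //.
        rewrite lef_pV2 ?posrE ?mulr_gt0 ?exprn_gt0 ?modulus_gt0 ?divr_gt0 //.
        rewrite ler_pM2l ?exprn_gt0 // lerXn2r ?nnegrE ?modulus_ge0 //.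
        by rewrite divr_ge0 // ltW.
      apply: le_trans (modulusB _ _) _; rewrite !modulusM !modulus_nat mzk; lra.
    rewrite -mulr_suml -[leRHS]mulrA -expr2 mulrA [B * _]mulrDl.
    apply: (@le_trans _ _ (A * (16 / rho ^+ 4) * modulus u ^+ 2)).
      by rewrite ler_wpM2r ?exprn_ge0 ?modulus_ge0 // ler_wpM2r // divr_ge0 // exprn_ge0 // ltW.
    by rewrite lerDl mul1r exprn_ge0 // modulus_ge0.
  rewrite -(ler_pM2r u0) -modulusM mulrBl /q mulfVK // mulrDl.
  have -> : f1 (u + z0) - f1 z0 - E * u =
    (f1 (u + z0) - D) - (f1 z0 - D0) + (D - D0 - E * u) by ring.
  apply: le_trans (modulusD _ _) _.
  have := modulusB (f1 (u + z0) - D) (f1 z0 - D0).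
  have : e * m <= e * modulus u by rewrite ler_pM2l.
  lra.
have mm : m <= modulus h /\ m <= modulus h' by rewrite !ge_min !lexx orbT.
have H1 := main h Hh He2 mm.1; have H2 := main h' Hh' He3 mm.2.
have := modulus_dist_trans E (q h) (q h'); rewrite (modulus_distC E) mulrDr; lra.
Qed.

(** The quotients along the real increments [hn n] form a Cauchy sequence. Their limit serves every
    direction because [quotient_cauchy] compares any two small increments. *)
Lemma holomorphic_deriv : exists d, cderiv f1 z0 d.
Proof.
have rho_gt0 := rho0.
have B0 : 0 < B by rewrite ltr_wpDl // mulr_ge0 // divr_ge0 // exprn_ge0 // ltW.
pose hn n := rc (rho / 4 / n.+1%:R).
have mhn n : modulus (hn n) = rho / 4 / n.+1%:R.
  by rewrite modulus_rc gtr0_norm // !divr_gt0.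
have hn_small (e : R) : 0 < e -> exists n0, forall n, (n0 <= n)%N -> modulus (hn n) < e.
  move=> e0; exists (Num.bound (rho / 4 / e)) => n n0n; rewrite mhn.
  rewrite ltr_pdivrMr // [ltRHS]mulrC -ltr_pdivrMr //.
  apply: (@lt_le_trans _ _ (Num.bound (rho / 4 / e))%:R).
    by apply: archi_boundP; rewrite !divr_ge0 // ltW.
  by rewrite ler_nat; apply: leq_trans n0n (leqnSn _).
have hnP n : 0 < modulus (hn n) <= rho / 4.
  rewrite mhn !divr_gt0 //= ler_pdivrMr // ler_peMr ?ler1n // divr_ge0 // ltW //.
have [|l Hl] := @cauchy_seq_complex R (fun n => q (hn n)).
  move=> e e0; have [|n0 Hn0] := hn_small (e / (2 * B)); first by rewrite divr_gt0 ?mulr_gt0.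
  exists n0 => m n /Hn0 Hm /Hn0 Hn; apply: le_lt_trans (quotient_cauchy (hnP _) (hnP _)) _.
  rewrite -ltr_pdivlMl //.
  have -> : B^-1 * e = e / (2 * B) + e / (2 * B) by field; rewrite gt_eqF.
  by rewrite ltrD.
exists l => e e0; exists (Num.min (rho / 4) (e / B)).
  by rewrite lt_min !divr_gt0.
move=> w; rewrite lt_min => /andP[wrho we].
have [->|wz] := eqVneq w z0; first by rewrite !subrr mulr0 subr0 modulus0 mulr0.
have wz0 : w - z0 != 0 by rewrite subr_eq0.
have m0 : 0 < modulus (w - z0) by rewrite modulus_gt0.
have -> : f1 w - f1 z0 - l * (w - z0) = (q (w - z0) - l) * (w - z0).
  by rewrite mulrBl /q mulfVK // subrK.
rewrite modulusM ler_pM2r //.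
apply: (@le_trans _ _ (B * modulus (w - z0))); last first.
  by rewrite mulrC -ler_pdivlMr // ltW.
apply/ler_addgt0Pr => e' e'0.
have [|n1 Hn1] := hn_small (e' / (2 * B)); first by rewrite divr_gt0 ?mulr_gt0.
have [|n2 Hn2] := Hl (e' / 2); first by rewrite divr_gt0.
have H1 := Hn1 _ (leq_maxl n1 n2); have H2 := Hn2 _ (leq_maxr n1 n2).
set n := maxn n1 n2 in H1 H2.
have := modulus_dist_trans (q (hn n)) (q (w - z0)) l.
have wP : 0 < modulus (w - z0) <= rho / 4 by rewrite m0 ltW.
have := quotient_cauchy wP (hnP n); rewrite mulrDr.
have : B * modulus (hn n) < e' / 2.
  rewrite -ltr_pdivlMl //; apply: lt_le_trans H1 _.
  by rewrite le_eqVlt; apply/orP; left; apply/eqP; field; rewrite gt_eqF.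
lra.
Qed.

End Nodes.
End CauchyEstimates.

(** * The topology of the space of smooth functions *)

Section AinfTopology.
Context {R : realType}.
Local Notation C := (Cplx R).
Variables (Omega : set C) (openOmega : open Omega).
Implicit Types (z w v : C) (h : C -> C) (f g : Ainf Omega).

Definition ext_lim h z v := forall e : R, 0 < e -> exists2 r : R, 0 < r &
  forall w, Omega w -> modulus (w - z) < r -> modulus (h w - v) < e.

Lemma within_closure_proper z : closure Omega z -> ProperFilter (within Omega (nbhs z)).
Proof.
move=> cz; split; last exact: within_filter.
by rewrite /within /= => /cz[w [Ow]]; apply.
Qed.

Lemma ext_limP h z v : ext_lim h z v <-> h w @[w --> within Omega (nbhs z)] --> v.
Proof.
have E := @cvg_modulusP R C (within Omega (nbhs z)) _ h v.
split=> [H|/E H e /H/nbhs_modulusP[r r0 Hr]].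
  by apply/E => e /H[r r0 Hr]; apply/nbhs_modulusP; exists r => // w wr Ow; exact: Hr.
by exists r => // w Ow wr; exact: Hr.
Qed.

Lemma dext_eq h l z v : closure Omega z -> ext_lim (derive1n l h) z v ->
  dext Omega h l z = v.
Proof.
by move=> /within_closure_proper ? /ext_limP H; exact: (norm_cvg_lim H).
Qed.

Lemma within_continuous_modulusP h : {within closure Omega, continuous h} <->
  forall z, closure Omega z -> forall e : R, 0 < e -> exists2 r : R, 0 < r &
    forall w, closure Omega w -> modulus (w - z) < r -> modulus (h w - h z) < e.
Proof.
have E z := @cvg_modulusP R C (within (closure Omega) (nbhs z)) _ h (h z).
split=> [/subspace_continuousP H z cz|H].
  have /E {}H : h @ within (closure Omega) (nbhs z) --> h z by exact: H.
  by move=> e /H/nbhs_modulusP[r r0 Hr]; exists r => // w cw wr; exact: Hr.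
apply/subspace_continuousP => z cz; apply/E => e /(H z cz)[r r0 Hr].
by apply/nbhs_modulusP; exists r => // w wr cw; exact: Hr.
Qed.

Lemma extends_continuously_lim h z : extends_continuously Omega h ->
  closure Omega z -> exists v, ext_lim h z v.
Proof.
move=> [k [/within_continuous_modulusP ck kh]] cz; exists (k z) => e e0.
have [r r0 Hr] := ck z cz e e0; exists r => // w Ow wr; rewrite -(kh w Ow).
exact: (Hr w (subset_closure Ow) wr).
Qed.

Lemma Ainf_dext f l z : closure Omega z ->
  ext_lim (derive1n l f) z (dext Omega f l z).
Proof.
move=> cz; have [v Hv] := extends_continuously_lim (Ainf_ext f l) cz.
by rewrite (dext_eq cz Hv).
Qed.

(** A value of [h'] near [z] is itself a limit of values of [h] at points of [Omega] near [z], to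
    which the estimate at [z] applies. *)
Lemma ext_lim_continuous h h' : (forall z, closure Omega z -> ext_lim h z (h' z)) ->
  {within closure Omega, continuous h'}.
Proof.
move=> hh'; apply/within_continuous_modulusP => z cz e e0.
have [|r r0 Hr] := hh' z cz (e / 2); first by rewrite divr_gt0.
exists (r / 2); first by rewrite divr_gt0.
move=> w cw wr.
have [|r' r'0 Hr'] := hh' w cw (e / 2); first by rewrite divr_gt0.
have m0 : 0 < Num.min r' (r / 2) by rewrite lt_min r'0 divr_gt0.
have [u Ou] := (closure_modulusP _ _).1 cw _ m0; rewrite lt_min => /andP[ur' ur].
have H1 := Hr' u Ou ur'.
have : modulus (u - z) < r by have := modulus_dist_trans w u z; lra.
move=> /(Hr u Ou) H2.
have := modulus_dist_trans (h u) (h' w) (h' z); rewrite (modulus_distC (h' w) (h u)); lra.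
Qed.

Lemma Ainf_dext_continuous f l : {within closure Omega, continuous (dext Omega f l)}.
Proof. by apply: ext_lim_continuous => z; exact: Ainf_dext. Qed.

Lemma open_disc_sub z : Omega z -> exists2 r : R, 0 < r &
  forall w, modulus (w - z) <= r -> Omega w.
Proof.
move=> Oz; have /nbhs_modulusP[r r0 Hr] := open_nbhs_nbhs (conj openOmega Oz).
exists (r / 2); first by rewrite divr_gt0.
by move=> w wr; apply: Hr; lra.
Qed.

Lemma extends_continuously_continuous h z : extends_continuously Omega h ->
  Omega z -> {for z, continuous h}.
Proof.
move=> [k [/within_continuous_modulusP ck kh]] Oz.
apply/continuous_modulusP => e e0.
have [r r0 Hr] := ck z (subset_closure Oz) e e0.
have [r' r'0 Hr'] := open_disc_sub Oz.
exists (Num.min r r'); first by rewrite lt_min r0.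
move=> w; rewrite lt_min => /andP[wr wr'].
have Ow : Omega w by apply: Hr'; exact: ltW.
rewrite -(kh w Ow) -(kh z Oz); exact: (Hr w (subset_closure Ow) wr).
Qed.

(** [derive1n] has a default value where no derivative exists, so this is not automatic. The
    continuous extensions make [derive1n l f] bounded and [derive1n l.+1 f] continuous on a small
    closed disc, and [holomorphic_deriv] raises the order by one. *)
Lemma Ainf_cderiv f l z : Omega z ->
  cderiv (derive1n l f) z (derive1n l.+1 f z).
Proof.
elim: l z => [|l IH] z Oz; first by apply/derivable_cderiv; exact: Ainf_holo.
have [r r0 Hr] := open_disc_sub Oz.
have [|M M0 HM] := compact_modulus_bounded (@compact_disc_center R z r)
    (_ : forall w, modulus (w - z) <= r -> {for w, continuous (derive1n l f)}).
  by move=> w /Hr Ow; apply: extends_continuously_continuous; [exact: Ainf_ext|].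
have [|||d Hd] := @holomorphic_deriv R (derive1n l f) (derive1n l.+1 f) z r M r0.
- by move=> w /Hr; exact: IH.
- by move=> w /Hr; apply: extends_continuously_continuous; exact: Ainf_ext.
- exact: HM.
by rewrite [derive1n l.+2 f z](cderiv_derive1 Hd).
Qed.

Lemma cderiv_derive1nB f g l z : Omega z ->
  derive1n l (fun w => f w - g w) z = derive1n l f z - derive1n l g z.
Proof.
elim: l z => [//|l IH] z Oz; rewrite !derive1nS.
have H := cderivB (Ainf_cderiv f l Oz) (Ainf_cderiv g l Oz).
rewrite -(cderiv_derive1 H) !derive1E; apply: (near_eq_derive (1 : C)).
have [r r0 Hr] := open_disc_sub Oz.
by apply/nbhs_modulusP; exists r => // w /ltW/Hr/IH.
Qed.

Lemma dextB f g l z : closure Omega z ->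
  dext Omega (fun w => f w - g w) l z = dext Omega f l z - dext Omega g l z.
Proof.
move=> cz; apply: (dext_eq cz) => e e0; have e20 : 0 < e / 2 by rewrite divr_gt0.
have [r r0 Hr] := Ainf_dext f l cz e20.
have [r' r'0 Hr'] := Ainf_dext g l cz e20.
exists (Num.min r r'); first by rewrite lt_min r0.
move=> w Ow; rewrite lt_min => /andP[/(Hr w Ow) H1 /(Hr' w Ow) H2].
rewrite (cderiv_derive1nB f g l Ow).
set a := derive1n l f w in H1 *; set b := derive1n l g w in H2 *.
have -> : a - b - (dext Omega f l z - dext Omega g l z) =
  (a - dext Omega f l z) - (b - dext Omega g l z) by ring.
by apply: le_lt_trans (modulusB _ _) _; lra.
Qed.

Lemma seminorm_lt l n h (e : R) z : (seminorm Omega l n h < e%:E)%E ->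
  closure Omega z -> modulus z <= n%:R -> modulus (dext Omega h l z) < e.
Proof.
move=> se cz zn; rewrite -lte_fin; apply: le_lt_trans se.
rewrite /seminorm /nnsup le_max; apply/orP; right.
by apply: ereal_sup_ubound; exists z.
Qed.

Lemma seminorm_le l n h (e : R) : 0 <= e ->
  (forall z, closure Omega z -> modulus z <= n%:R -> modulus (dext Omega h l z) <= e) ->
  (seminorm Omega l n h <= e%:E)%E.
Proof.
move=> e0 H; rewrite /seminorm /nnsup ge_max lee_fin e0 /=.
by apply: ge_ereal_sup => _ [z [cz zn] <-]; rewrite lee_fin; exact: H.
Qed.

(** The bound is non-strict so that it passes to limits; [m] bounds both the order and the
    radius. *)
Definition Ainf_near (m : nat) (e : R) f g := forall l z, (l <= m)%N ->
  closure Omega z -> modulus z <= m%:R ->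
  modulus (dext Omega g l z - dext Omega f l z) <= e.

Lemma Ainf_near_trans m f g k (e e' : R) :
  Ainf_near m e f g -> Ainf_near m e' g k -> Ainf_near m (e + e') f k.
Proof.
move=> fg gk l z lm cz zm; have := fg l z lm cz zm; have := gk l z lm cz zm.
have := modulus_dist_trans (dext Omega g l z) (dext Omega k l z) (dext Omega f l z).
lra.
Qed.

Lemma nbhs_AinfP f (U : set (Ainf Omega)) : nbhs f U <->
  exists m : nat, exists2 e : R, 0 < e & forall g, Ainf_near m e f g -> U g.
Proof.
split.
  rewrite nbhsE => -[V [oV Vf] VU]; have [m [e [e0 He]]] := oV f Vf.
  exists m, (e / 2); first by rewrite divr_gt0.
  move=> g fg; apply/VU/He => l n lm nm.
  apply: (@le_lt_trans _ _ (e / 2)%:E); last by rewrite lte_fin; lra.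
  apply: seminorm_le => [|z cz zn]; first by rewrite divr_ge0 // ltW.
  rewrite dextB //; apply: fg => //; apply: le_trans zn _.
  by rewrite ler_nat.
move=> [m [e e0 He]].
(* The room between [e'] and [e] makes this set open; the set defined by [e] itself comes with no
   such room. *)
pose V : set (Ainf Omega) := [set g | exists2 e' : R, 0 <= e' < e & Ainf_near m e' f g].
suff : nbhs f V.
  apply: filterS => g [e' /andP[_ e'e] fg]; apply: He => l z lm cz zm.
  exact: le_trans (fg l z lm cz zm) (ltW e'e).
apply: open_nbhs_nbhs; split; last first.
  by exists 0; rewrite ?lexx // => l z _ _ _; rewrite subrr modulus0.
move=> g [e' /andP[e'0 e'e] fg]; exists m, ((e - e') / 2); split.
  by rewrite divr_gt0 // subr_gt0.
move=> k gk; exists (e' + (e - e') / 2); first by apply/andP; split; lra.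
apply: Ainf_near_trans fg _ => l z lm cz zm.
by rewrite -dextB //; apply: ltW; apply: seminorm_lt (gk l m lm (leqnn m)) cz zm.
Qed.

End AinfTopology.

Section ThreeEpsilon.
Context {R : realType}.
Implicit Types a b c d h x y : Cplx R.

Lemma modulus_dist3 a b c d :
  modulus (a - b) <= modulus (a - c) + modulus (c - d) + modulus (b - d).
Proof.
have -> : a - b = (a - c) + (c - d) - (b - d) by ring.
have := modulusB (a - c + (c - d)) (b - d); have := modulusD (a - c) (c - d); lra.
Qed.

Lemma modulus_dist4 a b c d x y : modulus ((a - b) - (c - d)) <=
  modulus ((x - b) - (y - d)) + modulus (a - x) + modulus (c - y).
Proof.
have -> : a - b - (c - d) = ((x - b) - (y - d)) + (a - x) - (c - y) by ring.
have := modulusB ((x - b) - (y - d) + (a - x)) (c - y).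
have := modulusD ((x - b) - (y - d)) (a - x); lra.
Qed.

Lemma modulus_increment a b c d h x y : modulus (a - b - x * h) <=
  modulus ((a - c) - (b - d)) + modulus (c - d - y * h) + modulus (y - x) * modulus h.
Proof.
have -> : a - b - x * h = ((a - c) - (b - d)) + (c - d - y * h) + (y - x) * h by ring.
have := modulusD ((a - c) - (b - d) + (c - d - y * h)) ((y - x) * h).
have := modulusD ((a - c) - (b - d)) (c - d - y * h); rewrite modulusM; lra.
Qed.

End ThreeEpsilon.

(** * Rational functions in [Ainf], completeness and the Baire construction *)

Section RationalDense.
Context {R : realType}.
Local Notation C := (Cplx R).
Variables (Omega : set C) (openOmega : open Omega).
Implicit Types (z w v : C) (P Q : {poly C}) (f g : Ainf Omega).

Lemma rat_der_continuous P Q l z : Q.[z] != 0 -> {for z, continuous (rat_der P Q l)}.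
Proof. by move=> /(cderiv_rat_der P l)/cderiv_continuous. Qed.

Lemma dext_rat (h : C -> C) P Q l z :
  (forall w, Omega w -> h w = rat_fun P Q w) -> closure Omega z -> Q.[z] != 0 ->
  dext Omega h l z = rat_der P Q l z.
Proof.
move=> hPQ cz Qz; apply: (dext_eq cz) => e e0.
have [r r0 Hr] := (continuous_modulusP _ _).1 (@rat_der_continuous P Q l z Qz) e e0.
have [r' r'0 Hr'] := continuous_neq0 (cderiv_continuous (cderiv_horner Q z)) Qz.
exists (Num.min r r'); first by rewrite lt_min r0.
move=> w Ow; rewrite lt_min => /andP[/Hr H1 /Hr' H2].
by rewrite (derive1n_open l openOmega hPQ Ow) derive1n_rat.
Qed.

Lemma exists_rat_Ainf P Q : (forall z, closure Omega z -> Q.[z] != 0) ->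
  exists f : Ainf Omega, forall z, Omega z -> f z = rat_fun P Q z.
Proof.
move=> Q0; pose h z : C := if `[< Omega z >] then rat_fun P Q z else 0.
have hE z : Omega z -> h z = rat_fun P Q z by move=> Oz; rewrite /h asboolT.
have h_out z : ~ Omega z -> h z = 0 by move=> Oz; rewrite /h asboolF.
have h_holo z : Omega z -> derivable h z (1 : C).
  move=> Oz; have Qz := Q0 z (subset_closure Oz).
  have : cderiv (rat_der P Q 0) z (rat_der P Q 1 z) by exact: cderiv_rat_der.
  move=> H; have [] // : is_derive z (1 : C) h (rat_der P Q 1 z).
  apply/cderivP; apply: cderiv_near H.
  have : \forall w \near z, Omega w by exact: open_nbhs_nbhs.
  by apply: filterS => w Ow; rewrite hE // /rat_der expr1.
have h_ext l : extends_continuously Omega (derive1n l h).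
  exists (rat_der P Q l); split; last first.
    move=> z Oz; rewrite (derive1n_open l openOmega hE Oz) derive1n_rat //.
    exact: Q0 (subset_closure Oz).
  apply/within_continuous_modulusP => z cz e e0.
  have [r r0 Hr] := (continuous_modulusP _ _).1 (@rat_der_continuous P Q l z (Q0 z cz)) e e0.
  by exists r => // w _; exact: Hr.
by exists (MkAinf h_out h_holo h_ext).
Qed.

Lemma dext_Omega f l z : Omega z -> dext Omega f l z = derive1n l f z.
Proof.
move=> Oz; have cz := subset_closure Oz; apply: (dext_eq cz) => e e0.
have := extends_continuously_continuous openOmega (Ainf_ext f l) Oz.
by move=> /continuous_modulusP/(_ e e0)[r r0 Hr]; exists r => // w _; exact: Hr.
Qed.

Lemma Ainf_near_le (m m' : nat) (e e' : R) f g : (m <= m')%N -> e' <= e ->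
  Ainf_near m' e' f g -> Ainf_near m e f g.
Proof.
move=> mm ee fg l z lm cz zm; apply: le_trans ee; apply: fg => //.
  exact: leq_trans mm.
by apply: le_trans zm _; rewrite ler_nat.
Qed.

Lemma Ainf_near_sym m (e : R) f g : Ainf_near m e f g -> Ainf_near m e g f.
Proof. by move=> fg l z lm cz zm; rewrite modulus_distC; exact: fg. Qed.

Section Limit.
Variables (u : nat -> Ainf Omega) (m : nat -> nat) (e : nat -> R).
Hypothesis e_small : forall d : R, 0 < d -> exists k0, forall k, (k0 <= k)%N -> e k < d.
Hypothesis m_large : forall k, (k <= m k)%N.
Hypothesis u_near : forall k i, (k <= i)%N -> Ainf_near (m k) (e k) (u k) (u i).

(** A single index, beyond [k1], whose control covers the order [l] and the point [z] with error
    below [d]. *)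
Let index_of k1 l z (d : R) : 0 < d ->
  exists k, [/\ (k1 <= k)%N, e k < d, (l <= m k)%N & modulus z <= (m k)%:R].
Proof.
move=> d0; have [k0 Hk0] := e_small d0.
pose k := maxn k1 (maxn k0 (maxn l (Num.bound (modulus z)))).
have mk := m_large k; exists k; split.
- exact: leq_maxl.
- by apply: Hk0; rewrite !leq_max leqnn orbT.
- by apply: leq_trans mk; rewrite !leq_max leqnn !orbT.
apply: le_trans (ltW (archi_boundP (modulus_ge0 z))) _.
by rewrite ler_nat; apply: leq_trans mk; rewrite !leq_max leqnn !orbT.
Qed.

Let limit_exists l z : exists v, closure Omega z -> forall k, (l <= m k)%N ->
  modulus z <= (m k)%:R -> modulus (v - dext Omega (u k) l z) <= e k.
Proof.
have [cz|ncz] := pselect (closure Omega z); last by exists 0.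
have [|v Hv] := @cauchy_seq_complex R (fun k => dext Omega (u k) l z).
  move=> d d0; have d2 : 0 < d / 2 by rewrite divr_gt0.
  have [k [_ ek lk zk]] := index_of 0%N l z d2.
  exists k => i j ki kj; have H1 := u_near ki lk cz zk.
  have H2 := u_near kj lk cz zk.
  have := modulus_dist_trans (dext Omega (u k) l z) (dext Omega (u i) l z) (dext Omega (u j) l z).
  rewrite (modulus_distC (dext Omega (u k) l z)); lra.
exists v => _ k lk zk; apply/ler_addgt0Pr => d /Hv[k0 Hk0].
have H1 := Hk0 _ (leq_maxr k k0); have H2 := u_near (leq_maxl k k0) lk cz zk.
have := modulus_dist_trans (dext Omega (u (maxn k k0)) l z) v (dext Omega (u k) l z).
rewrite (modulus_distC v (dext Omega (u (maxn k k0)) l z)); lra.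
Qed.

Let limit_of (G : nat -> C -> C) := forall l z k, closure Omega z ->
  (l <= m k)%N -> modulus z <= (m k)%:R ->
  modulus (G l z - dext Omega (u k) l z) <= e k.

Let limit_of_exists : exists G, limit_of G.
Proof.
have [G HG] := choice (fun lz : nat * C => limit_exists lz.1 lz.2).
by exists (fun l z => G (l, z)) => l z k cz; exact: (HG (l, z)).
Qed.

Section LimitFunctions.
Variable G : nat -> C -> C.
Hypothesis GP : limit_of G.

Let G_continuous l : {within closure Omega, continuous (G l)}.
Proof.
apply/within_continuous_modulusP => z cz d d0.
have d4 : 0 < d / 4 by rewrite divr_gt0.
(* A dummy point: applied to it, [index_of] returns a radius that covers the unit disc around
   [z]. *)
pose z' := rc (modulus z + 1).
have mz' : modulus z' = modulus z + 1.
  by rewrite modulus_rc ger0_norm //; have := modulus_ge0 z; lra.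
have [k [_ ek lk]] := index_of 0%N l z' d4; rewrite mz' => zk.
have /within_continuous_modulusP/(_ z cz _ d4)[r r0 Hr] := @Ainf_dext_continuous R Omega (u k) l.
exists (Num.min r 1); first by rewrite lt_min r0 ltr01.
move=> w cw; rewrite lt_min => /andP[wr w1].
have wk : modulus w <= (m k)%:R.
  by have := modulusD (w - z) z; rewrite subrK; lra.
have H1 := GP cw lk wk; have H2 := GP cz lk ltac:(lra); have H3 := Hr w cw wr.
apply: le_lt_trans (modulus_dist3 _ _ (dext Omega (u k) l w) (dext Omega (u k) l z)) _.
move: H1 H2 H3; move: (dext Omega (u k) l w) (dext Omega (u k) l z) => a b; lra.
Qed.

(** On a segment from [z] the mean value inequality bounds the increment of the [l]-th derivative of
    [u i - u k] by [e k * modulus (w - z)]. This survives as [i] grows, so the expansion of one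
    [u k] carries over to [G l]. *)
Let G_cderiv l z : Omega z -> cderiv (G l) z (G l.+1 z).
Proof.
move=> Oz d d0; have d4 : 0 < d / 4 by rewrite divr_gt0.
have [r r0 Hr] := open_disc_sub openOmega Oz.
pose z' := rc (modulus z + r).
have mz' : modulus z' = modulus z + r.
  by rewrite modulus_rc ger0_norm //; have := modulus_ge0 z; lra.
have [k [_ ek lk]] := index_of 0%N l.+1 z' d4; rewrite mz' => zk.
have [r' r'0 Hr'] := Ainf_cderiv openOmega (u k) l Oz d4.
exists (Num.min r r'); first by rewrite lt_min r0.
move=> w; rewrite lt_min => /andP[wr wr'].
have Ow : Omega w by apply: Hr; exact: ltW.
have seg t : 0 <= t <= 1 -> modulus (z + rc t * (w - z) - z) <= r.
  move=> /andP[t0 t1]; rewrite addrC addKr modulusM modulus_rc ger0_norm //.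
  by rewrite -[leRHS]mul1r ler_pM ?modulus_ge0 // ltW.
have step i : (k <= i)%N -> modulus ((derive1n l (u i) w - derive1n l (u k) w) -
    (derive1n l (u i) z - derive1n l (u k) z)) <= e k * modulus (w - z).
  move=> ki; rewrite -[X in modulus X]subr0 -[X in _ - X](mul0r (w - z)).
  apply: (@cderiv_segment_le R (fun x => derive1n l (u i) x - derive1n l (u k) x)
    (fun x => derive1n l.+1 (u i) x - derive1n l.+1 (u k) x)) => t t01.
    have Ot := Hr _ (seg t t01).
    exact: cderivB (Ainf_cderiv openOmega (u i) l Ot) (Ainf_cderiv openOmega (u k) l Ot).
  rewrite subr0; have Ot := Hr _ (seg t t01); rewrite -!dext_Omega //.
  apply: (u_near ki) => //; first exact: subset_closure Ot.
  set x := z + _; have := modulusD (x - z) z; rewrite subrK.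
  have : modulus (x - z) <= r by exact: seg.
  lra.
have lk' : (l <= m k)%N by exact: ltnW.
have key : modulus ((G l w - derive1n l (u k) w) - (G l z - derive1n l (u k) z))
    <= e k * modulus (w - z).
  apply/ler_addgt0Pr => d' d'0; have d'2 : 0 < d' / 2 by rewrite divr_gt0.
  have [n [kn en ln zn]] := index_of k l z' d'2; rewrite mz' in zn.
  have Hn := step n kn.
  have wz : modulus w <= modulus z + r by have := modulusD (w - z) z; rewrite subrK; lra.
  have H1 := GP (subset_closure Ow) ln (le_trans wz zn).
  have H2 := GP (subset_closure Oz) ln ltac:(lra).
  rewrite !dext_Omega // in H1 H2.
  apply: le_trans (modulus_dist4 _ _ _ _ (derive1n l (u n) w) (derive1n l (u n) z)) _.
  move: H1 H2 Hn; move: (modulus (_ - _)) (modulus (_ - _)) (modulus (_ - _)) => a b c.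
  lra.
have H1 := Hr' w wr'.
have zk' : modulus z <= (m k)%:R by lra.
have := GP (subset_closure Oz) lk zk'; rewrite dext_Omega // modulus_distC => H2.
apply: le_trans (modulus_increment _ _ (derive1n l (u k) w) (derive1n l (u k) z) _ _
  (derive1n l.+1 (u k) z)) _.
have m0 := modulus_ge0 (w - z).
have H3 : modulus (derive1n l.+1 (u k) z - G l.+1 z) * modulus (w - z) <= d / 4 * modulus (w - z).
  by rewrite ler_wpM2r //; lra.
have H4 : e k * modulus (w - z) <= d / 4 * modulus (w - z) by rewrite ler_wpM2r // ltW.
have m1 : 0 <= d * modulus (w - z) by rewrite mulr_ge0 // ltW.
lra.
Qed.

Lemma Ainf_of_limit : exists g : Ainf Omega, forall k, Ainf_near (m k) (e k) (u k) g.
Proof.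
pose h z : C := if `[< Omega z >] then G 0 z else 0.
have hE z : Omega z -> h z = G 0 z by move=> Oz; rewrite /h asboolT.
have h_out z : ~ Omega z -> h z = 0 by move=> Oz; rewrite /h asboolF.
have hG l z : Omega z -> derive1n l h z = G l z.
  elim: l z => [|l IH] z Oz; first exact: hE.
  rewrite derive1nS -(cderiv_derive1 (@G_cderiv l z Oz)) !derive1E.
  apply: (near_eq_derive (1 : C)).
  have : \forall w \near z, Omega w by exact: open_nbhs_nbhs.
  by apply: filterS => w /IH.
have h_holo z : Omega z -> derivable h z (1 : C).
  move=> Oz; have H := @G_cderiv 0 z Oz.
  have [] // : is_derive z (1 : C) h (G 1 z).
  apply/cderivP; apply: cderiv_near H.
  have : \forall w \near z, Omega w by exact: open_nbhs_nbhs.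
  by apply: filterS => w Ow; rewrite hE.
have h_ext l : extends_continuously Omega (derive1n l h).
  by exists (G l); split=> [|z /hG]; [exact: G_continuous|].
exists (MkAinf h_out h_holo h_ext) => k l z lk cz zk.
suff -> : dext Omega h l z = G l z by exact: GP.
apply: (dext_eq cz) => d d0.
have /within_continuous_modulusP/(_ z cz d d0)[r r0 Hr] := @G_continuous l.
by exists r => // w Ow wr; rewrite hG //; exact: (Hr w (subset_closure Ow) wr).
Qed.

End LimitFunctions.

Lemma Ainf_limit : exists g : Ainf Omega, forall k, Ainf_near (m k) (e k) (u k) g.
Proof. by have [G] := limit_of_exists; exact: Ainf_of_limit. Qed.

End Limit.

(** Nested neighbourhoods with rational centres. The limit stays in all of them by completeness of
    [Ainf], and it lies in [Xinf] as a limit of the centres. *)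
Lemma baire_rational (O : nat -> set (Ainf Omega)) :
  (forall k f, O k f -> nbhs f (O k)) ->
  (forall k f m (e : R), rational_on f -> 0 < e ->
     exists g, [/\ rational_on g, O k g & Ainf_near m e f g]) ->
  forall f m (e : R), rational_on f -> 0 < e ->
    exists g, [/\ Xinf Omega g, forall k, O k g & Ainf_near m e f g].
Proof.
move=> oO dO f0 m0 e0 f0r e00.
pose state := {s : Ainf Omega * nat * R | rational_on s.1.1 /\ 0 < s.2}.
pose fn (s : state) := (proj1_sig s).1.1.
pose mn (s : state) := (proj1_sig s).1.2.
pose en (s : state) := (proj1_sig s).2.
have next (k : nat) (s : state) : {s' : state | [/\ Ainf_near (mn s) (en s / 2) (fn s) (fn s'),
    (mn s < mn s')%N, en s' <= en s / 2 &
    forall h, Ainf_near (mn s') (en s') (fn s') h -> O k h]}.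
  apply: cid; case: s => [[[f m] e] /= [fr e_gt0]]; rewrite /mn /en /fn /=.
  have [|g [gr Og fg]] := dO k f m (e / 2) fr; first by rewrite divr_gt0.
  have [m' [e' e'0 Hg]] := (nbhs_AinfP openOmega _ _).1 (oO k g Og).
  have e''0 : 0 < Num.min e' (e / 2) by rewrite lt_min e'0 divr_gt0.
  exists (exist (fun s : Ainf Omega * nat * R => rational_on s.1.1 /\ 0 < s.2)
    (g, maxn m.+1 m', Num.min e' (e / 2)) (conj gr e''0)) => /=.
  split=> //; first by rewrite leq_maxl.
    by rewrite ge_min lexx orbT.
  move=> h Hh; apply: Hg; apply: Ainf_near_le Hh; first exact: leq_maxr.
  by rewrite ge_min lexx.
pose s0 : state := exist (fun s : Ainf Omega * nat * R => rational_on s.1.1 /\ 0 < s.2)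
  (f0, m0, e0) (conj f0r e00).
pose fix s (k : nat) : state := if k is k'.+1 then proj1_sig (next k' (s k')) else s0.
have sP k : [/\ Ainf_near (mn (s k)) (en (s k) / 2) (fn (s k)) (fn (s k.+1)),
    (mn (s k) < mn (s k.+1))%N, en (s k.+1) <= en (s k) / 2 &
    forall h, Ainf_near (mn (s k.+1)) (en (s k.+1)) (fn (s k.+1)) h -> O k h].
  exact: proj2_sig (next k (s k)).
have e_gt0 k : 0 < en (s k) by case: (proj2_sig (s k)).
have e_pow k : en (s k) <= e0 / 2 ^+ k.
  elim: k => [|k IH]; first by rewrite expr0 divr1.
  have [_ _ H _] := sP k; apply: le_trans H _; rewrite exprSr invfM mulrA.
  by rewrite ler_pM2r ?invr_gt0.
have e_small (d : R) : 0 < d -> exists k0, forall k, (k0 <= k)%N -> en (s k) < d.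
  move=> d0; exists (Num.bound (e0 / d)) => k Hk; apply: le_lt_trans (e_pow k) _.
  rewrite ltr_pdivrMr ?exprn_gt0 // mulrC -ltr_pdivrMr //.
  apply: lt_le_trans (archi_boundP _) _; first by rewrite divr_ge0 // ltW.
  by rewrite -natrX ler_nat; apply: leq_trans Hk (ltnW (ltn_expl _ _)).
have m_large k : (k <= mn (s k))%N.
  by elim: k => [//|k IH]; have [_ H _ _] := sP k; apply: leq_ltn_trans H.
have m_mono k i : (k <= i)%N -> (mn (s k) <= mn (s i))%N.
  move=> /subnK <-; elim: (i - k)%N => [//|j IH].
  by have [_ H _ _] := sP (j + k)%N; apply: leq_trans IH (ltnW H).
(* As the radii at least halve, a step of size [en / 2] is at most the drop of the radius; the steps
   therefore telescope and never leave the ball of index [k]. *)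
have u_near' k i : (k <= i)%N ->
    Ainf_near (mn (s k)) (en (s k) - en (s i)) (fn (s k)) (fn (s i)).
  move=> ki; rewrite -(subnK ki); elim: (i - k)%N => [|j IH].
    by rewrite add0n subrr => l z _ _ _; rewrite subrr modulus0.
  have [H _ H' _] := sP (j + k)%N.
  have mk : (mn (s k) <= mn (s (j + k)))%N by apply: m_mono; exact: leq_addl.
  have := Ainf_near_trans IH (Ainf_near_le mk (lexx _) H).
  by apply: Ainf_near_le => //; lra.
have u_near k i : (k <= i)%N -> Ainf_near (mn (s k)) (en (s k)) (fn (s k)) (fn (s i)).
  by move=> ki; apply: Ainf_near_le (u_near' k i ki) => //; have := e_gt0 i; lra.
have [g Hg] := Ainf_limit e_small m_large u_near.
exists g; split; last exact: (Hg 0).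
  move=> U /(nbhs_AinfP openOmega)[m [e e_0 He]].
  have [k0 Hk0] := e_small e e_0; pose k := maxn k0 m.
  exists (fn (s k)); split; first by case: (proj2_sig (s k)).
  apply: He; apply: Ainf_near_sym; apply: Ainf_near_le (Hg k).
    by apply: leq_trans (m_large k); exact: leq_maxr.
  by apply/ltW/Hk0; exact: leq_maxl.
by move=> k; have [_ _ _] := sP k; apply; exact: Hg.
Qed.

End RationalDense.

(** * Pade approximants of rational functions *)

Section PadeAlgebra.
Variables (F : fieldType) (a : int -> F).
Hypothesis a_neg : forall n, a (Negz n) = 0.
Implicit Types (p q : nat) (A B P : {poly F}).

Definition trunc_series (k : int) : {poly F} :=
  match k with
  | Posz m => \sum_(nu < m.+1) a nu%:Z *: 'X^nu
  | Negz _ => 0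
  end.

Definition jacobi_rows p q (row0 : 'I_q.+1 -> {poly F}) : 'M[{poly F}]_q.+1 :=
  \matrix_(i < q.+1, j < q.+1)
    if i == 0%N :> nat then row0 j else (a (p%:Z - q%:Z + i%:Z + j%:Z))%:P.

Definition coef_hankel p q : 'M[F]_q :=
  \matrix_(i < q, j < q) a (p%:Z - q%:Z + i%:Z + j%:Z + 1).

Definition jacobi_num p q := \det (jacobi_rows p
  (fun j : 'I_q.+1 => 'X^(q - j) * trunc_series (p%:Z - q%:Z + j%:Z))).
Definition jacobi_den p q := \det (jacobi_rows p (fun j : 'I_q.+1 => 'X^(q - j))).

(** The rows common to both Jacobi matrices. Numerator and denominator are thus expanded along the
    first row with the same scalar cofactors, [jacobi_minor]. *)
Definition jacobi_tail p q : 'M[F]_(q, q.+1) :=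
  \matrix_(i < q, j < q.+1) a (p%:Z - q%:Z + i.+1%:Z + j%:Z).

Definition jacobi_minor p q (j : 'I_q.+1) : F := (-1) ^+ j * \det (col' j (jacobi_tail p q)).

Lemma det_jacobi_rows p q (row0 : 'I_q.+1 -> {poly F}) :
  \det (jacobi_rows p row0) = \sum_j row0 j * (jacobi_minor p j)%:P.
Proof.
rewrite (expand_det_row _ ord0); apply: eq_bigr => j _; rewrite mxE /=.
congr (_ * _); rewrite /cofactor add0n /jacobi_minor rmorphM rmorphXn rmorphN1 -det_map_mx.
congr (_ * \det _); apply/matrixP => i k; rewrite !mxE /=.
by [].
Qed.

Lemma minor_max p q : jacobi_minor p (ord_max : 'I_q.+1) = (-1) ^+ q * \det (coef_hankel p q).
Proof.
rewrite /jacobi_minor; congr (_ * \det _); apply/matrixP => i j; rewrite !mxE /=.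
rewrite /bump leqNgt ltn_ord add0n; congr a; lia.
Qed.

(** A determinant with a repeated row, expanded along its first row. In terms of series: denominator
    times series has no terms of degree [p + 1] to [p + q]. *)
Lemma minor_orthogonal p q (i : 'I_q) :
  \sum_(j < q.+1) jacobi_minor p j * a (p%:Z - q%:Z + i.+1%:Z + j%:Z) = 0.
Proof.
apply: polyC_inj; rewrite polyC0 rmorph_sum /=; apply: esym.
pose row0 (j : 'I_q.+1) := (a (p%:Z - q%:Z + i.+1%:Z + j%:Z))%:P.
have := det_jacobi_rows p row0; rewrite (determinant_alternate (i1 := ord0) (i2 := lift ord0 i)).
- by move=> E; apply: (etrans E); apply: eq_bigr => j _; rewrite [RHS]polyCM; exact: mulrC.
- by [].
- by move=> j; rewrite !mxE.
Qed.

Lemma coef_jacobi_den p q k : (jacobi_den p q)`_k =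
  if (k < q.+1)%N then jacobi_minor p (inord (q - k) : 'I_q.+1) else 0.
Proof.
rewrite /jacobi_den det_jacobi_rows coef_sum.
case: ltnP => [kq|qk]; last first.
  rewrite big1 // => j _; rewrite coefMC coefXn.
  case: eqP => [kE|]; last by rewrite mul0r.
  by move: qk; rewrite kE ltnNge leq_subr.
rewrite (bigD1 (inord (q - k))) //= coefMC coefXn inordK ?subKn // ?ltnS ?leq_subr //.
rewrite eqxx mul1r big1 ?addr0 // => j jk; rewrite coefMC coefXn.
case: eqP => [kE|]; last by rewrite mul0r.
have jq := ltn_ord j; case/eqP: jk; apply: val_inj; rewrite /= inordK; lia.
Qed.

Lemma size_jacobi_den p q : (size (jacobi_den p q) <= q.+1)%N.
Proof. by apply/leq_sizeP => k qk; rewrite coef_jacobi_den ltnNge qk. Qed.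

Lemma coef_trunc_series (k : int) n :
  (trunc_series k)`_n = if n%:Z <= k then a n%:Z else 0.
Proof.
case: k => m; last by rewrite /= coef0.
rewrite /= -(poly_def m.+1 (fun i : nat => a i%:Z)) coef_poly ltnS.
by have -> : (n%:Z <= m%:Z) = (n <= m)%N by lia.
Qed.

(** Up to degree [p] these are the coefficients of the denominator times the series; the partial
    sums in the first row cut off exactly the higher ones. *)
Lemma coef_jacobi_num p q n : (jacobi_num p q)`_n =
  if (n <= p)%N then \sum_(j < q.+1) jacobi_minor p j * a (n%:Z - q%:Z + j%:Z) else 0.
Proof.
rewrite /jacobi_num det_jacobi_rows coef_sum.
transitivity (\sum_(j < q.+1) if (n <= p)%N then jacobi_minor p j * a (n%:Z - q%:Z + j%:Z) else 0).
  apply: eq_bigr => j _; rewrite coefMC coefXnM coef_trunc_series.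
  have jq := ltn_ord j; case: ltnP => [nq|qn].
    rewrite mul0r; case: ifP => // _.
    have [m ->] : exists m, n%:Z - q%:Z + j%:Z = Negz m.
      by exists (q - j - n).-1; lia.
    by rewrite a_neg mulr0.
  have -> : ((n - (q - j))%N%:Z <= p%:Z - q%:Z + j%:Z) = (n <= p)%N by lia.
  case: ifP => _; last by rewrite mul0r.
  by rewrite mulrC; congr (_ * a _); lia.
by case: ifP => // _; rewrite big1.
Qed.

Lemma size_jacobi_num p q : (size (jacobi_num p q) <= p.+1)%N.
Proof. by apply/leq_sizeP => k pk; rewrite coef_jacobi_num leqNgt pk. Qed.

Lemma coefM_eq (P Q Q' : {poly F}) n : (forall i, (i <= n)%N -> Q`_i = Q'`_i) ->
  (P * Q)`_n = (P * Q')`_n.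
Proof. by move=> H; rewrite !coefM; apply: eq_bigr => i _; rewrite H ?leq_subr. Qed.

Let series (M : nat) : {poly F} := \poly_(k < M) a k%:Z.

Let coefM_series (P : {poly F}) s n M : (size P <= s)%N -> (n < M)%N ->
  (P * series M)`_n = \sum_(i < s) P`_i * a (n%:Z - i%:Z).
Proof.
move=> Ps nM; pose G i := P`_i * a (n%:Z - i%:Z).
have trunc m N : (forall i, (m <= i)%N -> G i = 0) -> (m <= N)%N ->
    \sum_(i < N) G i = \sum_(i < m) G i.
  move=> G0 mN; rewrite -!(big_mkord xpredT G) (big_cat_nat _ mN) //=.
  by rewrite [X in _ + X]big_nat_cond [X in _ + X]big1 ?addr0 // => i /andP[/andP[/G0]].
rewrite coefM; transitivity (\sum_(i < n.+1) G i).
  apply: eq_bigr => i _; rewrite coef_poly /G (leq_ltn_trans (leq_subr _ _) nM).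
  by congr (_ * a _); have := ltn_ord i; lia.
rewrite -(trunc n.+1 (maxn n.+1 s)) ?leq_maxl //; last first.
  move=> i ni; rewrite /G; have [m ->] : exists m, n%:Z - i%:Z = Negz m.
    by exists (i - n).-1; lia.
  by rewrite a_neg mulr0.
apply: trunc; last exact: leq_maxr.
move=> i si; rewrite /G nth_default ?mul0r //.
exact: leq_trans si.
Qed.

Section RationalSeries.
Variables (A B : {poly F}) (p q : nat).
Hypothesis coAB : coprimep A B.
Hypothesis sizeA : size A = p.+1.
Hypothesis sizeB : (size B <= q.+1)%N.
Hypothesis seriesAB : forall n, \sum_(i < n.+1) B`_i * a (n - i)%N%:Z = A`_n.

Let M := (p + q).+1.
Let T := series M.

Let BT n : (n < M)%N -> (B * T)`_n = A`_n.
Proof.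
move=> nM; rewrite -seriesAB coefM; apply: eq_bigr => i _.
by rewrite coef_poly (leq_ltn_trans (leq_subr _ _) nM).
Qed.

Let A0 : A != 0. Proof. by rewrite -size_poly_eq0 sizeA. Qed.

Let small_coef_eq (P Q : {poly F}) n : (size P <= n)%N -> (size Q <= n)%N ->
  (forall i, (i < n)%N -> P`_i = Q`_i) -> P = Q.
Proof.
move=> sP sQ H; apply/polyP => i; have [/H//|ni] := ltnP i n.
by rewrite !nth_default // (leq_trans _ ni).
Qed.

(* A null vector of the Hankel matrix gives [P] of degree < q such that the
   coefficients of [P * A / B] vanish in degrees p, ..., p + q - 1; hence
   [P * A = B * D] with [deg D < p], against coprimality. *)
Lemma rational_hankel_neq0 : \det (coef_hankel p q) != 0.
Proof.
apply/negP => /det0P[v v0 vH].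
(* For [q = 0] the null vector has no entries, so it cannot be nonzero. *)
case: q sizeB v v0 vH @M @T BT => [|q'] sB v v0 vH M' T' BT'.
  by case/eqP: v0; apply/rowP => -[].
(* Reading [v] backwards turns the Hankel sums into coefficients of a product. *)
pose P := \poly_(k < q'.+1) v 0 (inord (q' - k)).
have sP : (size P <= q'.+1)%N := size_poly _ _.
have PT j : (j < q'.+1)%N -> (P * T')`_(p + j) = 0.
  move=> jq; rewrite (coefM_series sP); last by rewrite /M'; lia.
  have := congr1 (fun w : 'rV_ _ => w 0 (Ordinal jq)) vH; rewrite !mxE => E; apply: etrans E.
  rewrite (reindex_inj rev_ord_inj) /=; apply: eq_bigr => i _.
  have iq := ltn_ord i; rewrite coef_poly mxE ifT; last by lia.
  congr (v 0 _ * a _); last by rewrite /=; lia.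
  by apply: val_inj; rewrite /= inordK; lia.
pose D := take_poly p (P * T').
have sD : (size D <= p)%N := size_take_poly _ _.
have DT n : (n < p + q'.+1)%N -> D`_n = (P * T')`_n.
  move=> npq; rewrite coef_take_poly; case: ltnP => // pn.
  by rewrite -(subnKC pn) PT //; lia.
have PA : P * A = B * D.
  apply: (@small_coef_eq _ _ (p + q'.+1)).
  - have := size_polyMleq P A; move: sP; rewrite sizeA.
    move: (size P) (size (P * A)%R) => m n; lia.
  - have := size_polyMleq B D; move: sB sD.
    move: (size B) (size D) (size (B * D)%R) => k m n; lia.
  move=> i ipq; transitivity ((P * (B * T'))`_i).
    by apply: coefM_eq => j ji; rewrite BT' // /M'; lia.
  by rewrite mulrCA; apply: coefM_eq => j ji; rewrite DT //; lia.
have D0 : D = 0.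
  apply/eqP; apply: contraTT isT => D0.
  have : A %| B * D by rewrite -PA dvdp_mull.
  by rewrite Gauss_dvdpr // => /(dvdp_leq D0); rewrite sizeA; lia.
move/eqP: PA; rewrite D0 mulr0 mulf_eq0 (negbTE A0) orbF => /eqP P0.
case/eqP: v0; apply/rowP => i; rewrite mxE.
have iq := ltn_ord i; have := congr1 (fun R : {poly F} => R`_(q' - i)) P0.
rewrite coef_poly coef0 ifT; last by lia.
by move=> <-; congr (v 0 _); apply: val_inj; rewrite /= inordK; lia.
Qed.

(** The cross products agree up to degree [p + q] and have no higher terms, so they are equal. By
    coprimality [A] divides the numerator, and [size A = p.+1] makes the quotient constant. It is
    nonzero because the constant coefficient of the denominator is, up to sign, the Hankel
    determinant. *)
Lemma rational_jacobi : exists2 c : F, c != 0 &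
  jacobi_num p q = c *: A /\ jacobi_den p q = c *: B.
Proof.
have sN := size_jacobi_num p q; have sD := size_jacobi_den p q.
have DT n : (n < M)%N -> (jacobi_den p q * T)`_n = (jacobi_num p q)`_n.
  move=> nM; rewrite (coefM_series sD nM) coef_jacobi_num.
  have -> : \sum_(i < q.+1) (jacobi_den p q)`_i * a (n%:Z - i%:Z) =
      \sum_(j < q.+1) jacobi_minor p j * a (n%:Z - q%:Z + j%:Z).
    rewrite (reindex_inj rev_ord_inj) /=; apply: eq_bigr => i _.
    have iq := ltn_ord i; rewrite coef_jacobi_den ifT; last by lia.
    congr (jacobi_minor _ _ * a _); last by lia.
    by apply: val_inj; rewrite /= inordK; lia.
  case: leqP => // pn; have iq : (n - p.+1 < q)%N by rewrite /M in nM; lia.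
  rewrite -[RHS](minor_orthogonal p (Ordinal iq)); apply: eq_bigr => j _.
  by congr (_ * a _); rewrite /=; lia.
have cross : jacobi_den p q * A = jacobi_num p q * B.
  apply: (@small_coef_eq _ _ M).
  - have := size_polyMleq (jacobi_den p q) A; move: sD; rewrite sizeA /M.
    move: (size (jacobi_den p q)) (size (jacobi_den p q * A)%R) => m n; lia.
  - have := size_polyMleq (jacobi_num p q) B; move: sN sizeB; rewrite /M.
    move: (size (jacobi_num p q)) (size B) (size (jacobi_num p q * B)%R) => k m n; lia.
  move=> i iM; transitivity ((jacobi_den p q * (B * T))`_i).
    by apply: coefM_eq => j ji; rewrite BT //; lia.
  rewrite mulrCA [RHS](congr1 (fun P : {poly F} => P`_i) (mulrC _ B)).
  by apply: coefM_eq => j ji; rewrite DT //; lia.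
have : A %| jacobi_num p q.
  by rewrite -(Gauss_dvdpl _ coAB) -cross dvdp_mull.
move=> /dvdpP[U UE].
have [c Uc] : exists c, U = c%:P.
  have [->|U0] := eqVneq U 0; first by exists 0; rewrite polyC0.
  have := sN; rewrite UE size_mul // sizeA addnS /= => sU.
  by exists U`_0; apply: size1_polyC; move: sU; rewrite -[p.+1]add1n leq_add2r.
have numE : jacobi_num p q = c *: A by rewrite UE Uc mul_polyC.
have denE : jacobi_den p q = c *: B.
  apply: (mulIf A0); rewrite cross numE -!mul_polyC; ring.
exists c => //; apply/eqP => c0.
have := coef_jacobi_den p q 0; rewrite denE c0 scale0r coef0 /= subn0.
have -> : inord q = ord_max :> 'I_q.+1 by apply: val_inj; rewrite /= inordK.
rewrite minor_max => /esym/eqP; rewrite mulf_eq0 signr_eq0 /=.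
by rewrite (negbTE rational_hankel_neq0).
Qed.

End RationalSeries.
End PadeAlgebra.

(** * Taylor coefficients of rational functions and their Pade approximants *)

Section TaylorRational.
Context {R : realType}.
Local Notation C := (Cplx R).
Implicit Types (z zeta : C) (A B P Q : {poly C}).

Lemma fact_neq0 n : (n`!)%:R != 0 :> C.
Proof. by rewrite pnatr_eq0 -lt0n fact_gt0. Qed.

Lemma cderiv_unique (h : C -> C) z d d' : cderiv h z d -> cderiv h z d' -> d = d'.
Proof. by move=> /cderiv_derive1 <- /cderiv_derive1. Qed.

Definition taylor_poly_coef P i z := (P^`(i)).[z] / (i`!)%:R.
Definition taylor_rat_coef P Q i z := rat_der P Q i z / (i`!)%:R.

Lemma cderiv_taylor_poly_coef P i z :
  cderiv (taylor_poly_coef P i) z (i.+1%:R * taylor_poly_coef P i.+1 z).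
Proof.
have := cderivM (cderiv_horner P^`(i) z) (cderiv_cst ((i`!)%:R^-1) z).
rewrite mulr0 addr0 => /cderiv_eq; apply.
rewrite /taylor_poly_coef derivnS factS natrM; field.
by rewrite fact_neq0 nat1r pnatr_eq0.
Qed.

Lemma cderiv_taylor_rat_coef P Q i z : Q.[z] != 0 ->
  cderiv (taylor_rat_coef P Q i) z (i.+1%:R * taylor_rat_coef P Q i.+1 z).
Proof.
move=> Qz; have := cderivM (cderiv_rat_der P i Qz) (cderiv_cst ((i`!)%:R^-1) z).
rewrite mulr0 addr0 => /cderiv_eq; apply.
rewrite /taylor_rat_coef factS natrM; field.
by rewrite fact_neq0 nat1r pnatr_eq0.
Qed.

(* The two sides agree for [n = 0]; deriving the identity for [n] in [z] gives
   [n + 1] times the identity for [n + 1]. *)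
Lemma taylor_rat_coefP A B n z : B.[z] != 0 ->
  \sum_(i < n.+1) taylor_poly_coef B i z * taylor_rat_coef A B (n - i) z =
  taylor_poly_coef A n z.
Proof.
elim: n z => [|n IH] z Bz.
  rewrite big_ord_recl big_ord0 addr0 /taylor_poly_coef /taylor_rat_coef /=.
  rewrite /rat_der fact0 expr1 /=; field; exact: Bz.
pose b i := taylor_poly_coef B i z; pose a i := taylor_rat_coef A B i z.
pose G w := \sum_(i < n.+1) taylor_poly_coef B i w * taylor_rat_coef A B (n - i) w.
have dG : cderiv G z (\sum_(i < n.+1)
    (i.+1%:R * b i.+1 * a (n - i)%N + b i * ((n - i).+1%:R * a (n - i).+1))).
  apply: cderiv_sum => i; apply: cderivM; first exact: cderiv_taylor_poly_coef.
  exact: cderiv_taylor_rat_coef.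
have dA : cderiv G z (n.+1%:R * taylor_poly_coef A n.+1 z).
  apply: cderiv_near (cderiv_taylor_poly_coef A n z).
  have [r r0 Hr] := continuous_neq0 (cderiv_continuous (cderiv_horner B z)) Bz.
  by apply/nbhs_modulusP; exists r => // w /Hr /IH.
have n0 : n.+1%:R != 0 :> C by rewrite pnatr_eq0.
apply: (mulfI n0); rewrite -(cderiv_unique dG dA) big_split /=.
pose c i := b i * a (n.+1 - i)%N.
have -> : \sum_(i < n.+1) i.+1%:R * b i.+1 * a (n - i)%N =
    \sum_(i < n.+2) i%:R * c i.
  rewrite [RHS]big_ord_recl mul0r add0r; apply: eq_bigr => i _.
  by rewrite lift0 /c subSS mulrA.
have -> : \sum_(i < n.+1) b i * ((n - i).+1%:R * a (n - i).+1) =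
    \sum_(i < n.+2) (n.+1 - i)%:R * c i.
  rewrite [RHS]big_ord_recr /= subnn mul0r addr0; apply: eq_bigr => i _.
  have /subSn -> : (i <= n)%N by rewrite -ltnS.
  by rewrite /c mulrCA subSn // -ltnS.
rewrite -big_split mulr_sumr; apply: eq_bigr => i _ /=.
rewrite -mulrDl -natrD subnKC // -ltnS; exact: ltn_ord.
Qed.

Lemma coef_comp_polyXaddC P z n : (P \Po ('X + z%:P))`_n = taylor_poly_coef P n z.
Proof.
have H : (P \Po ('X + z%:P))^`(n) = P^`(n) \Po ('X + z%:P).
  elim: n => [//|n IH]; rewrite !derivnS IH deriv_comp derivD derivX derivC addr0.
  by rewrite mulr1.
apply: (mulIf (fact_neq0 n)); rewrite /taylor_poly_coef mulfVK ?fact_neq0 //.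
have := coef_derivn n (P \Po ('X + z%:P)) 0; rewrite addn0 ffactnn H mulr_natr => <-.
by rewrite -horner_coef0 horner_comp !hornerE.
Qed.

Section PadeRational.
Variables (Omega : set C) (openOmega : open Omega) (f : Ainf Omega).
Variables (A B : {poly C}) (p q : nat).
Hypothesis fAB : forall z, Omega z -> f z = rat_fun A B z.
Hypothesis coAB : coprimep A B.
Hypothesis sizeA : size A = p.+1.
Hypothesis sizeB : (size B <= q.+1)%N.
Variable zeta : C.
Hypothesis cz : closure Omega zeta.
Hypothesis Bz : B.[zeta] != 0.

Let a := taylor_coef f zeta.

Let comp_inj (P Q : {poly C}) : P \Po ('X + zeta%:P) = Q \Po ('X + zeta%:P) -> P = Q.
Proof. by move=> /(congr1 (comp_poly ('X - zeta%:P))); rewrite !comp_polyXaddC_K. Qed.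

Let comp_X : ('X - zeta%:P) \Po ('X + zeta%:P) = 'X.
Proof. by rewrite comp_polyD comp_polyX -polyCN comp_polyC polyCN addrK. Qed.

Let comp_taylor_poly k : taylor_poly f zeta k \Po ('X + zeta%:P) = trunc_series a k.
Proof.
case: k => m; last by rewrite /= comp_poly0.
rewrite /= rmorph_sum /=; apply: eq_bigr => i _.
by rewrite comp_polyZ rmorphXn /= comp_X.
Qed.

Let comp_jacobi (row0 row1 : 'I_q.+1 -> {poly C}) :
  (forall j, row0 j \Po ('X + zeta%:P) = row1 j) ->
  \det (jacobi_mx f p zeta row0) \Po ('X + zeta%:P) = \det (jacobi_rows a p row1).
Proof.
move=> H; rewrite -(det_map_mx (comp_poly ('X + zeta%:P))); congr (\det _).
by apply/matrixP => i j; rewrite !mxE; case: ifP => _; [exact: H|exact: comp_polyC].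
Qed.

(** Composition with ['X + zeta%:P] moves the centre to 0, where the algebra of formal series
    applies. *)
Lemma comp_pade_A : pade_A f p q zeta \Po ('X + zeta%:P) = jacobi_num a p q.
Proof.
by apply: comp_jacobi => j; rewrite comp_polyM rmorphXn /= comp_X comp_taylor_poly.
Qed.

Lemma comp_pade_B : pade_B f p q zeta \Po ('X + zeta%:P) = jacobi_den a p q.
Proof. by apply: comp_jacobi => j; rewrite rmorphXn /= comp_X. Qed.

Let A' := A \Po ('X + zeta%:P).
Let B' := B \Po ('X + zeta%:P).

Let seriesAB n : \sum_(i < n.+1) B'`_i * a (n - i)%N%:Z = A'`_n.
Proof.
rewrite coef_comp_polyXaddC -(taylor_rat_coefP A n Bz); apply: eq_bigr => i _.
by rewrite coef_comp_polyXaddC /a /= (dext_rat openOmega (n - i) fAB cz Bz).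
Qed.

Let size_shift (P : {poly C}) : size (P \Po ('X + zeta%:P)) = size P.
Proof. by rewrite size_comp_poly2 // size_XaddC. Qed.

Lemma pade_D_rational : pade_D f p q zeta.
Proof.
right; apply: (@rational_hankel_neq0 _ a _ A' B') => //.
- exact: coprimep_comp_poly.
- by rewrite size_shift.
- by rewrite size_shift.
Qed.

Lemma pade_rational : exists2 c : C, c != 0 &
  pade_A f p q zeta = c *: A /\ pade_B f p q zeta = c *: B.
Proof.
have [|||||c c0 [H1 H2]] := @rational_jacobi _ a _ A' B' p q => //.
- exact: coprimep_comp_poly.
- by rewrite size_shift.
- by rewrite size_shift.
exists c => //; split; apply: comp_inj.
  by rewrite comp_pade_A H1 comp_polyZ.
by rewrite comp_pade_B H2 comp_polyZ.
Qed.

End PadeRational.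
End TaylorRational.

(** * Runge-type approximation and gluing *)

Section RationalApproximation.
Context {R : realType}.
Local Notation C := (Cplx R).
Implicit Types (a b z w : C) (V X : set C) (phi psi : C -> C) (P Q : {poly C}).

Definition rat_on V phi := exists P Q : {poly C},
  (forall z, V z -> Q.[z] != 0) /\ (forall z, V z -> phi z = P.[z] / Q.[z]).

Lemma rat_on_sub V V' phi : V' `<=` V -> rat_on V phi -> rat_on V' phi.
Proof. by move=> VV [P [Q [Q0 E]]]; exists P, Q; split=> z /VV; [exact: Q0|exact: E]. Qed.

Lemma rat_on_eq V phi psi : (forall z, V z -> phi z = psi z) -> rat_on V phi -> rat_on V psi.
Proof. by move=> pp [P [Q [Q0 E]]]; exists P, Q; split=> // z Vz; rewrite -pp // E. Qed.

Lemma rat_on_horner V P : rat_on V (horner P).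
Proof.
by exists P, 1; split=> z _; rewrite hornerE ?oner_neq0 // divr1.
Qed.

Lemma rat_on_cst V (c : C) : rat_on V (fun=> c).
Proof. by apply: rat_on_eq (rat_on_horner V c%:P) => z _; rewrite hornerC. Qed.

Lemma rat_onD V phi psi : rat_on V phi -> rat_on V psi -> rat_on V (fun z => phi z + psi z).
Proof.
move=> [P [Q [Q0 E]]] [P' [Q' [Q0' E']]]; exists (P * Q' + P' * Q), (Q * Q').
split=> z Vz; rewrite !hornerE; first by rewrite mulf_neq0 ?Q0 ?Q0'.
by rewrite E // E' //; field; rewrite Q0 ?Q0'.
Qed.

Lemma rat_onM V phi psi : rat_on V phi -> rat_on V psi -> rat_on V (fun z => phi z * psi z).
Proof.
move=> [P [Q [Q0 E]]] [P' [Q' [Q0' E']]]; exists (P * P'), (Q * Q').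
split=> z Vz; rewrite !hornerE; first by rewrite mulf_neq0 ?Q0 ?Q0'.
by rewrite E // E' //; field; rewrite Q0 ?Q0'.
Qed.

Lemma rat_onMl V (c : C) phi : rat_on V phi -> rat_on V (fun z => c * phi z).
Proof. exact: rat_onM (rat_on_cst V c). Qed.

Lemma rat_onB V phi psi : rat_on V phi -> rat_on V psi -> rat_on V (fun z => phi z - psi z).
Proof.
move=> Hphi /(rat_onMl (-1)) Hpsi; apply: rat_on_eq (rat_onD Hphi Hpsi) => z _.
by rewrite mulN1r.
Qed.

Lemma rat_on_sum V n (F : 'I_n -> C -> C) : (forall i, rat_on V (F i)) ->
  rat_on V (fun z => \sum_(i < n) F i z).
Proof.
move=> HF; elim: n F HF => [|n IH] F HF.
  by apply: rat_on_eq (rat_on_cst V 0) => z _; rewrite big_ord0.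
apply: rat_on_eq (rat_onD (HF ord0) (IH (fun i => F (lift ord0 i)) (fun i => HF _))).
by move=> z _; rewrite big_ord_recl.
Qed.

Lemma rat_on_pole V b : ~ V b -> rat_on V (fun z => (z - b)^-1).
Proof.
move=> Vb; exists 1, ('X - b%:P); split=> z Vz; rewrite !hornerE.
  by rewrite subr_eq0; apply/eqP => zb; apply: Vb; rewrite -zb.
by [].
Qed.

Lemma rat_on_bounded V K phi : compact K -> K `<=` V -> rat_on V phi ->
  exists2 M : R, 0 < M & forall z, K z -> modulus (phi z) <= M.
Proof.
move=> cK KV [P [Q [Q0 E]]].
have [z Kz|M M0 HM] := compact_modulus_bounded cK (f := rat_der P Q 0).
  by apply: rat_der_continuous; exact: Q0 (KV z Kz).
by exists M => // z Kz; rewrite (E z (KV z Kz)); have := HM z Kz; rewrite /rat_der expr1.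
Qed.

(** [X] is where the approximation is uniform, [V] the set that the poles of the approximants
    avoid. *)
Definition approximable X V phi := forall e : R, 0 < e ->
  exists2 psi, rat_on V psi & forall z, X z -> modulus (psi z - phi z) <= e.

Definition bounded_on X phi := exists2 M : R, 0 < M & forall z, X z -> modulus (phi z) <= M.

Lemma rat_on_approximable X V phi : rat_on V phi -> approximable X V phi.
Proof. by move=> H e e0; exists phi => // z _; rewrite subrr modulus0 ltW. Qed.

Lemma approximable_eq X V phi psi : (forall z, X z -> phi z = psi z) ->
  approximable X V phi -> approximable X V psi.
Proof.
by move=> pp H e /H[t rt Ht]; exists t => // z Xz; rewrite -pp //; exact: Ht.
Qed.

Lemma approximable_sub X X' V phi : X' `<=` X -> approximable X V phi -> approximable X' V phi.
Proof. by move=> XX H e /H[t rt Ht]; exists t => // z /XX/Ht. Qed.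

Lemma approximable_lim X V phi : (forall e : R, 0 < e -> exists2 psi,
    approximable X V psi & forall z, X z -> modulus (psi z - phi z) <= e) ->
  approximable X V phi.
Proof.
move=> H e e0; have e2 : 0 < e / 2 by rewrite divr_gt0.
have [psi /(_ _ e2)[t rt Ht] Hpsi] := H _ e2; exists t => // z Xz.
have := Ht z Xz; have := Hpsi z Xz; have := modulus_dist_trans (psi z) (t z) (phi z).
lra.
Qed.

Lemma approximableD X V phi psi : approximable X V phi -> approximable X V psi ->
  approximable X V (fun z => phi z + psi z).
Proof.
move=> H H' e e0; have e2 : 0 < e / 2 by rewrite divr_gt0.
have [t rt Ht] := H _ e2; have [t' rt' Ht'] := H' _ e2.
exists (fun z => t z + t' z); first exact: rat_onD.
move=> z Xz; rewrite opprD addrACA; have := Ht z Xz; have := Ht' z Xz.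
have := modulusD (t z - phi z) (t' z - psi z); lra.
Qed.

Lemma approximable_sum X V n (F : 'I_n -> C -> C) :
  (forall i, approximable X V (F i)) -> approximable X V (fun z => \sum_(i < n) F i z).
Proof.
move=> HF; elim: n F HF => [|n IH] F HF.
  apply: approximable_eq (rat_on_approximable X (rat_on_cst V 0)) => z _.
  by rewrite big_ord0.
apply: approximable_eq (approximableD (HF ord0) (IH (fun i => F (lift ord0 i)) (fun i => HF _))).
by move=> z _; rewrite big_ord_recl.
Qed.

Lemma approximableM X V phi psi : bounded_on X phi -> bounded_on X psi ->
  approximable X V phi -> approximable X V psi ->
  approximable X V (fun z => phi z * psi z).
Proof.
move=> [M M0 HM] [N N0 HN] H H' e e0.
have N1 : 0 < N + 1 by lra.
have [|t rt Ht] := H (e / (2 * (N + 1))); first by rewrite divr_gt0 ?mulr_gt0.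
have m0 : 0 < Num.min 1 (e / (2 * M)) by rewrite lt_min ltr01 divr_gt0 ?mulr_gt0.
have [t' rt' Ht'] := H' _ m0.
exists (fun z => t z * t' z); first exact: rat_onM.
move=> z Xz; have H1 := Ht z Xz; have := Ht' z Xz; rewrite le_min => /andP[H2 H3].
have -> : t z * t' z - phi z * psi z = (t z - phi z) * t' z + phi z * (t' z - psi z) by ring.
apply: le_trans (modulusD _ _) _; rewrite !modulusM.
have H4 : modulus (t' z) <= N + 1.
  by have := HN z Xz; have := ler_modulusB (t' z) (psi z); lra.
have : modulus (t z - phi z) * modulus (t' z) <= e / (2 * (N + 1)) * (N + 1).
  by rewrite ler_pM ?modulus_ge0.
have : modulus (phi z) * modulus (t' z - psi z) <= M * (e / (2 * M)).
  by rewrite ler_pM ?modulus_ge0 ?HM.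
have -> : M * (e / (2 * M)) = e / 2 by field; rewrite gt_eqF.
have -> : e / (2 * (N + 1)) * (N + 1) = e / 2 by field; rewrite gt_eqF //; lra.
lra.
Qed.

Lemma bounded_onM X phi psi : bounded_on X phi -> bounded_on X psi ->
  bounded_on X (fun z => phi z * psi z).
Proof.
move=> [M M0 HM] [N N0 HN]; exists (M * N); first exact: mulr_gt0.
by move=> z Xz; rewrite modulusM ler_pM ?modulus_ge0 ?HM ?HN.
Qed.

Lemma bounded_on_cst X (c : C) : bounded_on X (fun=> c).
Proof.
by exists (modulus c + 1) => [|z _]; [have := modulus_ge0 c; lra|rewrite lerDl].
Qed.

Lemma approximableX X V phi n : bounded_on X phi -> approximable X V phi ->
  bounded_on X (fun z => phi z ^+ n) /\ approximable X V (fun z => phi z ^+ n).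
Proof.
move=> bphi aphi; elim: n => [|n [bn an]].
  by split; [exact: bounded_on_cst|exact/rat_on_approximable/rat_on_cst].
have -> : (fun z => phi z ^+ n.+1) = (fun z => phi z * phi z ^+ n).
  by apply/funext => z; exact: exprS.
split; first exact: bounded_onM.
exact: approximableM.
Qed.

Lemma bounded_on_pole X b (d : R) : 0 < d ->
  (forall z, X z -> d <= modulus (z - b)) -> bounded_on X (fun z => (z - b)^-1).
Proof.
move=> d0 Hd; exists d^-1; first by rewrite invr_gt0.
move=> z /Hd dz; rewrite modulusV lef_pV2 ?posrE //; exact: lt_le_trans dz.
Qed.

(* [1 / (z - a)] is expanded in powers of [(a - b) / (z - b)]. *)
Lemma approximable_pole_step X V a b (d : R) : 0 < d ->
  (forall z, X z -> d <= modulus (z - a)) -> (forall z, X z -> d <= modulus (z - b)) ->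
  2 * modulus (a - b) <= d ->
  approximable X V (fun z => (z - b)^-1) -> approximable X V (fun z => (z - a)^-1).
Proof.
move=> d0 za zb ab Hb; apply: approximable_lim => e e0.
have bb := bounded_on_pole d0 zb.
(* The remainder is at most [2 ^ - n / d], hence at most [1 / (n.+1 * d)]. *)
have [n Hn] : exists n : nat, 1 / (d * e) < n%:R.
  by exists (Num.bound (1 / (d * e))); apply: archi_boundP; rewrite divr_ge0 // mulr_ge0 // ltW.
exists (fun z => \sum_(k < n) (a - b) ^+ k * (z - b)^-1 ^+ k.+1).
  apply: approximable_sum => k; apply: approximableM.
  - exact: bounded_on_cst.
  - by case: (approximableX k.+1 bb Hb).
  - exact/rat_on_approximable/rat_on_cst.
  - by case: (approximableX k.+1 bb Hb).
move=> z Xz.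
have za0 : z - a != 0 by rewrite -modulus_gt0; apply: lt_le_trans (za z Xz).
have zb0 : z - b != 0 by rewrite -modulus_gt0; apply: lt_le_trans (zb z Xz).
pose y := (a - b) / (z - b).
have y2 : modulus y <= 2^-1.
  rewrite /y modulusM modulusV ler_pdivrMr ?modulus_gt0 //.
  have := zb z Xz; lra.
have -> : \sum_(k < n) (a - b) ^+ k * (z - b)^-1 ^+ k.+1 - (z - a)^-1 = - (y ^+ n / (z - a)).
  have E : \sum_(k < n) (a - b) ^+ k * (z - b)^-1 ^+ k.+1 = (z - b)^-1 * \sum_(k < n) y ^+ k.
    rewrite mulr_sumr; apply: eq_bigr => k _; rewrite /y exprMn exprSr mulrA mulrC.
    by rewrite mulrA.
  have y1 : y - 1 = - (z - a) / (z - b) by rewrite /y; field.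
  have := subrX1 y n; rewrite y1 => S.
  have {}S : \sum_(k < n) y ^+ k = (1 - y ^+ n) * (z - b) / (z - a).
    apply: (mulfI (_ : - (z - a) / (z - b) != 0)).
      by rewrite mulf_neq0 ?oppr_eq0 ?invr_eq0.
    by rewrite -S; field; rewrite za0 zb0.
  by rewrite E S; field; rewrite za0 zb0.
rewrite modulusN modulusM modulusX modulusV.
have yn : modulus y ^+ n <= n.+1%:R^-1.
  apply: (@le_trans _ _ (2^-1 ^+ n)); first by rewrite lerXn2r ?nnegrE ?modulus_ge0.
  rewrite exprVn lef_pV2 ?posrE ?exprn_gt0 // -natrX ler_nat; exact: ltn_expl.
have dz : (modulus (z - a))^-1 <= d^-1.
  by rewrite lef_pV2 ?posrE ?modulus_gt0 //; exact: za.
have : modulus y ^+ n / modulus (z - a) <= n.+1%:R^-1 / d.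
  by rewrite ler_pM ?exprn_ge0 ?modulus_ge0 ?invr_ge0 ?modulus_ge0.
move=> /le_trans; apply; rewrite ler_pdivrMr // -[leLHS]mul1r ler_pdivrMr //.
rewrite -ler_pdivrMl ?mulr_gt0 // mulr1 [e * d]mulrC -[leLHS]mul1r.
by apply: ltW; apply: (lt_trans Hn); rewrite ltr_nat.
Qed.

(** Pole pushing: the segment is divided into steps of length at most [d / 2], as
    [approximable_pole_step] requires. *)
Lemma approximable_pole_segment X V a b (d : R) : 0 < d ->
  (forall t z, 0 <= t <= 1 -> X z -> d <= modulus (z - (a + rc t * (b - a)))) ->
  ~ V b -> approximable X V (fun z => (z - a)^-1).
Proof.
move=> d0 Hd Vb.
have [N HN] : exists N : nat, 2 * modulus (b - a) / d < N%:R.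
  exists (Num.bound (2 * modulus (b - a) / d)); apply: archi_boundP.
  by rewrite divr_ge0 ?mulr_ge0 ?modulus_ge0 // ltW.
have N0 : 0 < N%:R :> R.
  apply: le_lt_trans HN; by rewrite divr_ge0 ?mulr_ge0 ?modulus_ge0 // ltW.
(* Numbered from [b], where the pole is admissible, back to [a]. *)
pose c (i : nat) := a + rc (1 - i%:R / N%:R) * (b - a).
suff H i : (i <= N)%N -> approximable X V (fun z => (z - c i)^-1).
  have := H N (leqnn N); rewrite /c mulfV ?gt_eqF // subrr rc0 mul0r addr0 //.
have t01 (j : nat) : (j <= N)%N -> 0 <= 1 - j%:R / N%:R :> R /\ 1 - j%:R / N%:R <= 1 :> R.
  move=> jN; rewrite subr_ge0 gerBl divr_ge0 ?(ltW N0) //; split=> //.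
  by rewrite ler_pdivrMr // mul1r ler_nat.
elim: i => [|i IH] iN.
  have -> : c 0%N = b by rewrite /c mul0r subr0 rc1 mul1r addrC subrK.
  exact/rat_on_approximable/rat_on_pole.
have iN' : (i <= N)%N by exact: ltnW.
apply: (approximable_pole_step d0 _ _ _ (IH iN')).
- by move=> z; apply: Hd; apply/andP; exact: t01.
- by move=> z; apply: Hd; apply/andP; exact: t01.
have -> : c i.+1 - c i = rc (- N%:R^-1) * (b - a).
  have -> : - N%:R^-1 = (1 - i.+1%:R / N%:R) - (1 - i%:R / N%:R) :> R.
    by rewrite -[i.+1]addn1 natrD; field; rewrite gt_eqF.
  by rewrite rcB /c; ring.
rewrite modulusM modulus_rc normrN ger0_norm ?invr_ge0 ?(ltW N0) //.
by rewrite mulrCA ler_pdivrMl //; move: HN; rewrite ltr_pdivrMr //; exact: ltW.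
Qed.

(** Walk from [a] towards an almost nearest point [x] of [X] and stop at distance [2 * tau] from it.
    The path stays within [modulus (x - a) - 2 * tau] of [a], while all of [X] is farther than
    [modulus (x - a) - tau] from [a]; so the path keeps the distance [tau] from [X]. *)
Lemma exists_near_pole X a (d mu : R) : X !=set0 -> 0 < d -> 0 < mu ->
  (forall z, X z -> d <= modulus (z - a)) ->
  exists b x (e : R), [/\ X x, modulus (b - x) < mu, 0 < e &
    forall t z, 0 <= t <= 1 -> X z -> e <= modulus (z - (a + rc t * (b - a)))].
Proof.
move=> [x0 Xx0] d0 mu0 Hd; pose S := [set modulus (z - a) | z in X].
have lS : has_inf S.
  by split; [exists (modulus (x0 - a)), x0|exists d => _ [z /Hd ? <-]].
pose D := inf S.
have dD : d <= D by apply: lb_le_inf => [|_ [z /Hd ? <-] //]; case: lS.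
pose tau := Num.min (mu / 4) (d / 4).
have tau0 : 0 < tau by rewrite lt_min !divr_gt0.
have taumu : tau <= mu / 4 by rewrite ge_min lexx.
have taud : tau <= d / 4 by rewrite ge_min lexx orbT.
have [_ [x Xx <-] xD] := inf_adherent tau0 lS; rewrite -/D in xD.
have Dx z : X z -> D <= modulus (z - a) by move=> Xz; apply: ge_inf; [case: lS|exists z].
have m0 : 0 < modulus (x - a) by have := Dx x Xx; lra.
pose s := 1 - 2 * tau / modulus (x - a).
have s0 : 0 <= s by rewrite subr_ge0 ler_pdivrMr // mul1r; have := Dx x Xx; lra.
have s1 : 1 - s = 2 * tau / modulus (x - a) by rewrite /s opprB addrC subrK.
have sm : s * modulus (x - a) = modulus (x - a) - 2 * tau.
  by rewrite /s mulrBl mul1r divfK ?gt_eqF.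
clearbody s.
exists (a + rc s * (x - a)), x, tau; split=> //.
  have -> : a + rc s * (x - a) - x = - (rc (1 - s) * (x - a)) by rewrite rcB rc1; ring.
  rewrite modulusN modulusM modulus_rc s1 ger0_norm; last first.
    by rewrite divr_ge0 ?mulr_ge0 ?ltW.
  rewrite divfK ?gt_eqF //; lra.
move=> t z /andP[t0 t1] Xz.
have -> : a + rc t * (a + rc s * (x - a) - a) = a + rc (t * s) * (x - a).
  by rewrite rcM; ring.
have := modulus_dist_trans (a + rc (t * s) * (x - a)) z a.
have -> : a + rc (t * s) * (x - a) - a = rc (t * s) * (x - a) by ring.
rewrite modulusM modulus_rc ger0_norm ?mulr_ge0 //.
have : t * s * modulus (x - a) <= modulus (x - a) - 2 * tau.
  apply: (@le_trans _ _ (s * modulus (x - a))).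
    by rewrite ler_pM2r // ler_piMl.
  by rewrite sm.
have := Dx z Xz; lra.
Qed.

(** Each pole is pushed to a point off [X] but within [mu] of it; the last hypothesis says that such
    points avoid [V]. So poles lying in [V] but off [X] are removed, with no need to reach
    prescribed points. [X] may be unbounded; products of approximations are controlled on its
    bounded part [X0]. *)
Lemma approximable_rat X X0 V P Q (mu : R) : X0 `<=` X -> X !=set0 -> Q != 0 -> 0 < mu ->
  bounded_on X0 id ->
  (forall a, root Q a -> exists2 d : R, 0 < d & forall z, X z -> d <= modulus (z - a)) ->
  (forall b x (d : R), X x -> modulus (b - x) < mu -> 0 < d ->
     (forall z, X z -> d <= modulus (z - b)) -> ~ V b) ->
  approximable X0 V (fun z => P.[z] / Q.[z]).
Proof.
move=> X0X Xn0 Q0 mu0 bX0 Qroot HV.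
have bP : bounded_on X0 (horner P).
  elim/poly_ind: P => [|P c [M M0 HM]].
    by have [M M0 HM] := bounded_on_cst X0 0; exists M => // z; rewrite horner0; exact: HM.
  have [N N0 HN] := bX0; exists (M * N + modulus c).
    by rewrite ltr_wpDr ?modulus_ge0 // mulr_gt0.
  move=> z Xz; rewrite hornerMXaddC; apply: le_trans (modulusD _ _) _.
  by rewrite lerD2r modulusM ler_pM ?modulus_ge0 ?HM ?(HN z Xz).
have [r Qr] := closed_field_poly_normal Q.
have rroot a : a \in r -> root Q a.
  by move=> ar; rewrite Qr rootZ ?lead_coef_eq0 // root_prod_XsubC.
have [bQ aQ] : bounded_on X0 (fun z => \prod_(a <- r) (z - a)^-1) /\
    approximable X0 V (fun z => \prod_(a <- r) (z - a)^-1).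
  elim: r {Qr} rroot => [|a r IH] rroot.
    split.
      by have [M M0 HM] := bounded_on_cst X0 1; exists M => // z Xz; rewrite big_nil; exact: HM Xz.
    by apply: approximable_eq (rat_on_approximable X0 (rat_on_cst V 1)) => z _; rewrite big_nil.
  have [|bI aI] := IH; first by move=> b br; apply: rroot; rewrite inE br orbT.
  have [d d0 Hd] := Qroot a (rroot a (mem_head _ _)).
  have [b [x [e [Xx bx e0 He]]]] := exists_near_pole Xn0 d0 mu0 Hd.
  have Vb : ~ V b.
    apply: (HV b x e Xx bx e0) => z Xz; have := He 1 z ltac:(rewrite ler01 lexx //) Xz.
    by rewrite rc1 mul1r [a + _]addrC subrK.
  have ba : bounded_on X0 (fun z => (z - a)^-1).
    by apply: (bounded_on_pole d0) => z /X0X; exact: Hd.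
  have aa := approximable_sub X0X (approximable_pole_segment e0 He Vb).
  split.
    have [M M0 HM] := bounded_onM ba bI; exists M => // z Xz.
    by rewrite big_cons; exact: HM.
  by apply: approximable_eq (approximableM ba bI aa aI) => z _; rewrite big_cons.
have aP : approximable X0 V (horner P) by exact/rat_on_approximable/rat_on_horner.
have bl := bounded_on_cst X0 (lead_coef Q)^-1.
have al := rat_on_approximable X0 (rat_on_cst V (lead_coef Q)^-1).
apply: approximable_eq (approximableM bP (bounded_onM bl bQ) aP (approximableM bl bQ al aQ)).
move=> z _; rewrite [in RHS]Qr hornerZ horner_prod invfM -prodfV.
by congr (_ * (_ * _)); apply: eq_bigr => a _; rewrite !hornerE.
Qed.

End RationalApproximation.

Lemma rc_imagE (R : realType) (x y : R) :
  rc x + imag_unit * rc y = Complex x y :> Cplx R.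
Proof. by rewrite [RHS]complex_ReIm. Qed.

(** * Midpoint sums of the Cauchy kernel on a grid *)

Section Lattice.
Context {R : realType}.
Local Notation C := (Cplx R).
Local Notation I := (@imag_unit R).
Implicit Types (z w : C) (a b : nat).

Variables (eta : R) (n : nat).

(* A grid of squares of side [2 * eta]: the square [(a, b)] with [1 <= a, b <= n]
   lies in the box of half side [n * eta]. [vterm a b] is attached to the
   midpoint of the common side of the squares [(a, b)] and [(a.+1, b)], and
   [hterm a b] to that of [(a, b)] and [(a, b.+1)]. *)
Definition center a b : C :=
  rc (eta * (2 * a%:R - n%:R - 1)) + I * rc (eta * (2 * b%:R - n%:R - 1)).
Definition vmid a b : C :=
  rc (eta * (2 * a%:R - n%:R)) + I * rc (eta * (2 * b%:R - n%:R - 1)).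
Definition hmid a b : C :=
  rc (eta * (2 * a%:R - n%:R - 1)) + I * rc (eta * (2 * b%:R - n%:R)).
Definition vterm a b z : C := rc eta / (vmid a b - z).
Definition hterm a b z : C := I * rc eta / (hmid a b - z).
(* The midpoint rule for the integral of [1 / (w - z)] along the sides. *)
Definition square a b z : C :=
  vterm a.+1 b.+1 z - vterm a b.+1 z + (hterm a.+1 b.+1 z - hterm a.+1 b z).

Lemma vmidE a b : vmid a b = center a b + rc eta.
Proof.
rewrite /vmid /center; have -> : eta * (2 * a%:R - n%:R) = eta * (2 * a%:R - n%:R - 1) + eta.
  by ring.
by rewrite [rc (_ + eta)]rcD; ring.
Qed.
Lemma vmidSE a b : vmid a b = center a.+1 b - rc eta.
Proof.
rewrite /vmid /center; have -> : eta * (2 * a.+1%:R - n%:R - 1) = eta * (2 * a%:R - n%:R) + eta.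
  by rewrite -[a.+1]addn1 natrD; ring.
by rewrite [rc (_ + eta)]rcD; ring.
Qed.
Lemma hmidE a b : hmid a b = center a b + I * rc eta.
Proof.
rewrite /hmid /center; have -> : eta * (2 * b%:R - n%:R) = eta * (2 * b%:R - n%:R - 1) + eta.
  by ring.
by rewrite [rc (_ + eta)]rcD; ring.
Qed.
Lemma hmidSE a b : hmid a b = center a b.+1 - I * rc eta.
Proof.
rewrite /hmid /center; have -> : eta * (2 * b.+1%:R - n%:R - 1) = eta * (2 * b%:R - n%:R) + eta.
  by rewrite -[b.+1]addn1 natrD; ring.
by rewrite [rc (_ + eta)]rcD; ring.
Qed.

Hypothesis eta0 : 0 < eta.

Let rc_eta0 : rc eta != 0.
Proof. by rewrite -modulus_gt0 modulus_rc gtr0_norm. Qed.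

(** In the coordinate [y] the four midpoints are the fourth roots of unity, and the sum is a partial
    fraction expansion. Its decay of order 4 in the distance is what makes all distant squares
    together negligible. *)
Lemma squareE a b z : let y := (z - center a.+1 b.+1) / rc eta in
  y ^+ 4 != 1 -> square a b z = 4 / (1 - y ^+ 4).
Proof.
move=> y y4; have I2 : I ^+ 2 = -1 := imag_unit_sqr.
have yE : z = center a.+1 b.+1 + y * rc eta by rewrite /y mulfVK // addrC subrK.
have fac : 1 - y ^+ 4 = (1 - y) * (1 + y) * - ((I - y) * (I + y)).
  have -> : - ((I - y) * (I + y)) = y ^+ 2 - I ^+ 2 by ring.
  by rewrite I2; ring.
have : 1 - y ^+ 4 != 0 by rewrite subr_eq0 eq_sym.
rewrite fac !mulf_eq0 oppr_eq0 !mulf_eq0 !negb_or => /andP[/andP[h1 h2] /andP[h3 h4]].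
have -> : square a b z = (1 - y)^-1 + (1 + y)^-1 + (I / (I - y) + I / (I + y)).
  rewrite /square /vterm /hterm vmidE vmidSE hmidE hmidSE.
  rewrite yE.
  set c := center _ _.
  have -> : c + rc eta - (c + y * rc eta) = (1 - y) * rc eta by ring.
  have -> : c - rc eta - (c + y * rc eta) = - (1 + y) * rc eta by ring.
  have -> : c + I * rc eta - (c + y * rc eta) = (I - y) * rc eta by ring.
  have -> : c - I * rc eta - (c + y * rc eta) = - (I + y) * rc eta by ring.
  by field; rewrite h1 h2 h3 h4 rc_eta0.
have -> : I / (I - y) + I / (I + y) = 2 * I ^+ 2 / ((I - y) * (I + y)).
  by field; rewrite h3 h4.
rewrite I2; have E34 : (I - y) * (I + y) = - (1 + y ^+ 2).
  by rewrite -subr_sqr I2; ring.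
have h5 : 1 + y ^+ 2 != 0.
  by rewrite -oppr_eq0 -E34 mulf_neq0.
by rewrite E34; field; rewrite h1 h2 h5.
Qed.

Lemma modulus_square_le a b z (d : R) : 2 * eta <= d -> d <= modulus (z - center a.+1 b.+1) ->
  modulus (square a b z) <= 8 * (eta / d) ^+ 4.
Proof.
move=> etad dz; have eta_gt0 := eta0; have d0 : 0 < d by lra.
set y := (z - center a.+1 b.+1) / rc eta.
have my : d / eta <= modulus y.
  by rewrite /y modulusM modulusV modulus_rc gtr0_norm // ler_pM2r ?invr_gt0.
have y2 : 2 <= modulus y.
  by apply: le_trans my; rewrite ler_pdivlMr.
have y4 : 16 <= modulus y ^+ 4.
  have -> : 16 = 2 ^+ 4 :> R by rewrite -natrX.
  by rewrite lerXn2r ?nnegrE ?modulus_ge0.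
(* As |y| >= 2, subtracting 1 costs at most half of |y|^4; this turns the numerator 4 into the
   constant 8. *)
have H : modulus y ^+ 4 / 2 <= modulus (1 - y ^+ 4).
  have := ler_modulusB (y ^+ 4) 1; rewrite modulus1 modulusX modulus_distC; lra.
rewrite squareE; last first.
  by rewrite -/y eq_sym -subr_eq0 -modulus_gt0; apply: lt_le_trans H; lra.
rewrite -/y modulusM modulusV modulus_nat.
have -> : 8 * (eta / d) ^+ 4 = 4 / ((d / eta) ^+ 4 / 2).
  by field; rewrite !gt_eqF.
rewrite ler_pM2l // lef_pV2 ?posrE; last 2 first.
- by apply: lt_le_trans H; lra.
- by rewrite divr_gt0 // exprn_gt0 // divr_gt0.
apply: le_trans H; rewrite ler_pM2r ?invr_gt0 //.
by rewrite lerXn2r ?nnegrE ?modulus_ge0 // divr_ge0 ?ltW.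
Qed.

Definition box z : C := \sum_(a < n) \sum_(b < n) square a b z.

Lemma boxE z : box z = \sum_(b < n) (vterm n b.+1 z - vterm 0 b.+1 z) +
  \sum_(a < n) (hterm a.+1 n z - hterm a.+1 0 z).
Proof.
have tel (G : nat -> C) : \sum_(a < n) (G a.+1 - G a) = G n - G 0%N.
  by rewrite -(big_mkord xpredT (fun a => G a.+1 - G a)) telescope_sumr.
rewrite /box /square; under eq_bigr do rewrite big_split /=.
rewrite big_split /= exchange_big /=; congr (_ + _); apply: eq_bigr => k _.
  exact: (tel (fun a => vterm a k.+1 z)).
exact: (tel (fun b => hterm k.+1 b z)).
Qed.

(* Abel summation in each direction leaves only the terms of the midpoints
   between two squares with distinct weights. *)
Lemma weighted_squares (s : nat -> nat -> C) z :
  (forall b, s 0%N b = 0) -> (forall b, s n.+1 b = 0) ->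
  (forall a, s a 0%N = 0) -> (forall a, s a n.+1 = 0) ->
  \sum_(a < n) \sum_(b < n) s a.+1 b.+1 * square a b z =
  \sum_(b < n) \sum_(a < n.+1) (s a b.+1 - s a.+1 b.+1) * vterm a b.+1 z +
  \sum_(a < n) \sum_(b < n.+1) (s a.+1 b - s a.+1 b.+1) * hterm a.+1 b z.
Proof.
move=> s1 s2 s3 s4.
have abel (t G : nat -> C) : t 0%N = 0 -> t n.+1 = 0 ->
    \sum_(a < n) t a.+1 * (G a.+1 - G a) = \sum_(a < n.+1) (t a - t a.+1) * G a.
  move=> t0 tn; under eq_bigr do rewrite mulrBr; under [RHS]eq_bigr do rewrite mulrBl.
  rewrite !sumrB; congr (_ - _).
    by rewrite big_ord_recl t0 mul0r add0r.
  by rewrite big_ord_recr /= tn mul0r addr0.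
rewrite /square; under eq_bigr do (under eq_bigr do rewrite mulrDr; rewrite big_split /=).
rewrite big_split /= exchange_big /=; congr (_ + _); apply: eq_bigr => k _.
  exact: (abel (fun a => s a k.+1) (fun a => vterm a k.+1 z)).
exact: (abel (s k.+1) (fun b => hterm k.+1 b z)).
Qed.

Let r := n%:R * eta.

Let term_diff (e w z : C) (m : R) : modulus w = 1 -> 0 <= m < r -> r <= modulus e ->
  modulus z <= m -> modulus (w * rc eta / (e - z) - w * rc eta / (e - 0)) <=
    eta * (m / (r * (r - m))).
Proof.
move=> w1 /andP[m0 mr] re zm; have r0 : 0 < r by lra.
have e0 : e != 0 by rewrite -modulus_gt0; lra.
have ez : r - m <= modulus (e - z) by have := ler_modulusB e z; lra.
have ez0 : e - z != 0 by rewrite -modulus_gt0; lra.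
have -> : w * rc eta / (e - z) - w * rc eta / (e - 0) = w * rc eta * (z / (e * (e - z))).
  by rewrite subr0; field; rewrite e0 ez0.
rewrite !modulusM w1 mul1r modulus_rc gtr0_norm // ler_pM2l //.
rewrite modulusV modulusM ler_pM ?modulus_ge0 ?invr_ge0 ?mulr_ge0 ?modulus_ge0 //.
rewrite lef_pV2 ?posrE; first by rewrite ler_pM // ?subr_ge0 ltW.
  by rewrite mulr_gt0 ?modulus_gt0.
by apply: mulr_gt0 => //; rewrite subr_gt0.
Qed.

Let Re_mid (x y : R) : Re (rc x + I * rc y) = x.
Proof. by rewrite rc_imagE. Qed.
Let Im_mid (x y : R) : Im (rc x + I * rc y) = y.
Proof. by rewrite rc_imagE. Qed.

Let r_le_mid (x y : R) : (r <= `|x|) || (r <= `|y|) -> r <= modulus (rc x + I * rc y).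
Proof.
case/orP => H; apply: le_trans H _.
  by apply: le_trans (normr_Re_le_modulus _); rewrite Re_mid.
by apply: le_trans (normr_Im_le_modulus _); rewrite Im_mid.
Qed.

Let r0 : 0 <= r. Proof. by rewrite mulr_ge0 // ltW. Qed.

Let r_le_vmid b : r <= modulus (vmid n b) /\ r <= modulus (vmid 0 b).
Proof.
split; apply: r_le_mid; apply/orP; left.
  have -> : eta * (2 * n%:R - n%:R) = r by rewrite /r; ring.
  by rewrite ger0_norm.
have -> : eta * (2 * 0%N%:R - n%:R) = - r by rewrite /r; ring.
by rewrite normrN ger0_norm.
Qed.

Let r_le_hmid a : r <= modulus (hmid a n) /\ r <= modulus (hmid a 0).
Proof.
split; apply: r_le_mid; apply/orP; right.
  have -> : eta * (2 * n%:R - n%:R) = r by rewrite /r; ring.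
  by rewrite ger0_norm.
have -> : eta * (2 * 0%N%:R - n%:R) = - r by rewrite /r; ring.
by rewrite normrN ger0_norm.
Qed.

(** Only the [4 * n] outer midpoints survive, all at distance at least [r = n%:R * eta] from 0, and
    moving from 0 to [z] changes each term by at most [eta * (m / (r * (r - m)))]. *)
Lemma box_nearly_cst z (m : R) : 0 <= m < n%:R * eta -> modulus z <= m ->
  modulus (box z - box 0) <= 4 * (m / (n%:R * eta - m)).
Proof.
move=> mr zm; have [m0 mr'] := andP mr; have r_gt0 : 0 < r by rewrite /r; lra.
pose t := eta * (m / (r * (r - m))).
have vt (e : C) : r <= modulus e -> modulus (rc eta / (e - z) - rc eta / (e - 0)) <= t.
  by move=> re; have := term_diff (@modulus1 R) mr re zm; rewrite !mul1r.
have ht (e : C) : r <= modulus e ->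
    modulus (I * rc eta / (e - z) - I * rc eta / (e - 0)) <= t.
  by move=> re; exact: term_diff (@modulus_imag_unit R) mr re zm.
have dist2 (x y x' y' : C) : modulus (x - x') <= t -> modulus (y - y') <= t ->
    modulus ((x - y) - (x' - y')) <= 2 * t.
  move=> H1 H2; have -> : (x - y) - (x' - y') = (x - x') - (y - y') by ring.
  by have := modulusB (x - x') (y - y'); lra.
rewrite !boxE opprD addrACA -!sumrB; apply: le_trans (modulusD _ _) _.
have Hv : modulus (\sum_(i < n) (vterm n i.+1 z - vterm 0 i.+1 z -
    (vterm n i.+1 0 - vterm 0 i.+1 0))) <= n%:R * (2 * t).
  by apply: modulus_sum_le => i; have [H1 H2] := r_le_vmid i.+1; apply: dist2; exact: vt.
have Hh : modulus (\sum_(i < n) (hterm i.+1 n z - hterm i.+1 0 z -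
    (hterm i.+1 n 0 - hterm i.+1 0 0))) <= n%:R * (2 * t).
  by apply: modulus_sum_le => i; have [H1 H2] := r_le_hmid i.+1; apply: dist2; exact: ht.
apply: le_trans (lerD Hv Hh) _; rewrite le_eqVlt; apply/orP; left; apply/eqP.
have n0 : n%:R != 0 :> R by apply: contraTneq r_gt0 => n0; rewrite /r n0 mul0r ltxx.
have rm : n%:R * eta - m != 0 by rewrite gt_eqF // subr_gt0.
by rewrite /t /r; field; rewrite n0 rm gt_eqF.
Qed.

Let Re_inv (x y : R) : Re ((rc x + I * rc y)^-1) = x / (x ^+ 2 + y ^+ 2).
Proof.
by rewrite rc_imagE.
Qed.

Let Re_rcM (x : R) (w : C) : Re (rc x * w) = x * Re w.
Proof. by case: w => u v /=; rewrite mul0r subr0. Qed.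

Let ReI (x y : R) : Re (I * rc eta / (rc x + I * rc y)) = eta * (y / (x ^+ 2 + y ^+ 2)).
Proof.
rewrite rc_imagE -mulrA mulrCA Re_rcM; congr (_ * _).
by rewrite /= !mul0r mul1r sub0r opprK.
Qed.

(** The terms omit the common factor 2i of the contour integral, so the value approximates pi. Each
    opposite pair of outer midpoints contributes a real part of at least [eta / r = 1 / n], and
    there are [2 * n] pairs. *)
Lemma Re_box0 : (0 < n)%N -> 2 <= Re (box 0).
Proof.
move=> n0; have r_gt0 : 0 < r by rewrite mulr_gt0 ?ltr0n.
have key (x : R) : `|x| <= r -> eta / (2 * r) <= eta * (r / (r ^+ 2 + x ^+ 2)).
  move=> xr; rewrite ler_pM2l //.
  have x2 : x ^+ 2 <= r ^+ 2 by rewrite -(ger0_norm (sqr_ge0 x)) normrX lerXn2r ?nnegrE ?normr_ge0.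
  rewrite ler_pdivlMr; last by rewrite ltr_wpDr ?sqr_ge0 // exprn_gt0.
  rewrite mulrC ler_pdivrMr; last by rewrite pmulr_rgt0.
  by have -> : r * (2 * r) = r ^+ 2 + r ^+ 2; [ring|rewrite lerD2l].
have off (b : nat) : (b < n)%N -> `|eta * (2 * b.+1%:R - n%:R - 1)| <= r.
  move=> bn; rewrite normrM gtr0_norm // /r mulrC ler_pM2r // ler_norml.
  have : b.+1%:R <= n%:R :> R by rewrite ler_nat.
  have : 1 <= b.+1%:R :> R by rewrite ler1n.
  lra.
have Re_sum (F : 'I_n -> C) : Re (\sum_i F i) = \sum_i Re (F i).
  by elim/big_rec2: _ => [//|i u v _ <-]; rewrite ReD.
have Ern : eta * (2 * n%:R - n%:R) = r by rewrite /r; ring.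
have Er0 : eta * (2 * 0%N%:R - n%:R) = - r by rewrite /r; ring.
rewrite boxE ReD !Re_sum.
have Hsum (F : 'I_n -> R) : (forall i, eta / r <= F i) -> 1 <= \sum_i F i.
  move=> HF; apply: (@le_trans _ _ (\sum_(i < n) eta / r)); last exact: ler_sum.
  by rewrite sumr_const card_ord -mulr_natl mulrA mulfV // gt_eqF.
have half : eta / r = eta / (2 * r) + eta / (2 * r) by field; rewrite gt_eqF.
have -> : 2 = 1 + 1 :> R by [].
apply: lerD; apply: Hsum => i; rewrite ReB half.
  rewrite /vterm /vmid !subr0 !Re_rcM !Re_inv Ern Er0 sqrrN.
  by rewrite mulNr mulrN opprK; apply: lerD; apply: key; apply: off.
rewrite /hterm /hmid !subr0 !ReI Ern Er0 sqrrN mulNr mulrN opprK.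
by rewrite ![_ ^+ 2 + r ^+ 2]addrC; apply: lerD; apply: key; apply: off.
Qed.

End Lattice.

(** * A rational function close to 1 on a compact set and to 0 far from it *)

Section SeparatingFunction.
Context {R : realType}.
Local Notation C := (Cplx R).

Lemma separating_function (K : set C) (m d e : R) : 0 < m -> 0 < d -> 0 < e ->
  (forall k, K k -> modulus k <= m) ->
  exists u : C -> C, [/\ rat_on [set z | K z \/ forall k, K k -> 2 * d <= modulus (z - k)] u,
    forall z, K z -> modulus (u z - 1) <= e &
    forall z, (forall k, K k -> 2 * d <= modulus (z - k)) -> modulus (u z) <= e].
Proof.
move=> m0 d0 e0 Km.
(* The half side of the box: [4 * (m / (r - m)) <= e] makes the full sum constant up to [e] on [K],
   and beyond [m + d] no square is near [K]. *)
pose r := m + d + 4 * m / e.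
have me0 : 0 < 4 * m / e by rewrite divr_gt0 // mulr_gt0.
have r0 : 0 < r by rewrite /r; lra.
(* The third bound, with [eta <= 1], makes the total [n ^ 2 * 8 * (eta / d) ^ 4] over distant
   squares at most [e], since [n * eta = r]. *)
pose eta0 := Num.min 1 (Num.min (d / 2) (e * d ^+ 4 / (8 * r ^+ 2))).
have eta0_gt0 : 0 < eta0.
  by rewrite !lt_min ltr01 !divr_gt0 ?mulr_gt0 ?exprn_gt0.
pose n := (Num.bound (r / eta0)).+1.
have n0 : 0 < n%:R :> R by rewrite ltr0n.
have Hn : r / eta0 < n%:R.
  apply: lt_trans (archi_boundP _) _; first by rewrite divr_ge0 // ltW.
  by rewrite ltr_nat.
pose eta := r / n%:R.
have eta_gt0 : 0 < eta by rewrite divr_gt0.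
have eta_le : eta <= eta0.
  by rewrite /eta ler_pdivrMr // mulrC -ler_pdivrMr // ltW.
have rE : n%:R * eta = r by rewrite /eta mulrC divfK // gt_eqF.
have [eta1 etad etae] : [/\ eta <= 1, eta <= d / 2 & eta <= e * d ^+ 4 / (8 * r ^+ 2)].
  by move: eta_le; rewrite !le_min => /andP[-> /andP[-> ->]].
pose near a b := `[< exists2 k, K k & modulus (center eta n a b - k) <= d >].
pose s a b : C := (near a b)%:R.
have far (x y : R) : r <= `|x| \/ r <= `|y| ->
    ~ exists2 k, K k & modulus (rc x + imag_unit * rc y - k) <= d.
  move=> rxy [k Kk kd]; have mk := Km k Kk.
  have : r <= modulus (rc x + imag_unit * rc y).
    case: rxy => H; apply: le_trans H _.
      by have := normr_Re_le_modulus (rc x + imag_unit * rc y); rewrite {1}rc_imagE.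
    by have := normr_Im_le_modulus (rc x + imag_unit * rc y); rewrite {1}rc_imagE.
  have := ler_modulusB (rc x + imag_unit * rc y) k; rewrite /r; lra.
(* The indices 0 and [n.+1] stand for squares just outside the box; being away from [K] they have
   weight 0, as Abel summation requires. *)
have edge0 : r <= `|eta * (2 * 0%N%:R - n%:R - 1)|.
  have -> : eta * (2 * 0%N%:R - n%:R - 1) = - (r + eta) by rewrite -rE; ring.
  rewrite normrN ger0_norm; lra.
have edgen : r <= `|eta * (2 * n.+1%:R - n%:R - 1)|.
  have -> : eta * (2 * n.+1%:R - n%:R - 1) = r + eta by rewrite -rE -natr1; ring.
  rewrite ger0_norm; lra.
have s0a b : s 0%N b = 0 by rewrite /s /near asboolF //; apply: far; left.
have sna b : s n.+1 b = 0 by rewrite /s /near asboolF //; apply: far; left.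
have s0b a : s a 0%N = 0 by rewrite /s /near asboolF //; apply: far; right.
have snb a : s a n.+1 = 0 by rewrite /s /near asboolF //; apply: far; right.
pose U z := \sum_(a < n) \sum_(b < n) s a.+1 b.+1 * square eta n a b z.
pose c := box eta n 0.
have Rec : 2 <= Re c by apply: Re_box0.
have mc : 2 <= modulus c.
  by apply: le_trans (normr_Re_le_modulus c); apply: le_trans Rec (ler_norm _).
have c0 : c != 0 by rewrite -modulus_gt0; lra.
have small (w : nat -> nat -> bool) z :
    (forall a b, w a b -> d <= modulus (z - center eta n a.+1 b.+1)) ->
    modulus (\sum_(a < n) \sum_(b < n) (w a b)%:R * square eta n a b z) <= e.
  move=> Hw; apply: (@le_trans _ _ (n%:R * (n%:R * (8 * (eta / d) ^+ 4)))).
    apply: modulus_sum_le => a; apply: modulus_sum_le => b.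
    case wab : (w a b); last first.
      by rewrite mul0r modulus0 mulr_ge0 // exprn_ge0 // divr_ge0 // ltW.
    by rewrite mul1r; apply: modulus_square_le => //; [lra|exact: Hw].
  have -> : n%:R * (n%:R * (8 * (eta / d) ^+ 4)) = (8 * r ^+ 2 / d ^+ 4) * (eta * eta).
    by rewrite -rE; field; rewrite gt_eqF.
  apply: (@le_trans _ _ (8 * r ^+ 2 / d ^+ 4 * (e * d ^+ 4 / (8 * r ^+ 2)))).
    rewrite ler_pM2l; last by rewrite divr_gt0 ?mulr_gt0 ?exprn_gt0.
    by apply: le_trans etae; rewrite ler_piMl // ltW.
  by rewrite le_eqVlt; apply/orP; left; apply/eqP; field; rewrite !gt_eqF.
exists (fun z => c^-1 * U z); split.
(* A pole that remains lies within [eta] of the centre of a near square and of the centre of another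
   that is not near. The first puts it closer than [2 * d] to [K], the second keeps it off [K]. *)
- have away (x x' : nat * nat) (v : C) : modulus (v - center eta n x.1 x.2) <= eta ->
      modulus (v - center eta n x'.1 x'.2) <= eta -> near x.1 x.2 -> ~~ near x'.1 x'.2 ->
      ~ [set z | K z \/ forall k, K k -> 2 * d <= modulus (z - k)] v.
    move=> vx vx' /asboolP[k Kk kd] /asboolPn nx' [Kv|Fv].
      by apply: nx'; exists v => //; rewrite modulus_distC; lra.
    have := Fv k Kk; have := modulus_dist_trans (center eta n x.1 x.2) v k; lra.
  have term (x x' : nat * nat) (v w : C) : modulus (v - center eta n x.1 x.2) <= eta ->
      modulus (v - center eta n x'.1 x'.2) <= eta ->
      rat_on [set z | K z \/ forall k, K k -> 2 * d <= modulus (z - k)]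
        (fun z => (s x.1 x.2 - s x'.1 x'.2) * (w / (v - z))).
    move=> vx vx'.
    have pole : (near x.1 x.2 != near x'.1 x'.2) ->
        ~ [set z | K z \/ forall k, K k -> 2 * d <= modulus (z - k)] v.
      case E : (near x.1 x.2); case E' : (near x'.1 x'.2) => // _.
        by apply: (away x x') => //; rewrite E'.
      by apply: (away x' x) => //; rewrite E.
    have [E|/pole Vv] := eqVneq (near x.1 x.2) (near x'.1 x'.2).
      by apply: rat_on_eq (rat_on_cst _ 0) => z _; rewrite /s E subrr mul0r.
    apply: rat_on_eq (rat_onMl ((s x.1 x.2 - s x'.1 x'.2) * - w) (rat_on_pole Vv)) => z _.
    by rewrite -[z - v]opprB invrN !mulrN mulNr opprK mulrA.
  have etaN (w : C) : modulus w = 1 -> modulus (w * rc eta) <= eta.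
    by move=> w1; rewrite modulusM w1 mul1r modulus_rc gtr0_norm.
  have near1 (x w : C) : modulus w = 1 -> modulus (x + w * rc eta - x) <= eta.
    by move=> w1; rewrite addrC addKr; exact: etaN.
  have near2 (x w : C) : modulus w = 1 -> modulus (x - w * rc eta - x) <= eta.
    by move=> w1; rewrite addrC addKr modulusN; exact: etaN.
  apply: rat_onMl; apply: rat_on_eq (rat_onD
    (rat_on_sum (F := fun (b : 'I_n) z => \sum_(a < n.+1) (s a b.+1 - s a.+1 b.+1) * vterm eta n a b.+1 z) _)
    (rat_on_sum (F := fun (a : 'I_n) z => \sum_(b < n.+1) (s a.+1 b - s a.+1 b.+1) * hterm eta n a.+1 b z) _)).
  + by move=> z _; rewrite /U weighted_squares.
  + move=> b; apply: rat_on_sum => a.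
    apply: (term (nat_of_ord a, b.+1) (a.+1, b.+1)); rewrite [(_, _).1]/fst [(_, _).2]/snd.
      by rewrite vmidE -[rc eta]mul1r; apply: near1; exact: modulus1.
    by rewrite vmidSE -[rc eta]mul1r; apply: near2; exact: modulus1.
  + move=> a; apply: rat_on_sum => b.
    apply: (term (a.+1, nat_of_ord b) (a.+1, b.+1)); rewrite [(_, _).1]/fst [(_, _).2]/snd.
      by rewrite hmidE; apply: near1; exact: modulus_imag_unit.
    by rewrite hmidSE; apply: near2; exact: modulus_imag_unit.
- move=> z Kz; have zm := Km z Kz.
  have E : U z = box eta n z - \sum_(a < n) \sum_(b < n) (~~ near a.+1 b.+1)%:R * square eta n a b z.
    rewrite /U /box -sumrB; apply: eq_bigr => a _; rewrite -sumrB; apply: eq_bigr => b _.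
    by rewrite /s; case: (near _ _); rewrite ?mul1r ?mul0r ?subr0 ?subrr.
  have H1 : modulus (\sum_(a < n) \sum_(b < n) (~~ near a.+1 b.+1)%:R * square eta n a b z) <= e.
    apply: (small (fun a b => ~~ near a.+1 b.+1)) => a b /asboolPn nk.
    rewrite leNgt; apply/negP => zc; apply: nk; exists z => //.
    by rewrite modulus_distC ltW.
  have mr : 0 <= m < n%:R * eta by rewrite rE ltW //= /r; lra.
  have H2 : modulus (box eta n z - c) <= e.
    apply: le_trans (box_nearly_cst eta_gt0 mr zm) _; rewrite rE.
    have -> : r - m = d + 4 * m / e by rewrite /r; ring.
    rewrite mulrA ler_pdivrMr; last by lra.
    rewrite mulrDr; have -> : e * (4 * m / e) = 4 * m by field; rewrite gt_eqF.
    by rewrite lerDr mulr_ge0 // ltW.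
  have -> : c^-1 * U z - 1 = c^-1 * (U z - c) by field.
  rewrite modulusM modulusV ler_pdivrMl; last by lra.
  (* The distant squares and the variation of the box sum cost [e] each; dividing by [c], of modulus
     at least 2, gives [e] in total. *)
  apply: (@le_trans _ _ (2 * e)); last by rewrite ler_pM2r.
  rewrite E addrAC; set X := \sum_(_ < _) _ in H1 *.
  have := modulusB (box eta n z - c) X; lra.
move=> z Fz; rewrite modulusM modulusV ler_pdivrMl; last by lra.
apply: (@le_trans _ _ e); last by rewrite ler_peMl //; lra.
apply: (small (fun a b => near a.+1 b.+1)) => a b /asboolP[k Kk kd].
have := Fz k Kk; have := modulus_dist_trans (center eta n a.+1 b.+1) z k; lra.
Qed.

End SeparatingFunction.

(** * Gluing two rational functions *)

Section Gluing.
Context {R : realType}.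
Local Notation C := (Cplx R).
Implicit Types (Om K V X : set C) (rho : R) (P Q : {poly C}).

(** The closed [rho]-neighbourhood, written without a distance function; it is empty when [Om]
    is. *)
Definition thickening Om rho := [set z : C |
  forall e : R, 0 < e -> exists2 c, Om c & modulus (z - c) < rho + e].

Lemma closed_thickening Om rho : closed (thickening Om rho).
Proof.
apply: closed_modulusP => z H e e0; have e2 : 0 < e / 2 by rewrite divr_gt0.
have [w /(_ _ e2)[c Omc wc] wz] := H _ e2; exists c => //.
have := modulus_dist_trans w z c; rewrite (modulus_distC z w); lra.
Qed.

Lemma thickening_near Om rho w z : closure Om w -> modulus (z - w) <= rho ->
  thickening Om rho z.
Proof.
move=> /closure_modulusP clw zw e /clw[c Omc cw]; exists c => //.
have := modulus_dist_trans w z c; rewrite (modulus_distC w c); lra.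
Qed.

Lemma sub_thickening Om rho : 0 <= rho -> closure Om `<=` thickening Om rho.
Proof. by move=> r0 z clz; apply: thickening_near clz _; rewrite subrr modulus0. Qed.

Lemma thickening_far Om rho x (d : R) z : (forall c, Om c -> d <= modulus (x - c)) ->
  thickening Om rho z -> d - rho <= modulus (x - z).
Proof.
move=> dx tz; rewrite leNgt; apply/negP => H.
have [|c Omc zc] := tz (d - rho - modulus (x - z)); first by rewrite subr_gt0.
have := dx c Omc; have := modulus_dist_trans z x c; lra.
Qed.

Lemma approximable_empty X V (phi : C -> C) : ~ (X !=set0) -> approximable X V phi.
Proof.
move=> X0 e e0; exists (fun=> 0); first exact: rat_on_cst.
by move=> z Xz; case: X0; exists z.
Qed.

(** The glued function is [g' - u * (g' - k')], with [g'] and [k'] the two targets after removal of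
    their poles from [K] and the thickening, and [u] the separating function. [u] is made small only
    after [g' - k'] has been bounded on the two compact sets. *)
Lemma glue_rational K Om (mu rho : R) P Q G1 G2 n (e : R) : compact K ->
  0 < rho -> 4 * rho <= mu ->
  (forall k c, K k -> Om c -> mu <= modulus (k - c)) ->
  Q != 0 -> (forall z, K z -> Q.[z] != 0) ->
  G2 != 0 -> (forall a c, root G2 a -> Om c -> 2 * rho <= modulus (a - c)) -> 0 < e ->
  exists w, [/\ rat_on (K `|` thickening Om rho) w,
    forall z, K z -> modulus (w z - P.[z] / Q.[z]) <= e &
    forall z, thickening Om rho z -> modulus z <= n%:R ->
      modulus (w z - G1.[z] / G2.[z]) <= e].
Proof.
move=> cK rho0 rmu Kmu Q0 QK G20 G2r e0.
set T := thickening Om rho; set V := K `|` T.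
have mu0 : 0 < mu by lra.
have KT k z : K k -> T z -> mu - rho <= modulus (k - z).
  by move=> Kk; apply: thickening_far => c; exact: Kmu.
have [m m0 Km] := compact_bounded_modulus cK.
have mu2 : 0 < mu / 2 by lra.
have cT : compact (T `&` [set z : C | modulus z <= n%:R]).
  by rewrite setIC; apply: compact_closedI; [exact: compact_disc|exact: closed_thickening].
(* Points within [mu / 2] of the thickening cannot lie in [K], which is at distance
   [mu - rho >= 3 * mu / 4] from it; the same margin serves [apP]. *)
have apG : approximable (T `&` [set z : C | modulus z <= n%:R]) V (fun z => G1.[z] / G2.[z]).
  have [T0|T0] := pselect (T !=set0); last first.
    by apply: approximable_empty => -[z [Tz _]]; apply: T0; exists z.
  apply: (@approximable_rat _ T _ V G1 G2 (mu / 2)) => //.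
  - by exists (n%:R + 1) => [|z [_ /= zn]]; [rewrite ltr_wpDl|lra].
  - move=> a ra; exists rho => // z Tz; rewrite modulus_distC.
    have := @thickening_far Om rho a (2 * rho) z (fun c => G2r a c ra) Tz; lra.
  - move=> b x d Tx bx d0 Hd [Kb|Tb]; last by have := Hd b Tb; rewrite subrr modulus0; lra.
    have := KT b x Kb Tx; lra.
have apP : approximable K V (fun z => P.[z] / Q.[z]).
  have [K0|K0] := pselect (K !=set0); last exact: approximable_empty.
  apply: (@approximable_rat _ K K V P Q (mu / 2)) => //.
  - by exists m.
  - move=> a ra; have [||d d0 Hd] := @compact_separated _ K [set a] cK.
    + apply: closed_modulusP => z H; apply/eqP; rewrite -subr_eq0 -modulus_eq0.
      apply/negPn/negP => nz; have [|w -> wz] := H (modulus (z - a)).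
        by rewrite lt_def nz modulus_ge0.
      by rewrite modulus_distC ltxx in wz.
    + by move=> z Kz /= E; move: (QK z Kz); rewrite E; move/negP; apply.
    + by exists d => // z Kz; exact: Hd.
  - move=> b x d Kx bx d0 Hd [Kb|Tb]; first by have := Hd b Kb; rewrite subrr modulus0; lra.
    have := KT x b Kx Tb; rewrite modulus_distC; lra.
have e2 : 0 < e / 2 by lra.
have [g' rg Hg] := apG _ e2; have [k' rk Hk] := apP _ e2.
have rgk := rat_onB rg rk.
have [M1 M10 HM1] := rat_on_bounded cK (fun z Kz => or_introl Kz) rgk.
have [M2 M20 HM2] := rat_on_bounded cT (fun z Tz => or_intror Tz.1) rgk.
have eM : 0 < e / (2 * (M1 + M2)) by rewrite divr_gt0 // mulr_gt0 // addr_gt0.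
have mu4 : 0 < mu / 4 by lra.
have [u [ru Hu1 Hu0]] := separating_function m0 mu4 eM Km.
have far z : T z -> forall k, K k -> 2 * (mu / 4) <= modulus (z - k).
  by move=> Tz k Kk; rewrite modulus_distC; have := KT k z Kk Tz; lra.
have ruV : rat_on V u by apply: rat_on_sub ru => z [Kz|Tz]; [left|right; exact: far].
have small (x y M : R) : 0 <= x -> 0 <= y -> x <= e / (2 * (M1 + M2)) -> y <= M -> M <= M1 + M2 -> x * y <= e / 2.
  move=> x0 y0 xe yM MM.
  have -> : e / 2 = e / (2 * (M1 + M2)) * (M1 + M2) by field; rewrite gt_eqF // addr_gt0.
  by apply: ler_pM => //; exact: le_trans yM MM.
exists (fun z => g' z - u z * (g' z - k' z)); split.
- by apply: rat_onB => //; exact: rat_onM.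
- move=> z Kz; have -> : g' z - u z * (g' z - k' z) - P.[z] / Q.[z] =
      (k' z - P.[z] / Q.[z]) - (u z - 1) * (g' z - k' z) by ring.
  apply: le_trans (modulusB _ _) _; have := Hk z Kz.
  suff : modulus ((u z - 1) * (g' z - k' z)) <= e / 2 by lra.
  by rewrite modulusM; apply: (small _ _ M1); rewrite ?modulus_ge0 ?Hu1 ?HM1 ?lerDl ?(ltW M20).
- move=> z Tz zn; have -> : g' z - u z * (g' z - k' z) - G1.[z] / G2.[z] =
      (g' z - G1.[z] / G2.[z]) - u z * (g' z - k' z) by ring.
  apply: le_trans (modulusB _ _) _; have := Hg z (conj Tz zn).
  suff : modulus (u z * (g' z - k' z)) <= e / 2 by lra.
  rewrite modulusM; apply: (small _ _ M2); rewrite ?modulus_ge0 ?lerDr ?(ltW M10) //.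
    by apply: Hu0; exact: far.
  exact: (HM2 z (conj Tz zn)).
Qed.

End Gluing.

(** * Density *)

Section Values.
Context {R : realType}.
Local Notation C := (Cplx R).
Implicit Types (a b c d z : C) (A B P Q : {poly C}).

Definition ratio a b : Chat (R := R) := if b == 0 then None else Some (a / b).

Definition pair_norm a b : R := Num.sqrt (modulus a ^+ 2 + modulus b ^+ 2).

Lemma pair_norm_gt0 a b : ~ (a = 0 /\ b = 0) -> 0 < pair_norm a b.
Proof.
move=> ab; rewrite sqrtr_gt0 lt_def addr_ge0 ?sqr_ge0 // andbT.
rewrite paddr_eq0 ?sqr_ge0 // !sqrf_eq0 !modulus_eq0.
by apply/negP => /andP[/eqP a0 /eqP b0]; apply: ab.
Qed.

Lemma modulus_le_pair_norm a b : modulus a <= pair_norm a b /\ modulus b <= pair_norm a b.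
Proof.
by split; rewrite -[leLHS]ger0_norm ?modulus_ge0 // -sqrtr_sqr ler_wsqrtr //
  ?lerDl ?lerDr sqr_ge0.
Qed.

Lemma sqrt_ratio a b : b != 0 ->
  Num.sqrt (1 + modulus (a / b) ^+ 2) = pair_norm a b / modulus b.
Proof.
move=> b0; have mb : 0 < modulus b by rewrite modulus_gt0.
have -> : 1 + modulus (a / b) ^+ 2 =
    (modulus a ^+ 2 + modulus b ^+ 2) * ((modulus b)^-1) ^+ 2.
  by rewrite modulusM modulusV; field; rewrite gt_eqF.
by rewrite sqrtrM ?addr_ge0 ?sqr_ge0 // sqrtr_sqr ger0_norm // invr_ge0 ltW.
Qed.

(** In homogeneous coordinates one formula covers finite and infinite values, so no argument at
    poles is needed later. *)
Lemma chordal_ratio a b c d : ~ (a = 0 /\ b = 0) -> ~ (c = 0 /\ d = 0) ->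
  chordal (ratio a b) (ratio c d) =
  modulus (a * d - b * c) / (pair_norm a b * pair_norm c d).
Proof.
move=> ab cd; have ab0 := pair_norm_gt0 ab; have cd0 := pair_norm_gt0 cd.
have norm0 x : pair_norm x 0 = modulus x.
  by rewrite /pair_norm modulus0 expr0n /= addr0 sqrtr_sqr ger0_norm // modulus_ge0.
rewrite /ratio; have [b0|b0] := eqVneq b 0; have [d0|d0] := eqVneq d 0 => /=.
- by rewrite b0 d0 mulr0 mul0r subrr modulus0 mul0r.
- rewrite sqrt_ratio // b0 mul0r subr0 modulusM norm0 invf_div.
  by field; rewrite !gt_eqF // modulus_gt0; apply/eqP => a0; apply: ab.
- rewrite sqrt_ratio // d0 mulr0 sub0r modulusN modulusM norm0 invf_div.
  by field; rewrite !gt_eqF // modulus_gt0; apply/eqP => c0; apply: cd.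
rewrite !sqrt_ratio //; have -> : a / b - c / d = (a * d - b * c) / (b * d).
  by field; rewrite b0 d0.
rewrite modulusM modulusV modulusM; field.
by rewrite !gt_eqF ?modulus_gt0.
Qed.

Lemma gcd_horner A B z : ~ (A.[z] = 0 /\ B.[z] = 0) ->
  exists2 g : C, g != 0 & A.[z] = g * (rat_num A B).[z] /\ B.[z] = g * (rat_den A B).[z].
Proof.
move=> AB; have EA : A = rat_num A B * gcdp A B by rewrite divpK // dvdp_gcdl.
have EB : B = rat_den A B * gcdp A B by rewrite divpK // dvdp_gcdr.
have HA : A.[z] = (gcdp A B).[z] * (rat_num A B).[z] by rewrite {1}EA hornerM mulrC.
have HB : B.[z] = (gcdp A B).[z] * (rat_den A B).[z] by rewrite {1}EB hornerM mulrC.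
by exists (gcdp A B).[z] => //; apply: contra_notN AB => /eqP g0; rewrite HA HB g0 !mul0r.
Qed.

Lemma rat_valE A B z : ~ (A.[z] = 0 /\ B.[z] = 0) -> rat_val A B z = ratio A.[z] B.[z].
Proof.
move=> /gcd_horner[g g0 [-> ->]]; rewrite /rat_val /ratio mulf_eq0 (negbTE g0) /=.
by case: eqP => // _; rewrite -mulf_div mulfV // mul1r.
Qed.

Lemma rat_derivE A B l z : B.[z] != 0 -> rat_deriv A B l z = Some (rat_der A B l z).
Proof.
move=> Bz.
have AB w : B.[w] != 0 -> ~ (A.[w] = 0 /\ B.[w] = 0) by move=> /eqP Bw [].
have den w : B.[w] != 0 -> (rat_den A B).[w] != 0.
  by move=> Bw; have [g g0 [_ E]] := gcd_horner (AB w Bw); apply: contraNneq Bw; rewrite E => ->; rewrite mulr0.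
rewrite /rat_deriv (negbTE (den z Bz)); congr Some.
rewrite -derive1n_rat //; apply: (@derive1n_open _ [set w : C | B.[w] != 0]) => [||//]; first exact: open_horner_neq0.
move=> w /= Bw.
have [g g0 [E1 E2]] := gcd_horner (AB w Bw).
by rewrite /rat_fun E1 E2 -mulf_div mulfV // mul1r.
Qed.

Lemma rat_num_den_coprime P Q : Q != 0 -> forall z,
  ~ ((rat_num P Q).[z] = 0 /\ (rat_den P Q).[z] = 0).
Proof.
move=> Q0 z [/eqP Pz /eqP Qz].
have : coprimep (rat_num P Q) (rat_den P Q) by rewrite coprimep_div_gcd // Q0 orbT.
by move=> /Pdiv.ClosedField.coprimepP/(_ z Pz); rewrite Qz.
Qed.

Lemma rat_den_neq0 P Q : Q != 0 -> rat_den P Q != 0.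
Proof. move=> Q0; apply: contraNneq Q0 => d0; have : Q = rat_den P Q * gcdp P Q.
  by rewrite divpK // dvdp_gcdr.
by rewrite d0 mul0r => ->. Qed.

Lemma coprimep_roots A B : (forall z, root B z -> A.[z] != 0) -> coprimep A B.
Proof. by move=> H; rewrite coprimep_sym; apply/Pdiv.ClosedField.coprimepP. Qed.

Lemma exists_small_notin (s : seq C) (d : R) : 0 < d ->
  exists c : C, [/\ c != 0, modulus c <= d & c \notin s].
Proof.
move=> d0; have [r r0 Hr] : exists2 r : R, 0 < r & forall t, 0 < t < r -> rc t \notin s.
  elim: s => [|x s [r r0 Hr]]; first by exists 1.
  have [->|x0] := eqVneq x 0.
    by exists r => // t tr; rewrite inE negb_or Hr // andbT -modulus_gt0 modulus_rc normr_gt0 gt_eqF; case/andP: tr.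
  exists (Num.min r (modulus x)); first by rewrite lt_min r0 modulus_gt0.
  move=> t /andP[t0]; rewrite lt_min => /andP[tr tx]; rewrite inE negb_or Hr ?t0 // andbT.
  by apply/eqP => E; rewrite -E modulus_rc gtr0_norm ?ltxx in tx.
have m0 : 0 < Num.min r d / 2 by rewrite divr_gt0 // lt_min r0.
have [mr md] : Num.min r d <= r /\ Num.min r d <= d by rewrite !ge_min !lexx orbT.
exists (rc (Num.min r d / 2)); split.
- by rewrite -modulus_gt0 modulus_rc gtr0_norm.
- rewrite modulus_rc gtr0_norm //; lra.
- apply: Hr; rewrite m0 /=; lra.
Qed.

Lemma exists_root_split (S : set C) Q : Q != 0 -> exists Q1 Q2 : {poly C},
  [/\ Q = Q1 * Q2, Q1 != 0, forall z, root Q1 z -> S z & forall z, S z -> Q2.[z] != 0].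
Proof.
move=> Q0; have [r E] := closed_field_poly_normal Q.
exists (\prod_(x <- r | `[< S x >]) ('X - x%:P)),
  (lead_coef Q *: \prod_(x <- r | ~~ `[< S x >]) ('X - x%:P)).
have rootsP (p : pred C) z :
    root (\prod_(x <- r | p x) ('X - x%:P)) z = (z \in [seq x <- r | p x]).
  by rewrite -big_filter root_prod_XsubC.
split.
- by rewrite {1}E (bigID (fun x => `[< S x >])) /= scalerAr.
- apply/eqP => Q10; move/eqP: Q0; apply; rewrite E (bigID (fun x => `[< S x >])) /=.
  by rewrite Q10 mul0r scaler0.
- by move=> z; rewrite rootsP mem_filter => /andP[/asboolP].
move=> z Sz; rewrite hornerZ mulf_neq0 ?lead_coef_eq0 //.
by have := rootsP (fun x => ~~ `[< S x >]) z; rewrite mem_filter asboolT //= /root => ->.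
Qed.

Lemma exists_far_roots (Om : set C) Q : Q != 0 ->
  (forall z, closure Om z -> Q.[z] != 0) ->
  exists2 d : R, 0 < d & forall a c, root Q a -> Om c -> d <= modulus (a - c).
Proof.
move=> Q0 H; have [r E] := closed_field_poly_normal Q.
have rE a : root Q a -> a \in r.
  by rewrite E rootZ ?lead_coef_eq0 // root_prod_XsubC.
have : forall a, a \in r -> exists2 e : R, 0 < e & forall c, Om c -> e <= modulus (a - c).
  move=> a ar; apply: contrapT => nH.
  have /H : closure Om a.
    apply/closure_modulusP => e e0; apply: contrapT => nc; apply: nH; exists e => // c Omc.
    by rewrite leNgt; apply/negP => xc; apply: nc; exists c; rewrite // modulus_distC.
  apply/negP/negPn; rewrite -[_ == _]/(root Q a) E.
  by rewrite rootZ ?lead_coef_eq0 // root_prod_XsubC.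
move=> far; have [d d0 Hd] : exists2 d : R, 0 < d & forall a c, a \in r -> Om c -> d <= modulus (a - c).
  elim: r far {E rE} => [|x r IH] far; first by exists 1.
  have [e e0 He] := far x (mem_head x r).
  have [a ar|d d0 Hd] := IH; first by apply: far; rewrite inE ar orbT.
  exists (Num.min d e); first by rewrite lt_min d0.
  move=> a c; rewrite inE ge_min => /orP[/eqP ->|ar] Omc; first by rewrite He ?orbT.
  by rewrite Hd.
by exists d => // a c /rE ar; exact: Hd.
Qed.

(** [B] is chosen before the functions, so that uniform closeness on discs of radius [rho] gives
    closeness of derivatives with one constant. *)
Lemma iterated_cauchy_estimate l (rho : R) : 0 < rho -> exists2 B : R, 0 < B &
  forall (F : nat -> C -> C) z0 (M : R),
    (forall i z, modulus (z - z0) <= rho -> cderiv (F i) z (F i.+1 z)) ->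
    (forall z, modulus (z - z0) <= rho -> modulus (F 0 z) <= M) ->
    modulus (F l z0) <= B * M.
Proof.
elim: l rho => [|l IH] rho rho0.
  by exists 1 => // F z0 M _ FM; rewrite mul1r; apply: FM; rewrite subrr modulus0 ltW.
have rho2 : 0 < rho / 2 by rewrite divr_gt0.
have [B B0 HB] := IH _ rho2; exists (B * (4 / rho)); first by rewrite mulr_gt0 ?divr_gt0.
move=> F z0 M dF FM; rewrite -mulrA.
have inside z w : modulus (z - z0) <= rho / 2 -> modulus (w - z) <= rho / 2 ->
    modulus (w - z0) <= rho by have := modulus_dist_trans z w z0; lra.
apply: (HB (fun i => F i.+1)) => [i z zz|z zz].
  by apply: dF; have := rho2; lra.
have -> : 4 / rho * M = 2 * M / (rho / 2) by field; rewrite gt_eqF.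
apply: (@cauchy_estimate _ (F 0)) => // w wz.
- exact: dF (inside z w zz wz).
- exact: cderiv_continuous (dF 1%N w (inside z w zz wz)).
- exact: FM (inside z w zz wz).
Qed.

End Values.

(** * Rational functions that approximate both targets *)

Section Density.
Context {R : realType}.
Local Notation C := (Cplx R).
Implicit Types (z : C) (A B P Q : {poly C}) (K V : set C).

Lemma iterated_cauchy_estimates m (rho : R) : 0 < rho -> exists2 B : R, 0 < B &
  forall l (F : nat -> C -> C) z0 (M : R), (l <= m)%N ->
    (forall i z, modulus (z - z0) <= rho -> cderiv (F i) z (F i.+1 z)) ->
    (forall z, modulus (z - z0) <= rho -> modulus (F 0 z) <= M) ->
    modulus (F l z0) <= B * M.
Proof.
move=> rho0; elim: m => [|m [B B0 HB]].
  have [B B0 HB] := @iterated_cauchy_estimate R 0 rho rho0.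
  by exists B => // l F z0 M; rewrite leqn0 => /eqP ->; exact: HB.
have [B' B'0 HB'] := @iterated_cauchy_estimate R m.+1 rho rho0.
exists (B + B') => [|l F z0 M]; first exact: addr_gt0.
rewrite leq_eqVlt ltnS => lm dF FM.
have M0 : 0 <= M.
  by apply: le_trans (modulus_ge0 (F 0 z0)) (FM _ _); rewrite subrr modulus0 ltW.
case/orP: lm => [/eqP ->|lm].
  by apply: le_trans (HB' F z0 M dF FM) _; rewrite ler_wpM2r // lerDr ltW.
by apply: le_trans (HB l F z0 M lm dF FM) _; rewrite ler_wpM2r // lerDl ltW.
Qed.

(** By Bezout, a combination of [P] and [Q] with coefficients bounded on [K] is a nonzero constant.
    This bounds the denominators of the chordal formula from below. *)
Lemma coprimep_pair_norm K P Q : compact K -> coprimep P Q ->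
  exists2 M : R, 0 < M & forall z, K z -> 1 <= M * pair_norm P.[z] Q.[z].
Proof.
move=> cK /Bezout_coprimepP[[u v] /= /eqpP[[a b] /andP[/= a0 b0] E]].
have [Mu Mu0 HMu] := rat_on_bounded cK (fun z Kz => Kz) (rat_on_horner K u).
have [Mv Mv0 HMv] := rat_on_bounded cK (fun z Kz => Kz) (rat_on_horner K v).
have ma : 0 < modulus a by rewrite modulus_gt0.
have mb : 0 < modulus b by rewrite modulus_gt0.
exists (modulus a / modulus b * (Mu + Mv)) => [|z Kz].
  by rewrite mulr_gt0 ?divr_gt0 ?addr_gt0.
have [PN QN] := modulus_le_pair_norm P.[z] Q.[z].
have := congr1 (fun p => modulus p.[z]) E.
rewrite /= hornerZ hornerD !hornerM alg_polyC hornerC modulusM => Ez.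
have H : modulus (u.[z] * P.[z] + v.[z] * Q.[z]) <= (Mu + Mv) * pair_norm P.[z] Q.[z].
  apply: le_trans (modulusD _ _) _; rewrite !modulusM mulrDl.
  by apply: lerD; apply: ler_pM; rewrite ?modulus_ge0 ?HMu ?HMv.
rewrite -mulrA mulrAC ler_pdivlMr // mul1r -Ez.
by rewrite ler_pM2l.
Qed.

Lemma rat_on_nonzero V (phi : C -> C) : rat_on V phi -> exists P Q : {poly C},
  [/\ Q != 0, forall z, V z -> Q.[z] != 0 & forall z, V z -> phi z = P.[z] / Q.[z]].
Proof.
move=> [P [Q [QV E]]]; have [Q0|Q0] := eqVneq Q 0; last by exists P, Q.
have V0 z : ~ V z by move=> /QV; rewrite Q0 horner0 eqxx.
by exists 0, 1; split; rewrite ?oner_neq0 // => z /V0.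
Qed.

Lemma ratioM (c a b : C) : c != 0 -> ratio (c * a) (c * b) = ratio a b.
Proof.
by move=> c0; rewrite /ratio mulf_eq0 (negbTE c0) /= -mulf_div mulfV // mul1r.
Qed.

Variables (F : set (nat * nat)) (Omega : set C).
Hypothesis hF : exists pt qt : nat -> nat,
  [/\ forall n, F (pt n, qt n), pt n @[n --> \oo] --> \oo & qt n @[n --> \oo] --> \oo].
Hypothesis openOmega : open Omega.

Lemma exists_large_index a b : exists p q : nat, [/\ F (p, q), (a <= p)%N & (b <= q)%N].
Proof.
have [pt [qt [HF /cvgnyPge/(_ a) Hp /cvgnyPge/(_ b) Hq]]] := hF.
have [N _ HN] := filterI Hp Hq; have [aN bN] := HN N (leqnn N).
by exists (pt N), (qt N).
Qed.

(** As [c] is no root of [B], each root of [B] excludes a single value of [eta]. The point [c] is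
    fixed before [d], so that the perturbing term can be bounded on compact sets before [eta] is
    chosen. *)
Lemma exists_coprime_perturbation A B p : B != 0 -> (size A <= p)%N ->
  exists c : C, forall d : R, 0 < d -> exists eta : C, [/\ modulus eta <= d, coprimep (A + eta *: ('X - c%:P) ^+ p) B &
    size (A + eta *: ('X - c%:P) ^+ p) = p.+1].
Proof.
move=> B0 Ap; have [r E] := closed_field_poly_normal B.
have rE b : root B b -> b \in r.
  by rewrite E rootZ ?lead_coef_eq0 // root_prod_XsubC.
have [c [_ _ cr]] := exists_small_notin r (@ltr01 R).
exists c => d d0; have [eta [eta0 etad etas]] :=
  exists_small_notin [seq - A.[b] / (b - c) ^+ p | b <- r] d0.
exists eta; split => //; last first.
  by rewrite addrC size_polyDl size_scale // size_exp_XsubC // ltnS.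
apply: coprimep_roots => b /rE br; apply/eqP; rewrite !hornerE => Ab.
move/negP: etas; apply; apply/mapP; exists b => //.
have bc : b - c != 0 by rewrite subr_eq0; apply: contraNneq cr => <-.
apply: (canRL (mulfK _)); first by rewrite expf_neq0.
by apply/eqP; rewrite -addr_eq0 addrC Ab.
Qed.

Lemma rational_density K P Q (f : Ainf Omega) m (e : R) : compact K ->
  K `<=` ~` closure Omega -> Q != 0 -> rational_on f -> 0 < e ->
  exists (g : Ainf Omega) p q, [/\ rational_on g, Ainf_near m e f g, F (p, q) &
    forall zeta, closure Omega zeta ->
    [/\ pade_D g p q zeta, pade_E g p q zeta setT,
      forall z, K z -> chordal (pade_val g p q zeta z) (rat_val P Q z) <= e &
      forall z l, closure Omega z -> pade_deriv g p q zeta l z = Some (dext Omega g l z)]].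
Proof.
move=> cK KO Q0 [G1 [G2 [G20 [G2O fE]]]] e0.
set P1 := rat_num P Q; set P2 := rat_den P Q.
have P20 : P2 != 0 by exact: rat_den_neq0.
have P12 := @rat_num_den_coprime _ P Q Q0.
have cP12 : coprimep P1 P2 by rewrite coprimep_div_gcd // Q0 orbT.
(* [QK] collects the poles of the target in [K], which the gluing cannot handle. *)
have [QK [Qo [P2E QK0 QKr QoK]]] := exists_root_split K P20.
have Qo0 : Qo != 0 by apply: contraNneq P20; rewrite P2E => ->; rewrite mulr0.
have [mu mu0 Kmu] := compact_separated cK (@closed_closure _ Omega) KO.
have KmuO k c : K k -> Omega c -> mu <= modulus (k - c).
  by move=> Kk Oc; apply: Kmu => //; exact: subset_closure.
have [d d0 Hd] := exists_far_roots G20 G2O.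
(* Bounded by [mu / 4] for the gluing, by [d / 2] to keep the roots of [G2] off the thickening, and
   by 1 so that discs around points of modulus at most [m] stay within radius [n = m.+1]. *)
pose rho := Num.min 1 (Num.min (mu / 4) (d / 2)).
have rho0 : 0 < rho by rewrite !lt_min ltr01 !divr_gt0.
have [rho1 rmu rd] : [/\ rho <= 1, rho <= mu / 4 & rho <= d / 2].
  by rewrite !ge_min !lexx /= !orbT.
clearbody rho; set T := thickening Omega rho.
have OT : closure Omega `<=` T by exact: sub_thickening (ltW rho0).
have KT k : K k -> ~ T k.
  move=> Kk Tk; have := @thickening_far _ Omega rho k mu k (fun c => KmuO k c Kk) Tk.
  by rewrite subrr modulus0; lra.
have G2T z : T z -> G2.[z] != 0.
  move=> Tz; apply/negP => Gz.
  have := @thickening_far _ Omega rho z d z (fun c => Hd z c Gz) Tz.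
  by rewrite subrr modulus0; lra.
have QKT z : T z -> QK.[z] != 0 by move=> Tz; apply/negP => /QKr /KT.
pose n := m.+1; pose TD := T `&` [set z : C | modulus z <= n%:R].
have cTD : compact TD.
  by rewrite /TD setIC; apply: compact_closedI; [exact: compact_disc|exact: closed_thickening].
have [MQ MQ0 HMQ] : exists2 M : R, 0 < M & forall z, TD z -> modulus (QK.[z])^-1 <= M.
  apply: (@rat_on_bounded _ T TD _ cTD) => [z []//|].
  by exists 1, QK; split=> // z _; rewrite hornerE mul1r.
have [MN MN0 HMN] := coprimep_pair_norm cK cP12.
have [Mo Mo0 HMo] := rat_on_bounded cK (fun z Kz => Kz) (rat_on_horner K Qo).
have [B B0 HB] := iterated_cauchy_estimates m rho0.
(* Gluing and perturbation each cost [e1]. [Mo * MN] converts the error on [K] into chordal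
   distance; [B * MQ] converts the error on the thickening into derivatives after division by
   [QK]. *)
pose e1 := Num.min (e / (2 * (Mo * MN))) (e / (2 * (B * MQ))).
have e10 : 0 < e1 by rewrite lt_min !divr_gt0 // ?mulr_gt0.
have [e1K e1T] : Mo * MN * (2 * e1) <= e /\ B * (MQ * (2 * e1)) <= e.
  have h (x : R) : 0 < x -> e1 <= e / (2 * x) -> x * (2 * e1) <= e.
    move=> x0; rewrite ler_pdivlMr ?mulr_gt0 // => H; apply: le_trans H.
    by have -> : x * (2 * e1) = e1 * (2 * x) by ring.
  by split; rewrite 1?[B * _]mulrA; apply: h; rewrite ?mulr_gt0 // ge_min lexx ?orbT.
clearbody e1.
(* On [K] the factor [1 / QK] is left out, near [Omega] the target is multiplied by [QK]; dividing
   the glued function by [QK] restores both. *)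
have [|a c ra Oc|] := @glue_rational R K Omega mu rho P1 Qo (G1 * QK) G2 n e1 cK rho0 _ KmuO Qo0 QoK G20 _ e10.
- lra.
- by have := Hd a c ra Oc; lra.
move=> w [/rat_on_nonzero[W1 [W2 [W20 W2V wE]]] wK wT].
have W2K z : K z -> W2.[z] != 0 by move=> Kz; apply: W2V; left.
have W2T z : T z -> W2.[z] != 0 by move=> Tz; apply: W2V; right.
pose Bq := W2 * QK; have Bq0 : Bq != 0 by rewrite mulf_neq0.
(* [size W1 <= p] lets the perturbation set the degree of the numerator to exactly [p]; [q] only has
   to bound that of the denominator. *)
have [p [q [Fpq pW qB]]] := exists_large_index (size W1) (size Bq).
have W2rat (X : set C) x : (forall z, X z -> W2.[z] != 0) ->
    rat_on X (fun z => (z - x) ^+ p / W2.[z]).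
  by move=> XW; exists (('X - x%:P) ^+ p), W2; split=> // z _; rewrite !hornerE.
have [c Hc] := exists_coprime_perturbation Bq0 pW.
have [M1 M10 HM1] := rat_on_bounded cK (fun z Kz => Kz) (W2rat K c W2K).
have [M2 M20 HM2] := rat_on_bounded cTD (fun z (Tz : TD z) => Tz.1) (W2rat T c W2T).
have M12 : 0 < M1 + M2 by rewrite addr_gt0.
have [eta [eta_le coAB sA]] := Hc _ (divr_gt0 e10 M12).
have etae z : K z \/ TD z -> modulus (eta * (z - c) ^+ p / W2.[z]) <= e1.
  move=> Hz; rewrite -mulrA modulusM.
  have -> : e1 = e1 / (M1 + M2) * (M1 + M2) by rewrite divfK // gt_eqF.
  apply: ler_pM; rewrite ?modulus_ge0 //.
  by case: Hz => [/HM1 H|/HM2 H]; apply: le_trans H _; rewrite ?lerDl ?lerDr ltW.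
set A := W1 + _ in coAB sA.
have AW z : A.[z] / W2.[z] = W1.[z] / W2.[z] + eta * (z - c) ^+ p / W2.[z].
  by rewrite /A !hornerE mulrDl.
have AK z : K z -> modulus (A.[z] / W2.[z] - P1.[z] / Qo.[z]) <= 2 * e1.
  move=> Kz; rewrite AW addrAC; apply: le_trans (modulusD _ _) _.
  have := etae z (or_introl Kz); have := wK z Kz; rewrite wE; last by left.
  lra.
have AT z : TD z -> modulus (A.[z] / W2.[z] - (G1 * QK).[z] / G2.[z]) <= 2 * e1.
  move=> Tz; rewrite AW addrAC; apply: le_trans (modulusD _ _) _.
  have := etae z (or_intror Tz); have := wT z Tz.1 Tz.2; rewrite wE; last by right; case: Tz.
  lra.
have BqT z : T z -> Bq.[z] != 0.
  by move=> Tz; rewrite hornerM mulf_neq0 ?W2T ?QKT.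
have BqO z : closure Omega z -> Bq.[z] != 0 by move=> /OT/BqT.
have [g gE] := exists_rat_Ainf openOmega A BqO.
exists g, p, q; split => //.
- by exists A, Bq.
- move=> l z lm clz zm.
  rewrite (dext_rat openOmega l gE clz (BqO z clz)) (dext_rat openOmega l fE clz (G2O z clz)).
  have disc z' : modulus (z' - z) <= rho -> TD z'.
    move=> zz; split; first exact: thickening_near clz zz.
    have := modulusD (z' - z) z; rewrite subrK /= /n -natr1; lra.
  apply: le_trans e1T; apply: (HB l (fun i w => rat_der A Bq i w - rat_der G1 G2 i w)) => //.
    move=> i z' /disc[Tz' _]; apply: cderivB; apply: cderiv_rat_der; [exact: BqT|exact: G2T].
  move=> z' /disc Tz'; have [T' _] := Tz'; rewrite /rat_der !expr1 /=.
  have -> : A.[z'] / Bq.[z'] - G1.[z'] / G2.[z'] =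
      (A.[z'] / W2.[z'] - (G1 * QK).[z'] / G2.[z']) * (QK.[z'])^-1.
    by rewrite !hornerM; field; rewrite W2T // QKT // G2T.
  by rewrite modulusM mulrC; apply: ler_pM; rewrite ?modulus_ge0 ?HMQ ?AT.
move=> zeta clzeta.
have [k k0 [AE BE]] := pade_rational openOmega gE coAB sA (leqW qB) clzeta (BqO _ clzeta).
have nz z : ~ (A.[z] = 0 /\ Bq.[z] = 0).
  move=> [/eqP Az /eqP Bz]; have /Pdiv.ClosedField.coprimepP/(_ z Az) := coAB.
  by rewrite Bz.
have nzk z : ~ ((k *: A).[z] = 0 /\ (k *: Bq).[z] = 0).
  rewrite !hornerZ => -[/eqP Az /eqP Bz]; apply: (nz z).
  by move: Az Bz; rewrite !mulf_eq0 (negbTE k0) /= => /eqP -> /eqP ->.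
split.
- by have := pade_D_rational openOmega gE coAB sA (leqW qB) clzeta (BqO _ clzeta); apply.
- by move=> z _; rewrite AE BE.
- move=> z Kz; rewrite /pade_val AE BE rat_valE // !hornerZ ratioM //.
  rewrite -[rat_val P Q z]/(ratio P1.[z] P2.[z]) chordal_ratio //.
  have N1 := pair_norm_gt0 (nz z); have N2 := pair_norm_gt0 (P12 z).
  have [_ BN] := modulus_le_pair_norm A.[z] Bq.[z].
  (* The factor [Bq.[z]] is bounded by the pair norm in the denominator, so the estimate holds even
     where [Bq] vanishes. *)
  have -> : A.[z] * P2.[z] - Bq.[z] * P1.[z] =
      Bq.[z] * (Qo.[z] * (A.[z] / W2.[z] - P1.[z] / Qo.[z])).
    by rewrite P2E !hornerM; field; rewrite W2K // QoK.
  rewrite modulusM [modulus (Qo.[z] * _)]modulusM.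
  apply: (@le_trans _ _ (modulus Qo.[z] * modulus (A.[z] / W2.[z] - P1.[z] / Qo.[z]) / pair_norm P1.[z] P2.[z])).
    rewrite ler_pdivrMr ?mulr_gt0 // mulrA -mulrA [_ * (pair_norm _ _ * _)]mulrCA.
    by rewrite divfK ?gt_eqF // ler_wpM2r // mulr_ge0 ?modulus_ge0.
  rewrite ler_pdivrMr //; apply: (@le_trans _ _ (Mo * (2 * e1))).
    by apply: ler_pM; rewrite ?modulus_ge0 ?HMo ?AK.
  apply: le_trans (ler_wpM2r (ltW N2) e1K).
  have -> : Mo * MN * (2 * e1) * pair_norm P1.[z] P2.[z] =
    Mo * (2 * e1) * (MN * pair_norm P1.[z] P2.[z]) by ring.
  by rewrite ler_peMr ?HMN // !mulr_ge0 // ltW.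
move=> z l clz; rewrite /pade_deriv AE BE rat_derivE; last first.
  by rewrite hornerZ mulf_neq0 ?BqO.
congr Some; rewrite (dext_rat openOmega l gE clz (BqO z clz)).
rewrite -!derive1n_rat ?hornerZ ?mulf_neq0 ?BqO //.
apply: (@derive1n_open _ [set w : C | Bq.[w] != 0]) => [||/=]; last exact: BqO.
  exact: open_horner_neq0.
by move=> v /= Bv; rewrite /rat_fun !hornerZ -mulf_div mulfV // mul1r.
Qed.

End Density.

(** * Openness and universality *)

Section PolynomialLimits.
Context {R : realType}.
Local Notation C := (Cplx R).
Context {T : Type} (F : set_system T) {FF : Filter F} (z : T -> C) (z0 : C).
Hypothesis zF : z x @[x --> F] --> z0.
Implicit Types (u v : T -> {poly C}) (a b : {poly C}).

(** With all derivatives included, the notion is stable under ring operations and derivation, hence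
    passes to determinants and to [rat_dnum] without any bound on degrees. *)
Definition poly_cvg u a := forall k : nat, ((u x)^`(k)).[z x] @[x --> F] --> (a^`(k)).[z0].

Lemma poly_cvgC (c : T -> C) (l : C) : c x @[x --> F] --> l -> poly_cvg (fun x => (c x)%:P) l%:P.
Proof.
move=> cl [|k].
  by under eq_fun do rewrite derivn0 hornerC; rewrite derivn0 hornerC.
have E (x : C) : (x%:P^`(k.+1)) = 0 by rewrite derivSn derivC raddf0.
by under eq_fun do rewrite E horner0; rewrite E horner0; exact: cvg_cst.
Qed.

Lemma poly_cvg_cst a : (exists l : C, a = l%:P) -> poly_cvg (fun=> a) a.
Proof. by move=> [l ->]; apply: poly_cvgC; exact: cvg_cst. Qed.

Lemma poly_cvg_eq u v a b : (forall x, u x = v x) -> a = b -> poly_cvg u a -> poly_cvg v b.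
Proof. by move=> /funext -> ->. Qed.

Lemma poly_cvgX : poly_cvg (fun=> 'X) 'X.
Proof.
move=> [|k]; first by under eq_fun do rewrite derivn0 hornerX; rewrite derivn0 hornerX.
rewrite derivSn derivX; suff : poly_cvg (fun=> 1) 1 by move=> /(_ k).
by apply: poly_cvg_cst; exists 1.
Qed.

Lemma poly_cvgD u v a b : poly_cvg u a -> poly_cvg v b -> poly_cvg (fun x => u x + v x) (a + b).
Proof.
move=> ua vb k; under eq_fun do rewrite derivnD hornerD.
by rewrite derivnD hornerD; exact: cvgD (ua k) (vb k).
Qed.

Lemma poly_cvgN u a : poly_cvg u a -> poly_cvg (fun x => - u x) (- a).
Proof.
move=> ua k; under eq_fun do rewrite derivnN hornerN.
by rewrite derivnN hornerN; exact: cvgN (ua k).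
Qed.

Lemma poly_cvg_deriv u a : poly_cvg u a -> poly_cvg (fun x => (u x)^`()) a^`().
Proof.
by move=> ua k; under eq_fun do rewrite -derivSn; rewrite -derivSn; exact: ua.
Qed.

Lemma poly_cvgM u v a b : poly_cvg u a -> poly_cvg v b -> poly_cvg (fun x => u x * v x) (a * b).
Proof.
move=> ua vb k; elim: k u v a b ua vb => [|k IH] u v a b ua vb.
  under eq_fun do rewrite derivn0 hornerM; rewrite derivn0 hornerM.
  exact: cvgM (ua 0%N) (vb 0%N).
under eq_fun do rewrite derivSn derivM derivnD hornerD.
rewrite derivSn derivM derivnD hornerD.
exact: (cvgD (IH _ _ _ _ (poly_cvg_deriv ua) vb) (IH _ _ _ _ ua (poly_cvg_deriv vb))).
Qed.

Lemma poly_cvgZ (c : T -> C) (l : C) u a : c x @[x --> F] --> l -> poly_cvg u a ->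
  poly_cvg (fun x => c x *: u x) (l *: a).
Proof.
move=> cl ua; under eq_fun do rewrite -mul_polyC; rewrite -mul_polyC.
exact: (poly_cvgM (poly_cvgC cl) ua).
Qed.

Lemma poly_cvg_sum (I : Type) (r : seq I) (u : I -> T -> {poly C}) (a : I -> {poly C}) :
  (forall i, poly_cvg (u i) (a i)) ->
  poly_cvg (fun x => \sum_(i <- r) u i x) (\sum_(i <- r) a i).
Proof.
move=> ua; elim: r => [|i r IH].
  under eq_fun do rewrite big_nil; rewrite big_nil; apply: poly_cvg_cst.
  by exists 0.
by under eq_fun do rewrite big_cons; rewrite big_cons; exact: (poly_cvgD (ua i) IH).
Qed.

Lemma poly_cvg_prod (I : Type) (r : seq I) (u : I -> T -> {poly C}) (a : I -> {poly C}) :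
  (forall i, poly_cvg (u i) (a i)) ->
  poly_cvg (fun x => \prod_(i <- r) u i x) (\prod_(i <- r) a i).
Proof.
move=> ua; elim: r => [|i r IH].
  under eq_fun do rewrite big_nil; rewrite big_nil; apply: poly_cvg_cst.
  by exists 1.
by under eq_fun do rewrite big_cons; rewrite big_cons; exact: (poly_cvgM (ua i) IH).
Qed.

Lemma poly_cvgXn u a n : poly_cvg u a -> poly_cvg (fun x => u x ^+ n) (a ^+ n).
Proof.
move=> ua; elim: n => [|n IH]; first by apply: poly_cvg_cst; exists 1.
by under eq_fun do rewrite exprS; rewrite exprS; exact: (poly_cvgM ua IH).
Qed.

Lemma poly_cvgMn u a n : poly_cvg u a -> poly_cvg (fun x => u x *+ n) (a *+ n).
Proof.
move=> ua; elim: n => [|n IH]; first by apply: poly_cvg_cst; exists 0.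
by under eq_fun do rewrite mulrS; rewrite mulrS; exact: (poly_cvgD ua IH).
Qed.

Lemma poly_cvg_det n (M : T -> 'M[{poly C}]_n) (M0 : 'M[{poly C}]_n) :
  (forall i j, poly_cvg (fun x => M x i j) (M0 i j)) ->
  poly_cvg (fun x => \det (M x)) (\det M0).
Proof.
move=> HM; apply: poly_cvg_sum => s.
have sC : exists l : C, (-1) ^+ perm.odd_perm s = l%:P :> {poly C}.
  by exists ((-1) ^+ perm.odd_perm s); rewrite rmorphXn rmorphN rmorph1.
have HP := poly_cvg_prod (r := index_enum 'I_n) (u := fun i x => M x i (perm.fun_of_perm s i))
  (fun i => HM i (perm.fun_of_perm s i)).
exact: (poly_cvgM (poly_cvg_cst sC) HP).
Qed.

Lemma cvg_det n (M : T -> 'M[C]_n) (M0 : 'M[C]_n) :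
  (forall i j, M x i j @[x --> F] --> M0 i j) -> \det (M x) @[x --> F] --> \det M0.
Proof.
move=> HM; have := @poly_cvg_det n (fun x => map_mx polyC (M x)) (map_mx polyC M0).
under eq_fun do rewrite det_map_mx; rewrite det_map_mx => H.
have {}H : poly_cvg (fun x => (\det (M x))%:P) (\det M0)%:P.
  apply: H => i j; under eq_fun do rewrite mxE; rewrite mxE.
  exact: poly_cvgC (HM i j).
have := H 0%N; under eq_fun do rewrite derivn0 hornerC.
by rewrite derivn0 hornerC.
Qed.

Lemma poly_cvg_rat_dnum u v a b l : poly_cvg u a -> poly_cvg v b ->
  poly_cvg (fun x => rat_dnum (u x) (v x) l) (rat_dnum a b l).
Proof.
move=> ua vb; elim: l => [|l IH]; first exact: ua.
have HN := poly_cvgN (poly_cvgMn (n := l.+1) (poly_cvgM IH (poly_cvg_deriv vb))).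
exact: (poly_cvgD (poly_cvgM (poly_cvg_deriv IH) vb) HN).
Qed.

Lemma poly_cvg_horner u a : poly_cvg u a -> (u x).[z x] @[x --> F] --> a.[z0].
Proof. by move=> /(_ 0%N); rewrite derivn0; under eq_fun do rewrite derivn0. Qed.

Lemma cvg_rat_der u v a b l : poly_cvg u a -> poly_cvg v b -> b.[z0] != 0 ->
  rat_der (u x) (v x) l (z x) @[x --> F] --> rat_der a b l z0.
Proof.
move=> ua vb b0; have H := poly_cvg_horner (poly_cvgXn (n := l.+1) vb).
have {}H : (v x).[z x] ^+ l.+1 @[x --> F] --> b.[z0] ^+ l.+1.
  by rewrite horner_exp in H; under eq_fun do rewrite -horner_exp.
have bl : b.[z0] ^+ l.+1 != 0 by rewrite expf_neq0.
exact: (cvgM (poly_cvg_horner (poly_cvg_rat_dnum (l := l) ua vb)) (cvgV bl H)).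
Qed.

Lemma cvg_neq0_near (c : T -> C) (l : C) : c x @[x --> F] --> l -> l != 0 ->
  \forall x \near F, c x != 0.
Proof.
move=> /cvg_modulusP H l0; have ml : 0 < modulus l by rewrite modulus_gt0.
apply: filterS (H _ ml) => x; apply: contraTneq => ->.
by rewrite sub0r modulusN ltxx.
Qed.

Lemma cvg_modulus (c : T -> C) (l : C) : c x @[x --> F] --> l ->
  modulus (c x) @[x --> F] --> modulus l.
Proof.
move=> /cvg_modulusP H; apply/cvgrPdist_lt => e /H; apply: filterS => x.
apply: le_lt_trans; rewrite ler_norml.
have := ler_modulusB (c x) l; have := ler_modulusB l (c x).
rewrite (modulus_distC l); lra.
Qed.

Lemma cvg_pair_norm (c d : T -> C) (l m : C) : c x @[x --> F] --> l -> d x @[x --> F] --> m ->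
  pair_norm (c x) (d x) @[x --> F] --> pair_norm l m.
Proof.
move=> /cvg_modulus cl /cvg_modulus dm.
have H : modulus (c x) ^+ 2 + modulus (d x) ^+ 2 @[x --> F] --> modulus l ^+ 2 + modulus m ^+ 2.
  by under eq_fun do rewrite !expr2; rewrite !expr2; exact: (cvgD (cvgM cl cl) (cvgM dm dm)).
exact: (cvg_comp _ _ H (@sqrt_continuous R _)).
Qed.

End PolynomialLimits.

Lemma cdist_rat_deriv (R : realType) (A B : {poly Cplx R}) l (z w : Cplx R) (e : R) : B.[z] != 0 ->
  (cdist (rat_deriv A B l z) w < e%:E)%E = (modulus (rat_der A B l z - w) < e).
Proof. by move=> Bz; rewrite (rat_derivE A l Bz); exact: lte_fin. Qed.

(** * Continuity of Pade approximants in the function, the centre and the point *)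

Section JointLimits.
Context {R : realType}.
Local Notation C := (Cplx R).
Variables (Omega : set C) (openOmega : open Omega).
Implicit Types (f g : Ainf Omega) (V K L : set C) (z zeta : C) (r e : R) (P Q : {poly C}).

(** [Ainf_near] with a single small parameter, as [compact_modulusP] requires. *)
Definition Ainf_close r f g := forall l z, l%:R <= r^-1 -> closure Omega z ->
  modulus z <= r^-1 -> modulus (dext Omega g l z - dext Omega f l z) <= r.

Lemma Ainf_close_le r r' f g : 0 < r -> r <= r' -> Ainf_close r f g -> Ainf_close r' f g.
Proof.
move=> r0 rr fg l z lr cz zr; have r'0 := lt_le_trans r0 rr.
have V : r'^-1 <= r^-1 by rewrite lef_pV2.
by apply: le_trans rr; apply: fg => //; [exact: le_trans lr V|exact: le_trans zr V].
Qed.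

Lemma nbhs_Ainf_close f (U : set (Ainf Omega)) r : 0 < r ->
  (forall g, Ainf_close r f g -> U g) -> nbhs f U.
Proof.
move=> r0 H; apply/(nbhs_AinfP openOmega); exists (Num.bound r^-1), r => // g fg.
have B : r^-1 < (Num.bound r^-1)%:R by apply: archi_boundP; rewrite invr_ge0 ltW.
apply: H => l z lr cz zr; apply: fg => //; last exact: le_trans zr (ltW B).
by rewrite -(ler_nat R); exact: le_trans lr (ltW B).
Qed.

(* The filter of joint convergence of a function to [f], of a centre of expansion to
   [zeta0] in [closure Omega] and of an evaluation point to [z0] in [V]. *)
Definition joint f V zeta0 z0 : set_system (Ainf Omega * (C * C)) :=
  [set A | exists2 r : R, 0 < r & forall g zeta z, Ainf_close r f g ->
     closure Omega zeta -> modulus (zeta - zeta0) < r ->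
     V z -> modulus (z - z0) < r -> A (g, (zeta, z))].

Global Instance joint_filter f V zeta0 z0 : Filter (joint f V zeta0 z0).
Proof.
apply: Build_Filter.
- by exists 1.
- move=> A B [r r0 HA] [r' r'0 HB]; exists (Num.min r r'); first by rewrite lt_min r0.
  have m0 : 0 < Num.min r r' by rewrite lt_min r0.
  move=> g zeta z fg cz; rewrite !lt_min => /andP[z1 z2] Vz /andP[w1 w2]; split.
    by apply: HA => //; apply: Ainf_close_le fg; rewrite // ge_min lexx.
  by apply: HB => //; apply: Ainf_close_le fg; rewrite // ge_min lexx orbT.
- by move=> A B AB [r r0 H]; exists r => // *; apply: AB; exact: H.
Qed.

Section At.
Variables (f : Ainf Omega) (V : set C) (zeta0 z0 : C).
Hypothesis clzeta0 : closure Omega zeta0.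
Local Notation T := (Ainf Omega * (C * C))%type.
Local Notation J := (joint f V zeta0 z0).

Lemma joint_zeta : (fun x : T => x.2.1) @ J --> zeta0.
Proof. by apply/cvg_modulusP => e e0; exists e. Qed.

Lemma joint_z : (fun x : T => x.2.2) @ J --> z0.
Proof. by apply/cvg_modulusP => e e0; exists e. Qed.

Lemma joint_dext (w : T -> C) w0 n : closure Omega w0 ->
  (\forall x \near J, closure Omega (w x)) -> w @ J --> w0 ->
  (fun x : T => dext Omega x.1 n (w x)) @ J --> dext Omega f n w0.
Proof.
move=> clw0 clw /cvg_modulusP ww; apply/cvg_modulusP => e e0.
have /within_continuous_modulusP/(_ _ clw0)H := @Ainf_dext_continuous _ _ f n.
have e2 : 0 < e / 2 by rewrite divr_gt0.
have [r r0 Hr] := H _ e2.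
(* Small enough for [Ainf_close t] to control order [n] at all points within 1 of [w0]. *)
pose t := Num.min (e / 2) (n%:R + modulus w0 + 1)^-1.
have M0 : 0 < n%:R + modulus w0 + 1 by rewrite ltr_wpDl // addr_ge0 // modulus_ge0.
have t0 : 0 < t by rewrite lt_min e2 invr_gt0.
have tV : n%:R + modulus w0 + 1 <= t^-1.
  by rewrite -[leLHS]invrK lef_pV2 ?posrE ?invr_gt0 // ge_min lexx orbT.
have te : t <= e / 2 by rewrite ge_min lexx.
have close : \forall x \near J, Ainf_close t f x.1 by exists t.
have mw0 := modulus_ge0 w0; have n0 : 0 <= n%:R :> R by [].
apply: filterS (filterI close (filterI clw (filterI (ww _ ltr01) (ww _ r0)))).
move=> x [cx [clx [wx1 wxr]]].
have H1 : modulus (dext Omega x.1 n (w x) - dext Omega f n (w x)) <= t.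
  apply: cx => //; first by apply: le_trans tV; lra.
  by apply: le_trans tV; have := modulusD (w x - w0) w0; rewrite subrK; lra.
apply: le_lt_trans (modulus_dist_trans (dext Omega f n (w x)) _ _) _.
apply: lt_le_trans (ler_ltD H1 (Hr _ clx wxr)) _.
by rewrite [leRHS]splitr lerD2r.
Qed.

Lemma joint_cst (l : C) : (fun=> l : C) @ J --> l.
Proof. by apply/cvg_modulusP => e e0; apply: filterE => x; rewrite subrr modulus0. Qed.

Lemma joint_taylor_coef n : (fun x : T => taylor_coef x.1 x.2.1 n) @ J --> taylor_coef f zeta0 n.
Proof.
case: n => n; last exact: joint_cst.
have cl : \forall x \near J, closure Omega x.2.1 by exists 1.
exact: (cvgM (joint_dext (n := n) clzeta0 cl joint_zeta) (joint_cst (l := (n`!%:R)^-1))).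
Qed.

Lemma joint_XsubC : poly_cvg J (fun x : T => x.2.2) z0 (fun x => 'X - x.2.1%:P) ('X - zeta0%:P).
Proof.
exact: (poly_cvgD (poly_cvgX joint_z) (poly_cvgN (poly_cvgC _ joint_zeta))).
Qed.

Lemma joint_taylor_poly k : poly_cvg J (fun x : T => x.2.2) z0
  (fun x => taylor_poly x.1 x.2.1 k) (taylor_poly f zeta0 k).
Proof.
case: k => k /=; last by apply: poly_cvg_cst; exists 0.
pose u (i : 'I_k.+1) (x : T) :=
  taylor_coef x.1 x.2.1 i%:Z *: ('X - x.2.1%:P) ^+ i.
apply: (poly_cvg_sum (u := u)) => i; rewrite /u.
exact: (poly_cvgZ (joint_taylor_coef (n := i%:Z)) (poly_cvgXn (n := i) joint_XsubC)).
Qed.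

Lemma joint_jacobi p q (u : T -> 'I_q.+1 -> {poly C}) u0 :
  (forall j, poly_cvg J (fun x : T => x.2.2) z0 (fun x => u x j) (u0 j)) ->
  poly_cvg J (fun x : T => x.2.2) z0
    (fun x => \det (jacobi_mx x.1 p x.2.1 (u x))) (\det (jacobi_mx f p zeta0 u0)).
Proof.
move=> uu; apply: (poly_cvg_det (M := fun x : T => jacobi_mx x.1 p x.2.1 (u x))
  (M0 := jacobi_mx f p zeta0 u0)) => i j.
pose w (f' : Ainf Omega) zeta' (u' : 'I_q.+1 -> {poly C}) : {poly C} :=
  if i == 0%N :> nat then u' j else (taylor_coef f' zeta' (p%:Z - q%:Z + i%:Z + j%:Z))%:P.
have E f' zeta' u' : jacobi_mx f' p zeta' u' i j = w f' zeta' u' by rewrite mxE.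
suff H : poly_cvg J (fun x : T => x.2.2) z0 (fun x : T => w x.1 x.2.1 (u x)) (w f zeta0 u0).
  exact: poly_cvg_eq (fun x : T => esym (E x.1 x.2.1 (u x))) (esym (E f zeta0 u0)) H.
rewrite /w; case: eqP => _; first exact: uu.
have H := joint_taylor_coef (n := p%:Z - q%:Z + i%:Z + j%:Z).
exact: (poly_cvgC _ H).
Qed.

Lemma joint_pade_A p q : poly_cvg J (fun x : T => x.2.2) z0
  (fun x => pade_A x.1 p q x.2.1) (pade_A f p q zeta0).
Proof.
apply: joint_jacobi => j.
exact: (poly_cvgM (poly_cvgXn (n := q - j) joint_XsubC)
  (joint_taylor_poly (k := p%:Z - q%:Z + j%:Z))).
Qed.

Lemma joint_pade_B p q : poly_cvg J (fun x : T => x.2.2) z0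
  (fun x => pade_B x.1 p q x.2.1) (pade_B f p q zeta0).
Proof.
by apply: joint_jacobi => j; exact: (poly_cvgXn (n := q - j) joint_XsubC).
Qed.

Definition pade_regular p q (x : T) := pade_D x.1 p q x.2.1 /\
  ~ ((pade_A x.1 p q x.2.1).[x.2.2] = 0 /\ (pade_B x.1 p q x.2.1).[x.2.2] = 0).

Lemma near_pade_regular p q : pade_regular p q (f, (zeta0, z0)) ->
  \forall x \near J, pade_regular p q x.
Proof.
move=> [/= D E]; apply: filterI.
  case: D => [q0|D]; first by apply: filterE => x; left.
  have H : (fun x : T => \det (hankel x.1 p q x.2.1)) @ J --> \det (hankel f p q zeta0).
    apply: (@cvg_det R T J _ (fun=> 0) 0 q (fun x : T => hankel x.1 p q x.2.1)) => i j.
    by under eq_fun do rewrite mxE; rewrite mxE; exact: joint_taylor_coef.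
  by apply: filterS (cvg_neq0_near H D) => x Dx; right.
have [A0|A0] := eqVneq (pade_A f p q zeta0).[z0] 0; last first.
  apply: filterS (cvg_neq0_near (poly_cvg_horner (joint_pade_A (p := p) (q := q))) A0) => x /eqP Ax [].
  by [].
have B0 : (pade_B f p q zeta0).[z0] != 0 by apply/eqP => B0; apply: E.
by apply: filterS (cvg_neq0_near (poly_cvg_horner (joint_pade_B (p := p) (q := q))) B0) => x /eqP Bx [].
Qed.

Lemma near_chordal p q P Q e : Q != 0 -> pade_regular p q (f, (zeta0, z0)) ->
  chordal (pade_val f p q zeta0 z0) (rat_val P Q z0) < e ->
  \forall x \near J, chordal (pade_val x.1 p q x.2.1 x.2.2) (rat_val P Q x.2.2) < e.
Proof.
move=> Q0 reg; have PQ := @rat_num_den_coprime _ P Q Q0.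
(* The homogeneous expression of the chordal distance, built from convergent quantities with a
   nonzero denominator; it is the distance wherever there is no common zero. *)
pose D (x : T) : R :=
  modulus ((pade_A x.1 p q x.2.1).[x.2.2] * (rat_den P Q).[x.2.2] -
    (pade_B x.1 p q x.2.1).[x.2.2] * (rat_num P Q).[x.2.2]) /
  (pair_norm (pade_A x.1 p q x.2.1).[x.2.2] (pade_B x.1 p q x.2.1).[x.2.2] *
   pair_norm (rat_num P Q).[x.2.2] (rat_den P Q).[x.2.2]).
have DE x : pade_regular p q x ->
    chordal (pade_val x.1 p q x.2.1 x.2.2) (rat_val P Q x.2.2) = D x.
  move=> [_ E]; rewrite /pade_val rat_valE //.
  by rewrite -[rat_val P Q _]/(ratio (rat_num P Q).[x.2.2] (rat_den P Q).[x.2.2]) chordal_ratio.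
rewrite (DE (f, (zeta0, z0)) reg) => De.
suff cD : D x @[x --> J] --> D (f, (zeta0, z0)).
  apply: filterS (filterI (near_pade_regular reg) (cvgr_lt _ cD e De)) => x [rx].
  by rewrite DE.
have cA := poly_cvg_horner (joint_pade_A (p := p) (q := q)); have cB := poly_cvg_horner (joint_pade_B (p := p) (q := q)).
have ch S : (fun x : T => S.[x.2.2]) @ J --> S.[z0].
  apply: (cvg_comp _ _ joint_z).
  exact: (cderiv_continuous (cderiv_horner S z0)).
have N : pair_norm (pade_A f p q zeta0).[z0] (pade_B f p q zeta0).[z0] *
   pair_norm (rat_num P Q).[z0] (rat_den P Q).[z0] != 0.
  by rewrite gt_eqF // mulr_gt0 // pair_norm_gt0 //; case: reg.
exact: (cvgM (cvg_modulus (cvgB (cvgM cA (ch _)) (cvgM cB (ch _))))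
  (cvgV N (cvgM (cvg_pair_norm cA cB) (cvg_pair_norm (ch _) (ch _))))).
Qed.

End At.

Lemma near_cdist f zeta0 z0 p q l e : closure Omega zeta0 -> closure Omega z0 ->
  pade_regular p q (f, (zeta0, z0)) ->
  (cdist (pade_deriv f p q zeta0 l z0) (dext Omega f l z0) < e%:E)%E ->
  \forall x \near joint f (closure Omega) zeta0 z0,
    (cdist (pade_deriv x.1 p q x.2.1 l x.2.2) (dext Omega x.1 l x.2.2) < e%:E)%E.
Proof.
move=> clzeta0 clz0 [_ /= AB] H.
have cA := @joint_pade_A f (closure Omega) zeta0 z0 clzeta0 p q.
have cB := @joint_pade_B f (closure Omega) zeta0 z0 clzeta0 p q.
have cz := @joint_z f (closure Omega) zeta0 z0.
(* At a pole [cdist] is infinite, which the strict bound [H] excludes. *)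
have B0 : (pade_B f p q zeta0).[z0] != 0.
  have [g g0 [_ ->]] := gcd_horner AB; rewrite mulf_neq0 //.
  by apply/eqP => d0; move: H; rewrite /pade_deriv /rat_deriv d0 eqxx.
rewrite /pade_deriv (cdist_rat_deriv _ _ _ _ B0) in H.
have cl : \forall x \near joint f (closure Omega) zeta0 z0, closure Omega x.2.2 by exists 1.
have cD := joint_dext (n := l) clz0 cl cz.
have cR : (fun x : Ainf Omega * (C * C) => modulus
    (rat_der (pade_A x.1 p q x.2.1) (pade_B x.1 p q x.2.1) l x.2.2 - dext Omega x.1 l x.2.2))
    @ joint f (closure Omega) zeta0 z0 -->
    modulus (rat_der (pade_A f p q zeta0) (pade_B f p q zeta0) l z0 - dext Omega f l z0).
  exact: (cvg_modulus (cvgB (cvg_rat_der (l := l) cA cB B0) cD)).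
apply: filterS (filterI (cvg_neq0_near (poly_cvg_horner cB) B0) (cvgr_lt _ cR e H)).
by move=> x [Bx xe]; rewrite /pade_deriv (cdist_rat_deriv _ _ _ _ Bx).
Qed.

(** The tube lemma applied twice: over the evaluation points in [K] for centres near a fixed one,
    then over the centres in [L]. *)
Lemma nbhs_joint_compact f K L V (good : Ainf Omega * (C * C) -> Prop) :
  compact K -> compact L -> L `<=` closure Omega -> K `<=` V ->
  (forall zeta z, L zeta -> K z -> \forall x \near joint f V zeta z, good x) ->
  nbhs f [set g | forall zeta z, L zeta -> K z -> good (g, (zeta, z))].
Proof.
move=> cK cL LO KV H.
have [|d d0 Hd] := @compact_modulusP _ L (fun d zeta => L zeta ->
    forall z g, K z -> Ainf_close d f g -> good (g, (zeta, z))) cL; last first.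
  by apply: (nbhs_Ainf_close d0) => g fg zeta z Lz Kz; exact: Hd.
move=> zeta0 Lzeta0.
have [|d d0 Hd] := @compact_modulusP _ K (fun d z => K z -> forall zeta g, L zeta ->
    modulus (zeta - zeta0) < d -> Ainf_close d f g -> good (g, (zeta, z))) cK; last first.
  exists d => // zeta d' zd /andP[d'0 dd] Lz z g Kz fg; apply: (Hd z) => //.
  exact: Ainf_close_le (ltW dd) fg.
move=> z0 Kz0; have [r r0 Hr] := H zeta0 z0 Lzeta0 Kz0.
exists r => // z d zr /andP[d0 dr] Kz zeta g Lz zd fg.
apply: Hr => //; [exact: Ainf_close_le (ltW dr) fg|exact: LO|exact: lt_trans zd dr|exact: KV].
Qed.

End JointLimits.

Section Suprema.
Context {R : realType}.
Local Notation C := (Cplx R).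

Lemma nnsup_ge0 (T : Type) (A : set T) (g : T -> \bar R) : (0 <= nnsup A g)%E.
Proof. by rewrite /nnsup le_max lexx. Qed.

Lemma nnsup_ubound (T : Type) (A : set T) (g : T -> \bar R) x : A x -> (g x <= nnsup A g)%E.
Proof.
move=> Ax; rewrite /nnsup le_max; apply/orP; right.
by apply: ereal_sup_ubound; exists x.
Qed.

Lemma nnsup_le (T : Type) (A : set T) (g : T -> \bar R) (b : R) : 0 <= b ->
  (forall x, A x -> (g x <= b%:E)%E) -> (nnsup A g <= b%:E)%E.
Proof.
move=> b0 H; rewrite /nnsup ge_max lee_fin b0 /=.
by apply: ge_ereal_sup => _ [x Ax <-]; exact: H.
Qed.

Lemma cvge0P (u : nat -> \bar R) : (forall n, (0 <= u n)%E) ->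
  u n @[n --> \oo] --> 0%E <->
  forall e : R, 0 < e -> exists N, forall n, (N <= n)%N -> (u n < e%:E)%E.
Proof.
move=> u0; split=> [H e e0|H].
  have [|N _ HN] := H [set x | (x < e%:E)%E]; last by exists N => n /HN.
  by apply: open_nbhs_nbhs; split; [exact: open_ereal_lt_ereal|rewrite /= lte_fin].
move=> A [e /= e0 He]; have [N HN] := H e e0; exists N => // n /HN /= une.
have := u0 n; move: une; case: (u n) => [x||//]; last by rewrite ltNge leey.
rewrite lte_fin lee_fin => xe x0; apply: He.
by rewrite /= sub0r normrN ger0_norm.
Qed.

End Suprema.

(** * Polynomials with coefficients in Q(i) *)

Section RationalPolynomials.
Context {R : realType}.
Local Notation C := (Cplx R).
Implicit Types (P Q : {poly C}).

Definition gauss (a : rat * rat) : C := rc (ratr a.1) + imag_unit * rc (ratr a.2).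

Definition gauss_poly (s : seq (rat * rat)) : {poly C} := Poly [seq gauss a | a <- s].

Lemma gauss_dense (z : C) (d : R) : 0 < d -> exists a, modulus (gauss a - z) <= d.
Proof.
move=> d0; have approx (x : R) : exists q : rat, `|ratr q - x| <= d / 2.
  have [|q] := @rat_in_itvoo R (x - d / 2) (x + d / 2); first by lra.
  by rewrite in_itv /= => H; exists q; rewrite ler_distl; lra.
have [[q Hq] [q' Hq']] := (approx (Re z), approx (Im z)); exists (q, q').
rewrite /gauss {1}(complex_ReIm z) opprD addrACA -mulrBr -!rcB.
apply: le_trans (modulusD _ _) _.
by rewrite modulusM modulus_imag_unit mul1r !modulus_rc /=; lra.
Qed.

Lemma gauss_poly_dense P (M d : R) : 0 <= M -> 0 < d -> exists s, forall z, modulus z <= M ->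
  modulus ((gauss_poly s).[z] - P.[z]) <= d.
Proof.
move=> M0; elim/poly_ind: P d => [|P c IH] d d0.
  by exists [::] => z _; rewrite /gauss_poly /= !horner0 subrr modulus0 ltW.
have d2 : 0 < d / 2 by rewrite divr_gt0.
have M1 : 0 < M + 1 by lra.
have [s Hs] := IH _ (divr_gt0 d2 M1); have [a Ha] := gauss_dense c d2.
exists (a :: s) => z zM.
rewrite /gauss_poly /= cons_poly_def -/(gauss_poly s) !hornerD !hornerM !hornerX !hornerC.
have -> : (gauss_poly s).[z] * z + gauss a - (P.[z] * z + c) =
    ((gauss_poly s).[z] - P.[z]) * z + (gauss a - c) by ring.
apply: le_trans (modulusD _ _) _; rewrite [leRHS]splitr; apply: lerD => //.
have -> : d / 2 = d / 2 / (M + 1) * (M + 1) by rewrite divfK // gt_eqF.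
by rewrite modulusM; apply: ler_pM; rewrite ?modulus_ge0 ?Hs //; lra.
Qed.

Lemma gauss_poly_dense_neq0 P (M d : R) : P != 0 -> 0 <= M -> 0 < d -> exists s,
  gauss_poly s != 0 /\ forall z, modulus z <= M -> modulus ((gauss_poly s).[z] - P.[z]) <= d.
Proof.
move=> P0 M0 d0; have [r E] := closed_field_poly_normal P.
(* A point where [P] does not vanish; an approximation within half of |P(x)| there cannot be the
   zero polynomial. *)
have [x [_ _ xr]] := exists_small_notin r d0.
have Px : 0 < modulus P.[x].
  rewrite modulus_gt0; apply: contra xr => Px.
  by rewrite -root_prod_XsubC -(rootZ _ _ (_ : lead_coef P != 0)) ?lead_coef_eq0 // -E.
pose t := Num.min d (modulus P.[x] / 2).
have t0 : 0 < t by rewrite lt_min d0 divr_gt0.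
have [td tP] : t <= d /\ t <= modulus P.[x] / 2 by rewrite !ge_min !lexx orbT.
have Mx : 0 <= M + modulus x by rewrite addr_ge0 // modulus_ge0.
have [s Hs] := gauss_poly_dense P Mx t0; exists s; split.
  apply/eqP => s0; have := Hs x _; rewrite s0 horner0 sub0r modulusN lerDr => /(_ M0); lra.
move=> z zM; apply: le_trans td; apply: Hs; have := modulus_ge0 x; lra.
Qed.

Lemma pair_norm_le (a b : C) : pair_norm a b <= modulus a + modulus b.
Proof.
have [a0 b0] := (modulus_ge0 a, modulus_ge0 b).
rewrite -[leRHS]ger0_norm ?addr_ge0 // -sqrtr_sqr ler_wsqrtr // sqrrD.
by rewrite addrAC lerDl mulrn_wge0 // mulr_ge0.
Qed.

(* Plays the part of the triangle inequality for the chordal metric. *)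
Lemma chordal_perturbation (a b c d c' d' : C) (delta M : R) :
  ~ (a = 0 /\ b = 0) -> ~ (c = 0 /\ d = 0) -> ~ (c' = 0 /\ d' = 0) ->
  modulus (c - c') <= delta -> modulus (d - d') <= delta -> 1 <= M * pair_norm c d ->
  chordal (ratio a b) (ratio c d) <=
  chordal (ratio a b) (ratio c' d') * (2 + 2 * delta * M) + 2 * delta * M.
Proof.
move=> ab cd cd' cc dd Mcd; rewrite !chordal_ratio //.
have v0 := pair_norm_gt0 ab; have n0 := pair_norm_gt0 cd; have n'0 := pair_norm_gt0 cd'.
have [av bv] := modulus_le_pair_norm a b; have [cn dn] := modulus_le_pair_norm c d.
have nn' : pair_norm c' d' <= 2 * pair_norm c d + 2 * delta.
  apply: le_trans (pair_norm_le _ _) _.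
  have := ler_modulusB c' c; have := ler_modulusB d' d.
  rewrite (modulus_distC c') (modulus_distC d'); lra.
have X : modulus (a * d - b * c) <= modulus (a * d' - b * c') + 2 * delta * pair_norm a b.
  have -> : a * d - b * c = (a * d' - b * c') + (a * (d - d') - b * (c - c')) by ring.
  apply: le_trans (modulusD _ _) _; rewrite lerD2l; apply: le_trans (modulusB _ _) _.
  rewrite !modulusM.
  have -> : 2 * delta * pair_norm a b = pair_norm a b * delta + pair_norm a b * delta by ring.
  by apply: lerD; apply: ler_pM; rewrite ?modulus_ge0.
have d0 : 0 <= delta by exact: le_trans (modulus_ge0 _) cc.
move: X nn' Mcd v0 n0 n'0.
move: (pair_norm a b) (pair_norm c d) (pair_norm c' d') (modulus (a * d - b * c))
  (modulus (a * d' - b * c')) (modulus_ge0 (a * d' - b * c')) => v n n' X X' X'0 HX nn' Mn v0 n0 n'0.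
have chi0 : 0 <= X' / (v * n') by rewrite divr_ge0 // mulr_ge0 // ltW.
have MN : delta <= delta * (M * n) by rewrite ler_peMr.
have X'E : X' = X' / (v * n') * (v * n') by rewrite divfK // mulf_neq0 // gt_eqF.
rewrite ler_pdivrMr ?mulr_gt0 //.
apply: le_trans HX _.
have -> : (X' / (v * n') * (2 + 2 * delta * M) + 2 * delta * M) * (v * n) =
    X' / (v * n') * (v * (2 * n + 2 * (delta * (M * n)))) + 2 * (delta * (M * n)) * v by ring.
apply: lerD; last by rewrite ler_wpM2r ?(ltW v0) // ler_wpM2l.
rewrite {1}X'E; apply: ler_wpM2l => //; rewrite ler_wpM2l ?(ltW v0) //.
by apply: le_trans nn' _; rewrite lerD2l ler_wpM2l.
Qed.

End RationalPolynomials.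

(** * Countably many open conditions and the conclusion *)

Section UniversalFunctions.
Context {R : realType}.
Local Notation C := (Cplx R).
Variables (F : set (nat * nat)) (Omega : set C).
Hypothesis hF : exists pt qt : nat -> nat,
  [/\ forall n, F (pt n, qt n), pt n @[n --> \oo] --> \oo & qt n @[n --> \oo] --> \oo].
Hypothesis openOmega : open Omega.
Local Notation T := (Ainf Omega * (C * C))%type.
Implicit Types (f g : Ainf Omega) (K L : set C) (P Q : {poly C}).

Definition inside s := [set z : C | modulus z <= s%:R] `&` closure Omega.

Definition outside m := [set z : C | modulus z <= m%:R] `&`
  [set z | forall w, closure Omega w -> m.+1%:R^-1 <= modulus (z - w)].

Lemma compact_inside s : compact (inside s).
Proof. by apply: compact_closedI; [exact: compact_disc|exact: closed_closure]. Qed.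

Lemma compact_outside m : compact (outside m).
Proof.
apply: compact_closedI; first exact: compact_disc.
apply: closed_modulusP => z H w clw; apply/ler_addgt0Pr => e e0.
have [y Hy yz] := H e e0; apply: le_trans (Hy w clw) _.
by apply: le_trans (modulus_dist_trans z y w) _; rewrite addrC lerD2l ltW.
Qed.

Lemma outside_sub m : outside m `<=` ~` closure Omega.
Proof.
by move=> z [_ Hz] /Hz; rewrite subrr modulus0 leNgt invr_gt0 ltr0n.
Qed.

Lemma exists_inside L : compact L -> L `<=` closure Omega ->
  exists N, forall n, (N <= n)%N -> L `<=` inside n.
Proof.
move=> /compact_bounded_modulus[M M0 HM] LO; exists (Num.bound M) => n Nn z Lz.
split; last exact: LO.
apply: le_trans (HM z Lz) _; apply: le_trans (ltW (archi_boundP (ltW M0))) _.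
by rewrite ler_nat.
Qed.

Lemma exists_outside K : compact K -> K `<=` ~` closure Omega -> exists m, K `<=` outside m.
Proof.
move=> cK KO; have [M M0 HM] := compact_bounded_modulus cK.
have [d d0 Hd] := compact_separated cK (@closed_closure _ Omega) KO.
have V0 : 0 <= M + d^-1 by rewrite addr_ge0 ?invr_ge0 ?ltW.
have B := archi_boundP V0; have d'0 : 0 < d^-1 by rewrite invr_gt0.
exists (Num.bound (M + d^-1)) => z Kz; split => [|w clw] /=.
  by have := HM z Kz; lra.
apply: le_trans (Hd z w Kz clw); rewrite -[leRHS]invrK lef_pV2 ?posrE //.
  by rewrite -natr1; lra.
Qed.

Definition chordal_near p q P Q (e : R) (x : T) := pade_regular p q x /\
  chordal (pade_val x.1 p q x.2.1 x.2.2) (rat_val P Q x.2.2) < e.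

Definition deriv_near p q s (e : R) (x : T) := pade_regular p q x /\
  forall l, (l <= s)%N ->
  (cdist (pade_deriv x.1 p q x.2.1 l x.2.2) (dext Omega x.1 l x.2.2) < e%:E)%E.

(** The single index [s] sets the compact part of the closure, the orders of derivatives and the
    tolerance. Strict inequalities and regularity make the condition open in [f]. *)
Definition approximant K P Q s f p q :=
  (forall zeta z, inside s zeta -> K z -> chordal_near p q P Q s.+1%:R^-1 (f, (zeta, z))) /\
  (forall zeta z, inside s zeta -> inside s z -> deriv_near p q s s.+1%:R^-1 (f, (zeta, z))).

Lemma nbhs_approximant K P Q s f p q : compact K -> Q != 0 -> approximant K P Q s f p q ->
  nbhs f [set g | approximant K P Q s g p q].
Proof.
move=> cK Q0 [H1 H2].
have LO : inside s `<=` closure Omega by move=> z [].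
have cL := @compact_inside s.
have N1 zeta z : inside s zeta -> K z ->
    \forall x \near joint f setT zeta z, chordal_near p q P Q s.+1%:R^-1 x.
  move=> Lzeta Kz; have [reg Hc] := H1 zeta z Lzeta Kz.
  exact: (filterI (near_pade_regular _ (LO _ Lzeta) reg) (near_chordal _ (LO _ Lzeta) Q0 reg Hc)).
suff N2 zeta z : inside s zeta -> inside s z ->
    \forall x \near joint f (closure Omega) zeta z, deriv_near p q s s.+1%:R^-1 x.
  exact: filterI (nbhs_joint_compact openOmega cK cL LO (fun z _ => Logic.I) N1)
    (nbhs_joint_compact openOmega cL cL LO LO N2).
move=> Lzeta Lz.
have [reg Hc] := H2 zeta z Lzeta Lz.
have near_le t : (t <= s)%N -> \forall x \near joint f (closure Omega) zeta z,
    forall l, (l <= t)%N ->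
    (cdist (pade_deriv x.1 p q x.2.1 l x.2.2) (dext Omega x.1 l x.2.2) < s.+1%:R^-1%:E)%E.
  have near1 l : (l <= s)%N -> \forall x \near joint f (closure Omega) zeta z,
      (cdist (pade_deriv x.1 p q x.2.1 l x.2.2) (dext Omega x.1 l x.2.2) < s.+1%:R^-1%:E)%E.
    by move=> ls; apply: near_cdist (LO _ Lzeta) (LO _ Lz) reg (Hc l ls).
  elim: t => [|t IH] ts.
    by apply: filterS (near1 0%N ts) => x Hx l; rewrite leqn0 => /eqP ->.
  apply: filterS (filterI (near1 _ ts) (IH (ltnW ts))) => x [Hx IHx] l.
  by rewrite leq_eqVlt => /orP[/eqP ->//|]; rewrite ltnS; exact: IHx.
exact: (filterI (near_pade_regular _ (LO _ Lzeta) reg) (near_le _ (leqnn s))).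
Qed.

(** [k] encodes a compact set [outside m], two polynomials over Q(i) and an index [s]; codes that
    name nothing, or a zero denominator, impose no condition. *)
Definition level k : set (Ainf Omega) :=
  if (unpickle k : option (nat * (seq (rat * rat) * seq (rat * rat)) * nat)) is Some (m, (a, b), s)
  then [set f | gauss_poly (R := R) b != 0 -> exists p q, F (p, q) /\
         approximant (outside m) (gauss_poly a) (gauss_poly b) s f p q]
  else setT.

Lemma nbhs_level k f : level k f -> nbhs f (level k).
Proof.
rewrite /level; case: unpickle => [[[m [a b]] s]|_]; last exact: filterT.
have [b0 _|b0 /(_ isT)[p [q [Fpq H]]]] := eqVneq (gauss_poly (R := R) b) 0.
  by apply: filterE => g /eqP.
apply: filterS (nbhs_approximant (compact_outside (m := m)) b0 H) => g Hg _.
by exists p, q.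
Qed.

Lemma rational_level k f m (e : R) : rational_on f -> 0 < e ->
  exists g, [/\ rational_on g, level k g & Ainf_near m e f g].
Proof.
move=> rf e0; rewrite /level; case: unpickle => [[[m' [a b]] s]|]; last first.
  exists f; split=> // l z _ _ _; rewrite subrr modulus0; exact: ltW.
have [b0|b0] := eqVneq (gauss_poly (R := R) b) 0.
  by exists f; split=> // l z _ _ _; rewrite subrr modulus0; exact: ltW.
have s0 : 0 < s.+1%:R^-1 :> R by rewrite invr_gt0.
pose t := Num.min e (s.+1%:R^-1 / 2).
have t0 : 0 < t by rewrite lt_min e0 divr_gt0.
have te : t <= e by rewrite ge_min lexx.
have ts : t < s.+1%:R^-1.
  by rewrite gt_min; apply/orP; right; rewrite ltr_pdivrMr // ltr_pMr // ltr1n.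
have [g [p [q [rg fg Fpq H]]]] := rational_density hF openOmega (gauss_poly a) m
  (@compact_outside m') (@outside_sub m') b0 rf t0.
exists g; split=> // [_|]; last exact: Ainf_near_le (leqnn m) te fg.
exists p, q; split=> //; split=> zeta z [_ clzeta] Hz; have [D E Hc Hd] := H zeta clzeta.
  split; first by split; [exact: D|exact: E].
  exact: le_lt_trans (Hc z Hz) ts.
split; first by split; [exact: D|exact: E].
move=> l _; rewrite (Hd z l Hz.2) /= subrr modulus0; exact: s0.
Qed.

Lemma pade_universal_level f : pade_universal F f -> forall k, level k f.
Proof.
move=> univ k; rewrite /level; case: unpickle => [[[m [a b]] s]|//] b0.
have [p [q [Fpq H]]] := univ _ (@compact_outside m) (@outside_sub m) (gauss_poly a) _ b0.
have sO : inside s `<=` closure Omega by move=> z [].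
have [nL [HD HE Hc Hd]] := H _ (@compact_inside s) sO.
have e0 : 0 < s.+1%:R^-1 :> R by rewrite invr_gt0.
have [N1 HN1] := (cvge0P (fun n => nnsup_ge0 _ _)).1 Hc _ e0.
(* The convergence is given for each order separately; only the orders up to [s] are needed, so one
   index serves them all. *)
have uniformly t : exists N, forall l n, (l <= t)%N -> (N <= n)%N ->
    (nnsup (inside s) (fun zeta => nnsup (inside s) (fun z =>
       cdist (pade_deriv f (p n) (q n) zeta l z) (dext Omega f l z))) < s.+1%:R^-1%:E)%E.
  elim: t => [|t [N IH]].
    have [N HN] := (cvge0P (fun n => nnsup_ge0 _ _)).1 (Hd 0%N) _ e0.
    by exists N => l n; rewrite leqn0 => /eqP -> /HN.
  have [N' HN'] := (cvge0P (fun n => nnsup_ge0 _ _)).1 (Hd t.+1) _ e0.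
  exists (maxn N N') => l n; rewrite geq_max leq_eqVlt ltnS => /orP[/eqP ->|lt] /andP[Nn N'n].
    exact: HN'.
  exact: IH.
have [N2 HN2] := uniformly s; pose n := maxn nL (maxn N1 N2).
have [nLn [N1n N2n]] : (nL <= n)%N /\ (N1 <= n)%N /\ (N2 <= n)%N.
  by rewrite !leq_max !leqnn !orbT.
exists (p n), (q n); split; first exact: Fpq.
split=> zeta z Hzeta Hz.
  split; first exact: conj (HD n zeta nLn Hzeta) (HE n zeta nLn Hzeta z (or_introl Hz)).
  have := le_lt_trans (nnsup_ubound _ Hzeta) (HN1 n N1n).
  by move=> /(le_lt_trans (nnsup_ubound _ Hz)); rewrite lte_fin.
split; first exact: conj (HD n zeta nLn Hzeta) (HE n zeta nLn Hzeta z (or_intror Hz)).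
move=> l ls; have := le_lt_trans (nnsup_ubound _ Hzeta) (HN2 l n ls N2n).
by move=> /(le_lt_trans (nnsup_ubound _ Hz)); apply.
Qed.

Lemma level_approximant f m P Q n : (forall k, level k f) -> Q != 0 ->
  exists p q, [/\ F (p, q),
    forall zeta z, inside n zeta -> outside m z -> pade_regular p q (f, (zeta, z)) /\
      chordal (pade_val f p q zeta z) (rat_val P Q z) <= 4 / n.+1%:R &
    forall zeta z, inside n zeta -> inside n z -> deriv_near p q n n.+1%:R^-1 (f, (zeta, z))].
Proof.
move=> lev Q0; set P1 := rat_num P Q; set P2 := rat_den P Q.
have P20 : P2 != 0 by exact: rat_den_neq0.
have P12 := @rat_num_den_coprime _ P Q Q0.
have cP12 : coprimep P1 P2 by rewrite coprimep_div_gcd // Q0 orbT.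
have [M M0 HM] := coprimep_pair_norm (@compact_outside m) cP12.
have n0 : 0 < n.+1%:R :> R by [].
have n1 : n.+1%:R^-1 <= 1 :> R by rewrite invf_le1 // ler1n.
(* With v = 1 / (n + 1) this gives [2 * d * M = v / 2]: small enough to exclude common zeros of the
   Gaussian pair on [outside m], and to keep the perturbed distance v (2 + v / 2) + v / 2 below 4
   v. *)
pose d := (4 * M * n.+1%:R)^-1.
have d0 : 0 < d by rewrite invr_gt0 !mulr_gt0.
have dM : 2 * d * M = n.+1%:R^-1 / 2 by rewrite /d; field; rewrite !gt_eqF.
have [a Ha] := gauss_poly_dense P1 (ler0n R m) d0.
have [b [b0 Hb]] := gauss_poly_dense_neq0 P20 (ler0n R m) d0.
have := lev (pickle (m, (a, b), n)); rewrite /level pickleK => /(_ b0)[p [q [Fpq [H1 H2]]]].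
exists p, q; split; [exact: Fpq|move=> zeta z Hzeta Hz|exact: H2].
have [reg Hc] := H1 zeta z Hzeta Hz; split; first exact: reg.
move: Hc; rewrite /pade_val (rat_valE reg.2) /= => Hc.
have az := Ha z Hz.1; have bz := Hb z Hz.1.
have nz : ~ ((gauss_poly a).[z] = 0 /\ (gauss_poly b).[z] = 0).
  move=> [a0 b0']; have := HM z Hz; rewrite leNgt => /negP; apply.
  apply: (@le_lt_trans _ _ (M * (d + d))).
    rewrite ler_wpM2l ?(ltW M0) //; apply: le_trans (pair_norm_le _ _) _.
    by move: az bz; rewrite a0 b0' !sub0r !modulusN => az bz; apply: lerD.
  have -> : M * (d + d) = 2 * d * M by ring.
  by rewrite dM; apply: le_lt_trans (_ : 1 / 2 < 1); [rewrite ler_pM2r|lra].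
rewrite (rat_valE nz) in Hc.
rewrite -[rat_val P Q z]/(ratio P1.[z] P2.[z]).
apply: le_trans (chordal_perturbation reg.2 (P12 z) nz _ _ (HM z Hz)) _.
- by rewrite modulus_distC; exact: az.
- by rewrite modulus_distC; exact: bz.
rewrite dM; move: Hc; move: (chordal _ _) => x Hx.
have v0 : 0 < n.+1%:R^-1 :> R by rewrite invr_gt0.
move: Hx v0 n1; move: (n.+1%:R^-1 : R) => v Hx v0 v1.
apply: (@le_trans _ _ (v * (2 + v / 2) + v / 2)).
  rewrite lerD2r ler_wpM2r //; lra.
have : v * (2 + v / 2) <= v * 3 by rewrite ler_wpM2l //; lra.
lra.
Qed.

Lemma level_pade_universal f : (forall k, level k f) -> pade_universal F f.
Proof.
move=> lev K cK KO P Q Q0; have [m Km] := exists_outside cK KO.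
(* The pair of index [n] is chosen for [inside n], before any [L] is given; every [L] lies in
   [inside n] from some [n] on. *)
have /choice[pq Hpq] n : exists pq : nat * nat, [/\ F (pq.1, pq.2),
    forall zeta z, inside n zeta -> outside m z -> pade_regular pq.1 pq.2 (f, (zeta, z)) /\
      chordal (pade_val f pq.1 pq.2 zeta z) (rat_val P Q z) <= 4 / n.+1%:R &
    forall zeta z, inside n zeta -> inside n z ->
      deriv_near pq.1 pq.2 n n.+1%:R^-1 (f, (zeta, z))].
  have [p [q H]] := @level_approximant f m P Q n lev Q0.
  by exists (p, q); exact: H.
exists (fun n => (pq n).1), (fun n => (pq n).2); split=> [n|L cL LO]; first by case: (Hpq n).
have [N HN] := exists_inside cL LO; exists N.
have small (c e : R) : 0 < c -> 0 < e -> exists N', forall n, (N' <= n)%N -> c / n.+1%:R < e.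
  move=> c0 e0; exists (Num.bound (c / e)) => n Nn.
  rewrite ltr_pdivrMr // mulrC -ltr_pdivrMr //.
  apply: lt_trans (archi_boundP (ltW (divr_gt0 c0 e0))) _; rewrite ltr_nat.
  by rewrite ltnS.
split.
- move=> n zeta Nn Lzeta; have [_ _ H] := Hpq n.
  by have [[] ] := H zeta zeta (HN n Nn _ Lzeta) (HN n Nn _ Lzeta).
- move=> n zeta Nn Lzeta z [Kz|Lz]; have [_ H1 H2] := Hpq n.
    by have [[_ E] _] := H1 zeta z (HN n Nn _ Lzeta) (Km z Kz); exact: E.
  by have [[_ E] _] := H2 zeta z (HN n Nn _ Lzeta) (HN n Nn _ Lz); exact: E.
- apply/(cvge0P (fun n => nnsup_ge0 _ _)) => e e0.
  have [N' HN'] := small 4 e (ltr0n _ 4) e0; exists (maxn N N') => n.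
  rewrite geq_max => /andP[Nn N'n]; have [_ H1 _] := Hpq n.
  have c0 : 0 <= 4 / n.+1%:R :> R by rewrite divr_ge0.
  apply: (@le_lt_trans _ _ (4 / n.+1%:R)%:E); last by rewrite lte_fin HN'.
  apply: (nnsup_le c0) => zeta Lzeta; apply: (nnsup_le c0) => z Kz.
  by rewrite lee_fin; have [] := H1 zeta z (HN n Nn _ Lzeta) (Km z Kz).
move=> l; apply/(cvge0P (fun n => nnsup_ge0 _ _)) => e e0.
have [N' HN'] := small 1 e ltr01 e0; exists (maxn (maxn N l) N') => n.
rewrite !geq_max => /andP[/andP[Nn ln] N'n]; have [_ _ H2] := Hpq n.
have c0 : 0 <= 1 / n.+1%:R :> R by rewrite divr_ge0.
apply: (@le_lt_trans _ _ (1 / n.+1%:R)%:E); last by rewrite lte_fin HN'.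
apply: (nnsup_le c0) => zeta Lzeta; apply: (nnsup_le c0) => z Lz; apply: ltW.
by have [_ /(_ l ln)] := H2 zeta z (HN n Nn _ Lzeta) (HN n Nn _ Lz); rewrite div1r.
Qed.

Lemma pade_universalP f : pade_universal F f <-> forall k, level k f.
Proof. by split; [exact: pade_universal_level|exact: level_pade_universal]. Qed.

Lemma dense_pade_universal : dense [set f : set_type (Xinf Omega) | pade_universal F (set_val f)].
Proof.
move=> W [x Wx] [V oV VW].
have Vx : V (set_val x) by move: Wx; rewrite -VW.
(* An open set of [Xinf] is the trace of an open [V], which meets the rational functions because
   [Xinf] is their closure. *)
have [f [rf Vf]] : @rational_on R Omega `&` V !=set0.
  have /set_mem clx := valP x; apply: clx; exact: open_nbhs_nbhs.
have /(nbhs_AinfP openOmega)[m [e e0 He]] : nbhs f V by exact: open_nbhs_nbhs.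
have [g [Xg gl fg]] := baire_rational openOmega nbhs_level rational_level m rf e0.
exists (SigSub (mem_set Xg)); split; last exact/pade_universalP.
by rewrite -VW; exact: He.
Qed.

Lemma Gdelta_pade_universal :
  Gdelta [set f : set_type (Xinf Omega) | pade_universal F (set_val f)].
Proof.
exists (fun k => set_val @^-1` level k) => [k|].
  exists (level k) => //; rewrite openE => f; exact: nbhs_level.
apply/seteqP; split=> f; first by move=> /pade_universalP H k _; exact: H.
by move=> H; apply/pade_universalP => k; exact: H.
Qed.

Lemma exists_pade_universal :
  exists f : set_type (Xinf Omega), pade_universal F (set_val f).
Proof.
have one0 (z : C) : closure Omega z -> (1 : {poly C}).[z] != 0.
  by move=> _; rewrite hornerC oner_neq0.
have [f0 f0E] := exists_rat_Ainf openOmega 0 one0.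
have r0 : rational_on f0 by exists 0, 1; split; [exact: oner_neq0|split; [exact: one0|exact: f0E]].
(* Density is applied to the whole space, which contains the zero function and so is not empty. *)
have [f [_ Hf]] := dense_pade_universal (O := setT)
  (ex_intro _ (SigSub (mem_set (subset_closure r0))) Logic.I) openT.
by exists f.
Qed.

End UniversalFunctions.

Theorem theorem3p3 (R : realType) (F : set (nat * nat))
    (hF : exists pt qt : nat -> nat,
      [/\ forall n, F (pt n, qt n),
          pt n @[n --> \oo] --> \oo
        & qt n @[n --> \oo] --> \oo])
    (Omega : set (Cplx R)) (openOmega : open Omega) :
  (exists f : set_type (Xinf Omega), pade_universal F (set_val f)) /\
  dense [set f : set_type (Xinf Omega) | pade_universal F (set_val f)] /\
  Gdelta [set f : set_type (Xinf Omega) | pade_universal F (set_val f)].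
Proof.
split; first exact: exists_pade_universal.
by split; [exact: dense_pade_universal|exact: Gdelta_pade_universal].
Qed.
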